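(* Let $n,g\ge1$, $S\in\Lambda_g^+$, $l,l'\in\Lambda_n^+$ and $r,r'\in M_{n,g}(\mathbb Z)$ with $4l-rS^{-1}r^t>0$. Then, as $k$ runs over even integers, $$\lim_{k\to\infty}C(l',r';P^{l,r}_{k,S})=\delta_S(l,r;\,l',r'),$$ where $$\delta_S(l,r;l',r')=\#\Big\{(A,\lambda)\in\mathrm{GL}_n(\mathbb Z)\times M_{g,n}(\mathbb Z):\ B^t\begin{pmatrix}l&r/2\\ r^t/2&S\end{pmatrix}B=\begin{pmatrix}l'&r'/2\\ r'^t/2&S\end{pmatrix},\ B=\begin{pmatrix}A&0\\ \lambda&I_g\end{pmatrix}\Big\}.$$
   Context: $\Lambda_m^+$ is the set of symmetric positive-definite half-integral $m\times m$ matrices (diagonal entries in $\mathbb Z$, off-diagonal entries in $\frac12\mathbb Z$); $\mathbb H_n$ is the Siegel upper half-space of degree $n$; $e(x)=e^{2\pi ix}$. The Heisenberg group is $H^{n,g}_{\mathbb Z}=\{[(\lambda,\mu),\kappa]:\lambda,\mu\in M_{g,n}(\mathbb Z),\kappa\in M_g(\mathbb Z),\kappa+\mu\lambda^t \text{ symmetric}\}$ with product $[(\lambda_1,\mu_1),\kappa_1]\cdot[(\lambda_2,\mu_2),\kappa_2]=[(\lambda_1+\lambda_2,\mu_1+\mu_2),\kappa_1+\kappa_2+\lambda_1\mu_2^t-\mu_1\lambda_2^t]$, and the Jacobi group is $\Gamma^J_{n,g}=\mathrm{Sp}_n(\mathbb Z)\ltimes H^{n,g}_{\mathbb Z}$ with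 $(M_1,X_1)(M_2,X_2)=(M_1M_2,(X_1M_2)\cdot X_2)$, where $[(\lambda,\mu),\kappa]M=[(\lambda,\mu)M,\kappa]$. For $\gamma=(M,[(\lambda,\mu),\kappa])$ with $M=\begin{pmatrix}a&b\\c&d\end{pmatrix}$, and $\phi$ a function on $\mathbb H_n\times M_{g,n}(\mathbb C)$, put $w=z+\lambda\tau+\mu$ and $$(\phi|_{k,S}\gamma)(\tau,z)=\det(c\tau+d)^{-k}\,e\Big(\mathrm{tr}\,S\big(-w(c\tau+d)^{-1}c\,w^t+\lambda\tau\lambda^t+2\lambda z^t+\kappa+\mu\lambda^t\big)\Big)\,\phi\big((a\tau+b)(c\tau+d)^{-1},\,w(c\tau+d)^{-1}\big).$$ The Jacobi Poincaré series is $$P^{l,r}_{k,S}(\tau,z)=\sum_{\gamma\in\Gamma^J_{\infty}\backslash\Gamma^J_{n,g}}\big(e(\mathrm{tr}(l\tau+rz))\big)\big|_{k,S}\gamma,\qquad \Gamma^J_\infty=\Big\{\Big(\begin{pmatrix}1_n&s\\0&1_n\end{pmatrix},[(0,\mu),\kappa]\Big)\in\Gamma^J_{n,g}\Big\},$$ which for $k>2n+g$ converges to a Jacobi cusp form of weight $k$ and index $S$. It has a Fourier expansion $\sum_{T,R}C(T,R;P^{l,r}_{k,S})\,e(\mathrm{tr}(T\tau+Rz))$ over $T\in\Lambda_n^+$, $R\in M_{n,g}(\mathbb Z)$ with $4T-RS^{-1}R^t>0$; $C(l',r';P)$ denotes its $(l',r')$-th coefficient (zero if $(l',r')$ does not occur).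 *)

(* Defs.v *)
From HB Require Import structures.
From mathcomp Require Import all_boot all_order all_algebra.
From mathcomp Require Import finmap complex.
From mathcomp Require Import all_classical all_reals all_analysis.
Import Order.TTheory GRing.Theory Num.Theory.
Import numFieldNormedType.Exports.

Set Implicit Arguments.
Unset Strict Implicit.
Unset Printing Implicit Defensive.

Local Open Scope classical_set_scope.
Local Open Scope ring_scope.
Local Open Scope complex_scope.

Definition posdef (R : realType) (m : nat) (A : 'M[R]_m) : Prop :=
  A^T = A /\ forall x : 'rV[R]_m, x != 0 -> 0 < (x *m A *m x^T) 0 0.

Definition Lambda_pos (R : realType) (m : nat) : set 'M[R]_m :=
  [set T | [/\ posdef T, forall i, T i i \is a Num.int
             & forall i j, T i j *+ 2 \is a Num.int]].

Definition siegel (R : realType) (n : nat) : set 'M[R[i]]_n :=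
  [set tau | tau^T = tau /\ posdef (map_mx (@complex.Im R) tau)].

(* e(x) = exp (2 pi i x) *)
Definition e (R : realType) (x : R[i]) : R[i] :=
  (expR (- (2 * pi * complex.Im x)))%:C *
  (cos (2 * pi * complex.Re x) +i* sin (2 * pi * complex.Re x)).

Definition mxZ (R : realType) (p q : nat) (A : 'M[int]_(p, q)) :
  'M[R[i]]_(p, q) := map_mx intr A.
Definition mxR (R : realType) (p q : nat) (A : 'M[R]_(p, q)) :
  'M[R[i]]_(p, q) := map_mx (real_complex R) A.

(* Unordered summation over a possibly infinite index set; since R[i] is
   finite-dimensional, this amounts to absolute convergence. *)
Definition has_sum (R : realType) (I : choiceType) (D : set I) (f : I -> R[i])
    (s : R[i]) : Prop :=
  forall eps : R, 0 < eps -> exists2 F : set I, fsets D F &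
    forall G : set I, fsets D G -> F `<=` G ->
      `| \sum_(i \in G) f i - s | < eps%:C.

(* (M, [(lambda, mu), kappa]) is encoded as (M, (lambda, mu, kappa)). *)
Notation heis n g := ('M[int]_(g, n) * 'M[int]_(g, n) * 'M[int]_g)%type.
Notation jacobi n g := ('M[int]_(n + n) * heis n g)%type.

Definition heis_mul (n g : nat) (X1 X2 : heis n g) : heis n g :=
  let: (lam1, mu1, kap1) := X1 in
  let: (lam2, mu2, kap2) := X2 in
  (lam1 + lam2, mu1 + mu2, kap1 + kap2 + lam1 *m mu2^T - mu1 *m lam2^T).

Definition heis_act (n g : nat) (X : heis n g) (M : 'M[int]_(n + n)) :
    heis n g :=
  let: (lam, mu, kap) := X in
  let lm := row_mx lam mu *m M in (lsubmx lm, rsubmx lm, kap).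

Definition jacobi_mul (n g : nat) (x1 x2 : jacobi n g) : jacobi n g :=
  (x1.1 *m x2.1, heis_mul (heis_act x1.2 x2.1) x2.2).

Definition Sp (n : nat) : set 'M[int]_(n + n) :=
  let J := block_mx 0 1%:M (- 1%:M) 0 in [set M | M^T *m J *m M = J].

Definition heisZ (n g : nat) : set (heis n g) :=
  [set X | let: (lam, mu, kap) := X in
           (kap + mu *m lam^T)^T = kap + mu *m lam^T].

Definition Gamma_J (n g : nat) : set (jacobi n g) :=
  [set x | Sp x.1 /\ heisZ x.2].

Definition Gamma_J_inf (n g : nat) : set (jacobi n g) :=
  [set x | Gamma_J x /\ exists s mu kap,
             x = (block_mx 1%:M s 0 1%:M, (0, mu, kap))].

Definition Gcoset (n g : nat) (x : jacobi n g) : set (jacobi n g) :=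
  [set jacobi_mul d x | d in @Gamma_J_inf n g].

Definition Gcosets (n g : nat) : set (set (jacobi n g)) :=
  [set Gcoset x | x in @Gamma_J n g].

Definition slash (R : realType) (n g k : nat) (S : 'M[R]_g)
    (x : jacobi n g) (phi : 'M[R[i]]_n -> 'M[R[i]]_(g, n) -> R[i])
    (tau : 'M[R[i]]_n) (z : 'M[R[i]]_(g, n)) : R[i] :=
  let: (M, (lam, mu, kap)) := x in
  let a := mxZ R (ulsubmx M) in let b := mxZ R (ursubmx M) in
  let c := mxZ R (dlsubmx M) in let d := mxZ R (drsubmx M) in
  let lam := mxZ R lam in let mu := mxZ R mu in let kap := mxZ R kap in
  let j := c *m tau + d in
  let w := z + lam *m tau + mu in
  (\det j) ^- k *
  e (\tr (mxR S *m (- (w *m invmx j *m c *m w^T) + lam *m tau *m lam^T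
                    + (lam *m z^T) *+ 2 + kap + mu *m lam^T))) *
  phi ((a *m tau + b) *m invmx j) (w *m invmx j).

Definition expTR (R : realType) (n g : nat) (T : 'M[R]_n) (r : 'M[int]_(n, g))
    (tau : 'M[R[i]]_n) (z : 'M[R[i]]_(g, n)) : R[i] :=
  e (\tr (mxR T *m tau + mxZ R r *m z)).

(* The summand does not depend on the representative of the coset picked by
   xget; the outer xget returns the sum when the series converges, and 0
   otherwise. *)
Definition poincare (R : realType) (n g k : nat) (S : 'M[R]_g) (l : 'M[R]_n)
    (r : 'M[int]_(n, g)) (tau : 'M[R[i]]_n) (z : 'M[R[i]]_(g, n)) : R[i] :=
  xget 0 [set s | has_sum (@Gcosets n g)
    (fun X => slash k S (xget (1%:M, (0, 0, 0)) X) (expTR l r) tau z) s].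

Definition disc (R : realType) (n g : nat) (S : 'M[R]_g) (T : 'M[R]_n)
    (r : 'M[int]_(n, g)) : 'M[R]_n :=
  T *+ 4 - map_mx intr r *m invmx S *m (map_mx intr r)^T.

Definition cusp_index (R : realType) (n g : nat) (S : 'M[R]_g) :
    set ('M[R]_n * 'M[int]_(n, g)) :=
  [set p | Lambda_pos p.1 /\ posdef (disc S p.1 p.2)].

Definition fourier_expansion (R : realType) (n g : nat) (S : 'M[R]_g)
    (f : 'M[R[i]]_n -> 'M[R[i]]_(g, n) -> R[i])
    (C : 'M[R]_n * 'M[int]_(n, g) -> R[i]) : Prop :=
  (forall p, ~ cusp_index S p -> C p = 0) /\
  forall tau z, siegel tau ->
    has_sum (cusp_index S) (fun p => C p * expTR p.1 p.2 tau z) (f tau z).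

(* Such an expansion is unique when it exists; the default value is only
   reached by functions without any expansion. *)
Definition fourier_coef (R : realType) (n g : nat) (S : 'M[R]_g)
    (f : 'M[R[i]]_n -> 'M[R[i]]_(g, n) -> R[i])
    (T : 'M[R]_n) (r : 'M[int]_(n, g)) : R[i] :=
  xget (fun=> 0) [set C | fourier_expansion S f C] (T, r).

Definition index_mx (R : realType) (n g : nat) (S : 'M[R]_g) (l : 'M[R]_n)
    (r : 'M[int]_(n, g)) : 'M[R]_(n + g) :=
  let r2 := 2^-1 *: map_mx intr r in block_mx l r2 r2^T S.

Definition delta_set (R : realType) (n g : nat) (S : 'M[R]_g)
    (l : 'M[R]_n) (r : 'M[int]_(n, g)) (l' : 'M[R]_n) (r' : 'M[int]_(n, g)) :
    set ('M[int]_n * 'M[int]_(g, n)) :=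
  [set p | p.1 \in unitmx /\
    let B : 'M[R]_(n + g) :=
      block_mx (map_mx intr p.1) 0 (map_mx intr p.2) 1%:M in
    B^T *m index_mx S l r *m B = index_mx S l' r'].

(* The set is finite when S > 0 and 4 l - r S^-1 r^t > 0, so the convention
   fset_set A = fset0 for infinite A plays no role. *)
Definition delta (R : realType) (n g : nat) (S : 'M[R]_g)
    (l : 'M[R]_n) (r : 'M[int]_(n, g)) (l' : 'M[R]_n) (r' : 'M[int]_(n, g)) :
    nat := #|` fset_set (delta_set S l r l' r')|%fset.

(* Main.v *)
(* Put Z = (tau, z^t; z, tau2), a point of the Siegel half-space of degree
   p = n + g. The Jacobi group embeds into Sp_p, and multiplication by
   e(tr(S tau2)) turns the Poincare series into a sum over bottom rows (C, D) of
   det(CZ + D)^(-2K) e(tr(L W)), with L = (l, r/2; r^t/2, S) and W the image of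
   Z. Since Im W > 0 has determinant det(Im Z) |det(CZ + D)|^-2 and L > 0, each
   term is at most a constant times tr((Im W)^-1)^(-N) for every N <= K, which
   gives absolute convergence.

   The Fourier coefficients are means over real translates; they do not depend on
   the imaginary part, because the function is a uniform limit of polynomials on
   small discs. At Im Z = K the terms with C <> 0 contribute
   O(K^(-2K + O(1)) c^K), while the terms with C = 0 are the characters
   e(tr(B^t L B Z)), of which the mean counts those with B^t L B equal to the
   index matrix of (l', r'). *)
Require Import Defs.
From HB Require Import structures.
From mathcomp Require Import all_boot all_order all_algebra.
From mathcomp Require Import finmap perm complex ring lra zify.
From mathcomp Require Import all_classical all_reals all_analysis.
Import Order.TTheory GRing.Theory Num.Theory.
Import numFieldNormedType.Exports.
Set Implicit Arguments.
Unset Strict Implicit.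
Unset Printing Implicit Defensive.

Local Open Scope classical_set_scope.
Local Open Scope ring_scope.
Local Open Scope complex_scope.

(** [poincare] and [fourier_coef] pick their values by [xget], so an estimate means nothing before
    convergence, existence of an expansion and its uniqueness are proved. Existence is the delicate
    part: Fourier analysis gives a series over all integer matrices q, whose support has to be cut
    down to [cusp_index]. Real translations with a known multiplier force q to be twice an index
    matrix with lower right block S. Positivity follows by moving the imaginary part to infinity
    along a rank one direction, where a non-positive index keeps the character bounded below while
    the function decays. The gain K^(-2K) has two sources. At Im Z = K the factor det(Im Z)^(-K) is
    K^(-pK), and the maximum of s^((p-1)K) e^(-as) gives back only K^((p-1)K) up to c^K. When C <>
    0, the trace of (Im W)^-1 is at least K, which gives another K^(-K), up to a fixed power
    reserved for summing over (C, D). Dividing by the character costs exp(2 pi K tr L'), which is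
    only c^K. *)

(** * Real-valued modulus on [R[i]] and the exponential [e] *)

Section ComplexNorm.
Variable R : realType.
Implicit Types (x y z : R[i]) (a b : R).

(** The norm of [R[i]] has values in [R[i]]; its real part lets every estimate be made in the
    ordered field [R], where [lra] and [nra] work. *)
Definition nm (z : R[i]) : R := complex.Re `|z|.

Lemma normr_nm z : `|z| = (nm z)%:C.
Proof. by rewrite /nm normc_def. Qed.

Lemma nmE z : nm z = Num.sqrt (complex.Re z ^+ 2 + complex.Im z ^+ 2).
Proof. by rewrite /nm normc_def. Qed.

Lemma nm_ge0 z : 0 <= nm z.
Proof. by rewrite -ler0c -normr_nm. Qed.

Lemma nm0 : nm 0 = 0. Proof. by rewrite /nm normr0. Qed.
Lemma nm1 : nm 1 = 1. Proof. by rewrite /nm normr1. Qed.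
Lemma nmN z : nm (- z) = nm z. Proof. by rewrite /nm normrN. Qed.
Lemma nmBC x y : nm (x - y) = nm (y - x). Proof. by rewrite /nm distrC. Qed.

Lemma nmM x y : nm (x * y) = nm x * nm y.
Proof. by apply: complexI; rewrite rmorphM /= -!normr_nm normrM. Qed.

Lemma nmX x k : nm (x ^+ k) = nm x ^+ k.
Proof. by elim: k => [|k IH]; rewrite ?nm1 // !exprS nmM IH. Qed.

Lemma nm_eq0 z : (nm z == 0) = (z == 0).
Proof. by rewrite -(inj_eq (@complexI R)) -normr_nm normr_eq0. Qed.

Lemma nm_gt0 z : (0 < nm z) = (z != 0).
Proof. by rewrite lt_def nm_ge0 andbT nm_eq0. Qed.

Lemma nmV z : nm z^-1 = (nm z)^-1.
Proof.
by apply: complexI; rewrite fmorphV /= -!normr_nm normfV.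
Qed.

Lemma nmR a : nm a%:C = `|a|.
Proof. by rewrite nmE /= expr0n /= addr0 sqrtr_sqr. Qed.

Lemma nm_nat k : nm k%:R = k%:R.
Proof. by rewrite -(rmorph_nat (real_complex R)) nmR normr_nat. Qed.

Lemma nmD x y : nm (x + y) <= nm x + nm y.
Proof. by rewrite -lecR rmorphD /= -!normr_nm ler_normD. Qed.

Lemma nmB x y : nm (x - y) <= nm x + nm y.
Proof. by rewrite (le_trans (nmD _ _))// nmN. Qed.

Lemma nm_sub x y z : nm (x - z) <= nm (x - y) + nm (y - z).
Proof. by rewrite (le_trans _ (nmD _ _))// addrA subrK. Qed.

Lemma nm_sum I (r : seq I) (P : pred I) (F : I -> R[i]) :
  nm (\sum_(i <- r | P i) F i) <= \sum_(i <- r | P i) nm (F i).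
Proof.
elim/big_rec2: _ => [|i y x _ h]; first by rewrite nm0.
by rewrite (le_trans (nmD _ _))// lerD2l.
Qed.

Lemma ler_Re_nm z : `|complex.Re z| <= nm z.
Proof. by rewrite nmE -sqrtr_sqr ler_wsqrtr// lerDl sqr_ge0. Qed.

Lemma ler_Im_nm z : `|complex.Im z| <= nm z.
Proof. by rewrite nmE -sqrtr_sqr ler_wsqrtr// lerDr sqr_ge0. Qed.

Lemma nm_i : nm 'i = 1 :> R.
Proof. by rewrite nmE /= expr0n expr1n add0r sqrtr1. Qed.

Lemma nm_le_ReIm z : nm z <= `|complex.Re z| + `|complex.Im z|.
Proof.
by rewrite {1}(complexE z) (le_trans (nmD _ _))// nmM nm_i mul1r !nmR.
Qed.

Lemma nm_conj z : nm z^* = nm z.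
Proof. by rewrite /nm normcJ. Qed.

Lemma ltc_nm z a : (`|z| < a%:C) = (nm z < a).
Proof. by rewrite normr_nm ltcR. Qed.

Lemma ReD x y : complex.Re (x + y) = complex.Re x + complex.Re y.
Proof. by case: x y => ? ? [? ?]. Qed.
Lemma ImD x y : complex.Im (x + y) = complex.Im x + complex.Im y.
Proof. by case: x y => ? ? [? ?]. Qed.
Lemma ReN x : complex.Re (- x) = - complex.Re x.
Proof. by case: x. Qed.
Lemma ImN x : complex.Im (- x) = - complex.Im x.
Proof. by case: x. Qed.
Lemma Re_sum I (r : seq I) (P : pred I) (F : I -> R[i]) :
  complex.Re (\sum_(i <- r | P i) F i) = \sum_(i <- r | P i) complex.Re (F i).
Proof. exact: (big_morph _ ReD). Qed.
Lemma Im_sum I (r : seq I) (P : pred I) (F : I -> R[i]) :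
  complex.Im (\sum_(i <- r | P i) F i) = \sum_(i <- r | P i) complex.Im (F i).
Proof. exact: (big_morph _ ImD). Qed.
Lemma ReM x y : complex.Re (x * y) =
  complex.Re x * complex.Re y - complex.Im x * complex.Im y.
Proof. by case: x y => ? ? [? ?]. Qed.
Lemma ImM x y : complex.Im (x * y) =
  complex.Re x * complex.Im y + complex.Im x * complex.Re y.
Proof. by case: x y => ? ? [? ?]. Qed.
Lemma complexP x y : complex.Re x = complex.Re y ->
  complex.Im x = complex.Im y -> x = y.
Proof. by case: x y => ? ? [? ?] /= -> ->. Qed.

Lemma e0 : e (0 : R[i]) = 1.
Proof. by rewrite /e /= !mulr0 oppr0 expR0 cos0 sin0 mul1r. Qed.

Lemma eD x y : e (x + y) = e x * e y.
Proof.
rewrite /e ReD ImD !mulrDr opprD expRD cosD sinD.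
by apply: complexP; rewrite !(ReM, ImM) /=; ring.
Qed.

Lemma nm_e x : nm (e x) = expR (- (2 * pi * complex.Im x)).
Proof.
rewrite /e nmM nmR ger0_norm ?expR_ge0// nmE /=.
by rewrite cos2Dsin2 sqrtr1 mulr1.
Qed.

Lemma e_neq0 x : e x != 0.
Proof. by rewrite -nm_gt0 nm_e expR_gt0. Qed.

Lemma eN x : e (- x) = (e x)^-1.
Proof.
by apply: (mulIf (e_neq0 x)); rewrite -eD addNr e0 mulVf// e_neq0.
Qed.

Lemma eB x y : e (x - y) = e x / e y.
Proof. by rewrite eD eN. Qed.

Lemma e1 : e (1 : R[i]) = 1.
Proof.
by rewrite /e /= !mulr0 oppr0 expR0 mul1r mulr1 mulr_natl cos2pi sin2pi.
Qed.

Lemma e_nat k : e (k%:R : R[i]) = 1.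
Proof. by elim: k => [|k IH]; rewrite ?e0// -natr1 eD IH e1 mulr1. Qed.

Lemma e_int (k : int) : e (k%:~R : R[i]) = 1.
Proof.
case: k => k; first by rewrite -pmulrn e_nat.
by rewrite NegzE mulrNz eN -pmulrn e_nat invr1.
Qed.

Lemma e_half : e (2^-1 : R[i]) = -1.
Proof.
have -> : (2^-1 : R[i]) = (2^-1)%:C by rewrite fmorphV rmorph_nat.
rewrite /e /= !mulr0 oppr0 expR0 mul1r mulrAC divff// mul1r cospi sinpi.
by apply: complexP; rewrite /= ?oppr0.
Qed.

Lemma nm_eR a : nm (e a%:C) = 1.
Proof. by rewrite nm_e /= mulr0 oppr0 expR0. Qed.

End ComplexNorm.

(** * Unordered sums: existence, uniqueness, truncation, reindexing *)

Definition subD (I : choiceType) (D : set I) (G : {fset I}) : Prop :=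
  forall i, i \in G -> D i.

(** Summability of a nonnegative b with total at most B, expressed through finite partial sums so
    that the total itself need not be named. *)
Definition sum_le (R : realType) (I : choiceType) (D : set I) (b : I -> R)
    (B : R) : Prop :=
  forall G : {fset I}, subD D G -> \sum_(i <- G) b i <= B.

Section HasSum.
Variables (R : realType).
Local Notation C := R[i].

Lemma subDU (I : choiceType) (D : set I) (F G : {fset I}) :
  subD D F -> subD D G -> subD D (F `|` G)%fset.
Proof. by move=> hF hG i; rewrite inE => /orP[/hF|/hG]. Qed.

Lemma subD_sub (I : choiceType) (D : set I) (F G : {fset I}) :
  (F `<=` G)%fset -> subD D G -> subD D F.
Proof. by move=> /fsubsetP FG hG i /FG /hG. Qed.

Lemma big_fsetD (V : zmodType) (I : choiceType) (F G : {fset I}) (f : I -> V) :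
  (F `<=` G)%fset ->
  \sum_(i <- G) f i - \sum_(i <- F) f i = \sum_(i <- (G `\` F)%fset) f i.
Proof.
move=> FG; rewrite [X in X - _](big_fsetID _ (mem F)) /=.
rewrite (_ : [fset x in G | x \in F]%fset = F); last first.
  apply/fsetP => i; rewrite !inE /=.
  by case: (boolP (i \in F)) => [/(fsubsetP FG) ->|]; rewrite ?andbF.
rewrite (_ : [fset x in G | x \notin F]%fset = (G `\` F)%fset); last first.
  by apply/fsetP => i; rewrite !inE andbC.
by rewrite addrAC subrr add0r.
Qed.

(** Passes from the classical finite sets of [has_sum] to [{fset I}], where big operators and
    induction are at hand, and from the norm of [R[i]] to [nm]. *)
Lemma has_sumP (I : choiceType) (D : set I) (f : I -> C) (s : C) :
  has_sum D f s <->
  (forall eps : R, 0 < eps -> exists2 F : {fset I}, subD D F &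
    forall G : {fset I}, subD D G -> (F `<=` G)%fset ->
      nm (\sum_(i <- G) f i - s) < eps).
Proof.
split=> h eps /h [F].
  move=> [finF FD] hF; exists (fset_set F).
    by move=> i; rewrite in_fset_set// inE => /FD.
  move=> G GD /fsubsetP FG; rewrite -ltc_nm.
  have := hF [set` G]; rewrite fsbig_finite//= set_fsetK; apply.
    by split => //= i /= /GD.
  by move=> i Fi /=; apply: FG; rewrite in_fset_set// inE.
move=> FD hF; exists [set` F]; first by split => // i /= /FD.
move=> G [finG GD] FG; rewrite ltc_nm fsbig_finite//=; apply: hF.
  by move=> i; rewrite in_fset_set// inE => /GD.
by apply/fsubsetP => i iF; rewrite in_fset_set// inE; apply: FG.
Qed.

Lemma has_sum_uniq (I : choiceType) (D : set I) (f : I -> C) (s t : C) :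
  has_sum D f s -> has_sum D f t -> s = t.
Proof.
move=> /has_sumP hs /has_sumP ht; apply/eqP; rewrite -subr_eq0 -nm_eq0.
rewrite eq_le nm_ge0 andbT leNgt; apply/negP => st.
have e0 : 0 < nm (s - t) / 2 by rewrite divr_gt0.
have [F FD hF] := hs _ e0; have [G GD hG] := ht _ e0.
have FGD := subDU FD GD.
have := nm_sub s (\sum_(i <- (F `|` G)%fset) f i) t.
have := hF _ FGD (fsubsetUl _ _); have := hG _ FGD (fsubsetUr _ _).
rewrite nmBC [in X in X -> _]nmBC => h1 h2; rewrite [nm (s - \sum_(_ <- _) _)]nmBC.
move=> h3; move: h1 h2 h3; set a := nm _; set b := nm (_ - s); set c := nm (s - t).
by rewrite nmBC -/a; lra.
Qed.

Lemma eq_has_sum (I : choiceType) (D : set I) (f g : I -> C) (s : C) :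
  (forall i, D i -> f i = g i) -> has_sum D f s -> has_sum D g s.
Proof.
move=> fg /has_sumP h; apply/has_sumP => eps /h[F FD hF]; exists F => // G GD FG.
rewrite -(@eq_big_seq _ _ _ _ _ f) ?hF// => i /GD; exact: fg.
Qed.

Lemma has_sum_approx (I : choiceType) (D : set I) (f : I -> C) (s : C) (eps : R)
    (F0 : {fset I}) :
  has_sum D f s -> 0 < eps -> subD D F0 -> exists G : {fset I},
    [/\ subD D G, (F0 `<=` G)%fset & nm (\sum_(i <- G) f i - s) < eps].
Proof.
move=> /has_sumP h /h[F FD hF] F0D; exists (F0 `|` F)%fset.
have UD := subDU F0D FD.
by split; rewrite ?fsubsetUl//; apply: hF; rewrite ?fsubsetUr.
Qed.

Lemma has_sum_le (I : choiceType) (D : set I) (f : I -> C) (b : I -> R) (s : C)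
    (B : R) :
  (forall i, D i -> nm (f i) <= b i) -> sum_le D b B -> has_sum D f s ->
  nm s <= B.
Proof.
move=> fb hB hs; apply/ler_addgt0Pr => eps e0.
have [|G [GD _ hG]] := @has_sum_approx _ _ _ _ _ fset0 hs e0.
  by move=> i; rewrite inE.
have := nm_sub s (\sum_(i <- G) f i) 0; rewrite !subr0 nmBC => /le_trans; apply.
rewrite addrC lerD ?(ltW hG)//.
apply: (le_trans (nm_sum _ _ _)); apply: (le_trans _ (hB G GD)).
by rewrite big_seq [leRHS]big_seq ler_sum// => i /GD /fb.
Qed.

Lemma has_sumD (I : choiceType) (D : set I) (f g : I -> C) (s t : C) :
  has_sum D f s -> has_sum D g t -> has_sum D (fun i => f i + g i) (s + t).
Proof.
move=> /has_sumP hs /has_sumP ht; apply/has_sumP => eps e0.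
have e2 : 0 < eps / 2 by rewrite divr_gt0.
have [F FD hF] := hs _ e2; have [G GD hG] := ht _ e2.
exists (F `|` G)%fset; first exact: subDU.
move=> H HD; rewrite fsubUset => /andP[FH GH].
rewrite big_split/= opprD addrACA (le_lt_trans (nmD _ _))//.
by rewrite (splitr eps) ltrD ?hF ?hG.
Qed.

Lemma has_sumZ (I : choiceType) (D : set I) (f : I -> C) (s c : C) :
  has_sum D f s -> has_sum D (fun i => c * f i) (c * s).
Proof.
move=> /has_sumP hs; apply/has_sumP => eps e0.
have c0 : 0 < nm c + 1 by rewrite ltr_wpDl ?nm_ge0.
have [F FD hF] := hs _ (divr_gt0 e0 c0).
exists F => // G GD FG; rewrite -mulr_sumr -mulrBr nmM.
have := hF _ GD FG; rewrite ltr_pdivlMr// mulrC => /(le_lt_trans _); apply.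
by rewrite ler_wpM2r ?nm_ge0// lerDl.
Qed.

Lemma sum_leS (I : choiceType) (D : set I) (b : I -> R)
    (F G : {fset I}) : (forall i, D i -> 0 <= b i) ->
  subD D G -> (F `<=` G)%fset -> \sum_(i <- F) b i <= \sum_(i <- G) b i.
Proof.
move=> b0 GD FG; rewrite -subr_ge0 big_fsetD// big_seq sumr_ge0// => i.
by rewrite inE => /andP[_ /GD /b0].
Qed.

(** F has a partial sum within eps of the supremum of all partial sums, so whatever is disjoint from
    F can add less than eps. *)
Lemma sum_le_tail (I : choiceType) (D : set I) (b : I -> R) (B : R) :
  (forall i, D i -> 0 <= b i) -> sum_le D b B ->
  forall eps : R, 0 < eps -> exists2 F : {fset I}, subD D F &
    forall G : {fset I}, subD D G -> [disjoint F & G]%fset ->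
      \sum_(i <- G) b i < eps.
Proof.
move=> b0 hB eps e0.
pose E := [set x | exists2 F : {fset I}, subD D F & x = \sum_(i <- F) b i].
have ubE : has_sup E.
  split; last by exists B => _ [F FD ->]; exact: hB.
  by exists 0; exists fset0; rewrite ?big_seq_fset0// => i; rewrite inE.
have [_ [F FD ->] hF] := sup_adherent e0 ubE.
exists F => // G GD FG.
have UD := subDU FD GD.
have : \sum_(i <- (F `|` G)%fset) b i <= sup E.
  by apply: sup_upper_bound => //; exists (F `|` G)%fset.
have := big_fsetD b (fsubsetUl F G).
have -> : ((F `|` G) `\` F = G)%fset.
  apply/fsetP => i; rewrite !inE; case: (boolP (i \in F)) => //= iF.
  by rewrite (negbTE (fdisjointP FG _ iF)).
by lra.
Qed.

Lemma has_sum_nneg (I : choiceType) (D : set I) (b : I -> R) (B : R) :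
  (forall i, D i -> 0 <= b i) -> sum_le D b B ->
  exists s : R, has_sum D (fun i => (b i)%:C) s%:C.
Proof.
move=> b0 hB.
pose E := [set x | exists2 F : {fset I}, subD D F & x = \sum_(i <- F) b i].
have ubE : has_sup E.
  split; last by exists B => _ [F FD ->]; exact: hB.
  by exists 0; exists fset0; rewrite ?big_seq_fset0// => i; rewrite inE.
exists (sup E); apply/has_sumP => eps e0.
have [_ [F FD ->] hF] := sup_adherent e0 ubE.
exists F => // G GD FG; rewrite -rmorph_sum/= -rmorphB/= nmR.
have h1 : \sum_(i <- G) b i <= sup E.
  by apply: sup_upper_bound => //; exists G.
have h2 := sum_leS b0 GD FG.
by rewrite ler0_norm; lra.
Qed.

(** Monotone convergence applied to h + b and to b, both nonnegative, followed by a subtraction; h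
    is the real, then the imaginary part of f. *)
Lemma has_sum_ex (I : choiceType) (D : set I) (f : I -> C) (b : I -> R) (B : R) :
  (forall i, D i -> nm (f i) <= b i) -> sum_le D b B ->
  exists s : C, has_sum D f s.
Proof.
move=> fb hB.
have b0 i : D i -> 0 <= b i by move=> /fb; apply: le_trans; exact: nm_ge0.
have [s hs] := has_sum_nneg b0 hB.
have hB2 (h : I -> R) : (forall i, D i -> `|h i| <= b i) ->
    exists t : R, has_sum D (fun i => (h i)%:C) t%:C.
  move=> hb.
  have [||t ht] := @has_sum_nneg _ D (fun i => h i + b i) (B + B).
  - by move=> i /hb; rewrite ler_norml => /andP[? _]; lra.
  - move=> G GD; rewrite big_split lerD ?hB//; apply: le_trans (hB G GD).
    rewrite big_seq [leRHS]big_seq ler_sum// => i /GD /hb.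
    by rewrite ler_norml => /andP[].
  exists (t - s); rewrite rmorphB/=.
  have := has_sumD ht (has_sumZ (-1) hs); rewrite mulN1r; apply: eq_has_sum.
  by move=> i _; rewrite rmorphD/= mulN1r addrK.
have [i Di|t ht] := hB2 (fun i => complex.Re (f i)).
  by rewrite (le_trans (ler_Re_nm _)) ?fb.
have [i Di|u hu] := hB2 (fun i => complex.Im (f i)).
  by rewrite (le_trans (ler_Im_nm _)) ?fb.
exists (t%:C + 'i * u%:C); apply: eq_has_sum (has_sumD ht (has_sumZ 'i hu)).
by move=> i _; rewrite [RHS]complexE.
Qed.

(** F and eps depend on the majorant b alone, so the truncation is uniform in any parameter of f. *)
Lemma has_sum_tail (I : choiceType) (D : set I) (f : I -> C) (b : I -> R)
    (s : C) (eps : R) (F : {fset I}) :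
  (forall i, D i -> nm (f i) <= b i) -> subD D F ->
  (forall G : {fset I}, subD D G -> [disjoint F & G]%fset ->
      \sum_(i <- G) b i < eps) ->
  has_sum D f s -> nm (s - \sum_(i <- F) f i) <= eps.
Proof.
move=> fb FD hF hs; apply/ler_addgt0Pr => eta e0.
have [G [GD FG hG]] := has_sum_approx hs e0 FD.
rewrite (le_trans (nm_sub _ (\sum_(i <- G) f i) _))// addrC lerD//.
  rewrite big_fsetD// (le_trans (nm_sum _ _ _))//.
  have sD := subD_sub (fsubsetDl G F) GD.
  apply: (@le_trans _ _ (\sum_(i <- (G `\` F)%fset) b i)).
    by rewrite big_seq [leRHS]big_seq ler_sum// => i /sD /fb.
  apply/ltW/hF => //; apply/fdisjointP => i iF.
  by rewrite !inE iF.
by rewrite nmBC ltW.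
Qed.

Lemma has_sum_reindex (I J : choiceType) (D : set I) (E : set J) (h : I -> J)
    (f : J -> C) (s : C) :
  set_bij D E h -> has_sum D (f \o h) s <-> has_sum E f s.
Proof.
case=> hDE hinj hsurj.
have inj (G : {fset I}) : subD D G -> {in G &, injective h}.
  by move=> GD x y /GD xD /GD yD; apply: hinj; rewrite inE.
have sumG (G : {fset I}) : subD D G ->
    \sum_(i <- (h @` G)%fset) f i = \sum_(i <- G) (f \o h) i.
  by move=> GD; rewrite big_imfset//=; exact: inj.
have imD (G : {fset I}) : subD D G -> subD E (h @` G)%fset.
  by move=> GD _ /imfsetP[x /= /GD xD ->]; apply: hDE.
(* Finite subsets of E are lifted one element at a time, each element having a preimage by
   surjectivity. *)
have pre (G : {fset J}) : subD E G ->
    exists2 G' : {fset I}, subD D G' & (h @` G')%fset = G.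
  elim/finSet_rect: G => G IH GE.
  have [->|[j jG]] := fset_0Vmem G.
    by exists fset0; rewrite ?imfset0// => i; rewrite inE.
  have [|i /= iG|G' G'D G'E] := IH (G `\ j)%fset; first exact: fproperD1.
    by apply: GE; move: iG; rewrite !inE => /andP[].
  have [i Di hi] := hsurj _ (GE _ jG).
  exists (i |` G')%fset.
    by move=> x; rewrite !inE => /orP[/eqP ->//|/G'D].
  by rewrite imfsetU1 G'E hi fsetD1K.
split=> /has_sumP hs; apply/has_sumP => eps /hs[F FD hF].
  exists (h @` F)%fset; first exact: imD.
  move=> G /pre[G' G'D <-] FG; rewrite sumG//; apply: hF => //.
  apply/fsubsetP => i iF; have : h i \in (h @` G')%fset.
    by apply: (fsubsetP FG); apply/imfsetP; exists i.
  move=> /imfsetP[i' /= i'G] /hinj -> //; rewrite inE; [exact: FD|exact: G'D].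
have [F' F'D F'E] := pre F FD; exists F' => // G GD FG; rewrite -sumG//.
apply: hF; first exact: imD.
rewrite -F'E; apply/fsubsetP => _ /imfsetP[i /= iF ->]; apply/imfsetP; exists i => //.
exact: (fsubsetP FG).
Qed.

Lemma has_sum_sub (I : choiceType) (D E : set I) (f : I -> C) (s : C) :
  D `<=` E -> (forall i, E i -> ~ D i -> f i = 0) ->
  has_sum D f s <-> has_sum E f s.
Proof.
move=> DE f0.
have red (G : {fset I}) : subD E G -> exists2 G' : {fset I}, subD D G' &
    (G' `<=` G)%fset /\ (forall i, i \in G -> D i -> i \in G') /\
    \sum_(i <- G) f i = \sum_(i <- G') f i.
  move=> GE; exists [fset i in G | `[< D i >]]%fset.
    by move=> i; rewrite !inE /= => /andP[_ /asboolP].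
  split; first by apply/fsubsetP => i; rewrite !inE => /andP[].
  split; first by move=> i iG /asboolP Di; rewrite !inE /= iG.
  rewrite (big_fsetID _ [pred i | `[< D i >]]) /= [X in _ + X]big1_seq ?addr0//.
  by move=> i /=; rewrite !inE /= => /andP[/GE Ei /asboolPn]; exact: f0.
split=> /has_sumP hs; apply/has_sumP => eps /hs[F FD hF].
  exists F; first by move=> i /FD /DE.
  move=> G /red[G' G'D [_ [hG ->]]] FG; apply: hF => //; apply/fsubsetP => i iF.
  by apply: hG; [exact: (fsubsetP FG)|exact: FD].
have [F' F'D [F'F [hF' _]]] := red F FD; exists F' => // G GD FG.
have GFE : subD E (G `|` F)%fset.
  by apply: subDU => // i /GD /DE.
suff <- : \sum_(i <- (G `|` F)%fset) f i = \sum_(i <- G) f i.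
  by apply: hF => //; exact: fsubsetUr.
apply/eqP; rewrite -subr_eq0 big_fsetD ?fsubsetUl//; apply/eqP.
apply: big1_seq => i /=; rewrite !inE => /andP[iG /orP[|iF]].
  by rewrite (negbTE iG).
apply: f0; first exact: FD.
by move=> Di; move/negP: iG; apply; apply: (fsubsetP FG); exact: hF'.
Qed.

Lemma has_sum_fset (I : choiceType) (F : {fset I}) (f : I -> C) :
  has_sum [set` F] f (\sum_(i <- F) f i).
Proof.
apply/has_sumP => eps e0; exists F; first by move=> i.
move=> G GD FG; suff -> : G = F by rewrite subrr nm0.
by apply/eqP; rewrite eqEfsubset FG andbT; apply/fsubsetP => i /GD.
Qed.

Lemma sum_le_sub (I : choiceType) (D E : set I) (b : I -> R) (B : R) :
  D `<=` E -> sum_le E b B -> sum_le D b B.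
Proof. by move=> DE h G GD; apply: h => i /GD /DE. Qed.

Lemma sum_leZ (I : choiceType) (D : set I) (b : I -> R) (B c : R) :
  0 <= c -> sum_le D b B -> sum_le D (fun i => c * b i) (c * B).
Proof. by move=> c0 h G GD; rewrite -mulr_sumr ler_wpM2l// h. Qed.

Lemma sum_le_le (I : choiceType) (D : set I) (a b : I -> R) (B : R) :
  (forall i, D i -> a i <= b i) -> sum_le D b B -> sum_le D a B.
Proof.
move=> ab h G GD; apply: le_trans (h G GD).
by rewrite big_seq [leRHS]big_seq ler_sum// => i /GD /ab.
Qed.

Lemma sum_le_inj (I J : choiceType) (D : set I) (E : set J) (h : I -> J)
    (b : J -> R) (B : R) :
  (forall i, D i -> E (h i)) ->
  (forall i j, D i -> D j -> h i = h j -> i = j) ->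
  sum_le E b B -> sum_le D (b \o h) B.
Proof.
move=> hDE hinj hB G GD.
have <- : \sum_(i <- (h @` G)%fset) b i = \sum_(i <- G) (b \o h) i.
  by rewrite big_imfset//= => x y /GD xD /GD yD; apply: hinj.
by apply: hB => _ /imfsetP[x /= /GD xD ->]; apply: hDE.
Qed.

End HasSum.

(** * The disc algebra: uniform limits of polynomials on a disc *)

Section Disc.
Variable R : realType.
Local Notation C := R[i].
Implicit Types (f g : C -> C) (rho : R).

Lemma nmD_le (x y : C) (a b : R) : nm x <= a -> nm y <= b -> nm (x + y) <= a + b.
Proof. by move=> ha hb; rewrite (le_trans (nmD _ _))// lerD. Qed.

Lemma e_neq1 (x : R) : 0 < x < 1 -> e x%:C != 1.
Proof.
move=> /andP[x0 x1]; apply/eqP => /(congr1 (@complex.Re R)).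
rewrite /e /= mulr0 oppr0 expR0 !mul1r mul0r subr0.
have -> : 2 * pi * x = (pi * x) *+ 2 by rewrite -mulr_natl; ring.
rewrite cos_mulr2n => h.
have : 0 < sin (pi * x) by rewrite sin_gt0_pi// mulr_gt0 ?pi_gt0//= gtr_pMr ?pi_gt0.
by have := sin2cos2 (pi * x); nra.
Qed.

Lemma e_mulrn (x : C) k : e (x *+ k) = e x ^+ k.
Proof. by elim: k => [|k IH]; rewrite ?mulr0n ?e0// mulrS eD IH exprS. Qed.

(** A geometric series whose ratio is an n-th root of unity other than 1. *)
Lemma sum_roots_unity (n a : nat) : (0 < n)%N -> (a %% n != 0)%N ->
  \sum_(j < n) e ((n%:R^-1 : R)%:C *+ (j * a)) = 0.
Proof.
move=> n0 an; pose x := e ((n%:R^-1 : R)%:C *+ a).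
have x1 : x != 1.
  rewrite /x {1}(divn_eq a n) mulrnDr eD mulnC mulrnA.
  rewrite -!rmorphMn/= -[n%:R^-1 *+ n]mulr_natr mulVf ?pnatr_eq0 -?lt0n//.
  rewrite rmorph_nat e_nat mul1r; apply: e_neq1.
  have -> : n%:R^-1 *+ (a %% n) = (a %% n)%:R / n%:R :> R by rewrite mulr_natl.
  apply/andP; split; first by rewrite divr_gt0// ltr0n// lt0n.
  by rewrite ltr_pdivrMr ?ltr0n// mul1r ltr_nat ltn_mod.
have xn : x ^+ n = 1.
  rewrite /x -e_mulrn -mulrnA mulnC mulrnA -!rmorphMn/=.
  by rewrite -[n%:R^-1 *+ n]mulr_natr mulVf ?pnatr_eq0 -?lt0n// rmorph_nat e_nat.
transitivity (\sum_(j < n) x ^+ j).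
  by apply: eq_bigr => j _; rewrite /x -e_mulrn -mulrnA mulnC.
apply: (mulfI (_ : x - 1 != 0)); first by rewrite subr_eq0.
by rewrite -subrX1 xn subrr mulr0.
Qed.

(** Cauchy's estimate without an integral: an average over n-th roots of unity recovers the
    coefficient exactly once n exceeds both k and the degree. *)
Lemma poly_coef_le (p : {poly C}) rho B k : 0 < rho ->
  (forall z, nm z <= rho -> nm p.[z] <= B) -> nm p`_k * rho ^+ k <= B.
Proof.
move=> r0 hB; pose n := (maxn (size p) k).+1; pose w := (n%:R^-1 : R)%:C.
have n0 : (0 < n)%N by [].
have kn : (k < n)%N by rewrite ltnS leq_maxr.
(* The weight with exponent n - k keeps only those l for which n divides l + n - k, and for l, k < n
   this means l = k. *)
have key : p`_k * rho%:C ^+ k * n%:R =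
    \sum_(j < n) p.[rho%:C * e (w *+ j)] * e (w *+ (j * (n - k))).
  transitivity (\sum_(j < n) \sum_(l < n)
      (p`_l * rho%:C ^+ l) * e (w *+ (j * (l + (n - k))))).
    rewrite exchange_big/= (bigD1 (Ordinal kn))//= [X in _ + X]big1 ?addr0.
      rewrite -mulr_sumr; congr (_ * _); rewrite -[LHS](_ : \sum_(j < n) 1 = _).
        apply: eq_bigr => j _; rewrite subnKC ?(ltnW kn)// mulnC mulrnA.
        rewrite -rmorphMn/= -mulr_natr mulVf ?pnatr_eq0//.
        by rewrite rmorph1 e_nat.
      by rewrite sumr_const card_ord.
    move=> l lk; rewrite -mulr_sumr sum_roots_unity ?mulr0//.
    have ln := ltn_ord l; have lk' : (l != k :> nat) by [].
    apply/negP => /eqP h.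
    have [kl|lk2] := ltnP k l.
      have : ((l + (n - k)) = n + (l - k))%N by lia.
      by move=> E; move: h; rewrite E modnDl modn_small; lia.
    by move: h; rewrite modn_small; lia.
  apply: eq_bigr => j _.
  rewrite (@horner_coef_wide _ n) ?mulr_suml; last first.
    by rewrite /n leqW// leq_maxl.
  apply: eq_bigr => l _; rewrite mulnDr mulrnDr eD exprMn -e_mulrn -mulrnA.
  by rewrite !mulrA.
have : nm (p`_k * rho%:C ^+ k * n%:R) <= B *+ n.
  rewrite key (le_trans (nm_sum _ _ _))// -[n in B *+ n]card_ord -sumr_const.
  apply: ler_sum => j _.
  rewrite -[w]/(n%:R^-1%:C) -!rmorphMn/= nmM nm_eR mulr1 hB//.
  by rewrite nmM nm_eR mulr1 nmR ger0_norm// ltW.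
by rewrite !nmM nm_nat nmX nmR gtr0_norm// -[B *+ n]mulr_natr ler_pM2r// ltr0n.
Qed.

Lemma geom_le2 (t : R) n : 0 <= t <= 2^-1 -> \sum_(k < n) t ^+ k <= 2.
Proof.
move=> /andP[t0 t1]; suff h : \sum_(k < n) t ^+ k <= 2 - 2 * t ^+ n.
  by rewrite (le_trans h)// lerBlDr lerDl mulr_ge0 ?exprn_ge0.
elim: n => [|n IH]; first by rewrite big_ord0 expr0; lra.
rewrite big_ord_recr/= exprS; have := exprn_ge0 n t0.
by move: IH; set s := \sum_(_ < _) _; set q := t ^+ n; nra.
Qed.

(** By Cauchy's estimate the term of degree k is at most B t^k with t = |z| / rho <= 1/2; from
    degree 2 on these sum to at most 2 B t^2. *)
Lemma poly_taylor1 (p : {poly C}) rho B z : 0 < rho ->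
  (forall z, nm z <= rho -> nm p.[z] <= B) -> nm z <= rho / 2 ->
  nm (p.[z] - p`_0 - p`_1 * z) <= 2 * B * (nm z / rho) ^+ 2.
Proof.
move=> r0 hB hz; pose n := size p; pose t := nm z / rho.
have t0 : 0 <= t by rewrite divr_ge0 ?nm_ge0// ltW.
have t1 : 0 <= t <= 2^-1 by rewrite t0 /= ler_pdivrMr// mulrC.
have B0 : 0 <= B.
  by apply: le_trans (hB 0 _); rewrite ?nm_ge0// nm0 ltW.
rewrite (@horner_coef_wide _ n.+2); last by rewrite /n; lia.
rewrite !big_ord_recl/= expr0 expr1 mulr1 addrA.
rewrite [X in nm X](_ : _ = \sum_(i < n) p`_i.+2 * z ^+ i.+2); last by ring.
apply: (@le_trans _ _ (\sum_(i < n) B * t ^+ 2 * t ^+ i)).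
  apply: (le_trans (nm_sum _ _ _)); apply: ler_sum => i _.
  rewrite nmM nmX -mulrA -exprD add2n.
  have -> : nm z = t * rho by rewrite /t divfK// gt_eqF.
  rewrite exprMn mulrCA mulrC ler_wpM2r ?exprn_ge0//.
  exact: poly_coef_le.
rewrite -mulr_sumr mulrC -mulrA ler_wpM2r ?geom_le2//.
by rewrite mulr_ge0// exprn_ge0.
Qed.

Lemma poly_taylor0 (p : {poly C}) rho B z : 0 < rho ->
  (forall z, nm z <= rho -> nm p.[z] <= B) -> nm z <= rho / 2 ->
  nm (p.[z] - p`_0) <= 2 * B * (nm z / rho).
Proof.
move=> r0 hB hz; pose n := size p; pose t := nm z / rho.
have t0 : 0 <= t by rewrite divr_ge0 ?nm_ge0// ltW.
have t1 : 0 <= t <= 2^-1 by rewrite t0 /= ler_pdivrMr// mulrC.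
have B0 : 0 <= B.
  by apply: le_trans (hB 0 _); rewrite ?nm_ge0// nm0 ltW.
rewrite (@horner_coef_wide _ n.+1); last by rewrite /n; lia.
rewrite !big_ord_recl/= expr0 mulr1.
rewrite [X in nm X](_ : _ = \sum_(i < n) p`_i.+1 * z ^+ i.+1); last by ring.
apply: (@le_trans _ _ (\sum_(i < n) B * t * t ^+ i)).
  apply: (le_trans (nm_sum _ _ _)); apply: ler_sum => i _.
  rewrite nmM nmX -mulrA -exprS.
  have -> : nm z = t * rho by rewrite /t divfK// gt_eqF.
  rewrite exprMn mulrCA mulrC ler_wpM2r ?exprn_ge0//.
  exact: poly_coef_le.
rewrite -mulr_sumr mulrC -mulrA ler_wpM2r ?geom_le2//.
by rewrite mulr_ge0.
Qed.

Lemma poly_bound (p : {poly C}) rho :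
  exists2 B, 0 <= B & forall z, nm z <= rho -> nm p.[z] <= B.
Proof.
exists (\sum_(i < size p) nm p`_i * `|rho| ^+ i).
  by apply: sumr_ge0 => i _; rewrite mulr_ge0 ?nm_ge0// exprn_ge0.
move=> z zr; rewrite horner_coef (le_trans (nm_sum _ _ _))// ler_sum// => i _.
rewrite nmM nmX ler_wpM2l ?nm_ge0// lerXn2r ?nnegrE ?nm_ge0//.
by rewrite (le_trans zr)// ler_norm.
Qed.

(* Uniform limits of polynomials on the closed disc of radius rho: this
   replaces holomorphy, so that no complex analysis is needed. *)
Definition Ap rho f : Prop := forall eps : R, 0 < eps ->
  exists p : {poly C}, forall z, nm z <= rho -> nm (f z - p.[z]) <= eps.

Lemma Ap_ext rho f g : (forall z, nm z <= rho -> f z = g z) -> Ap rho f -> Ap rho g.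
Proof.
by move=> fg hf eps /hf[p hp]; exists p => z zr; rewrite -fg// hp.
Qed.

Lemma Ap_bound rho f : Ap rho f ->
  exists2 B, 0 <= B & forall z, nm z <= rho -> nm (f z) <= B.
Proof.
move=> /(_ _ ltr01)[p hp]; have [B B0 hB] := poly_bound p rho.
exists (1 + B); first by rewrite addr_ge0.
move=> z zr; have := nm_sub (f z) p.[z] 0; rewrite !subr0 => /le_trans; apply.
by rewrite lerD ?hp ?hB.
Qed.

Lemma Ap_poly rho (p : {poly C}) : Ap rho (fun z => p.[z]).
Proof. by move=> eps e0; exists p => z _; rewrite subrr nm0 ltW. Qed.

Lemma Ap_const rho (c : C) : Ap rho (fun=> c).
Proof. by apply: Ap_ext (Ap_poly rho c%:P) => z _; rewrite hornerC. Qed.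

Lemma Ap_id rho : Ap rho id.
Proof. by apply: Ap_ext (Ap_poly rho 'X) => z _; rewrite hornerX. Qed.

Lemma ApD rho f g : Ap rho f -> Ap rho g -> Ap rho (fun z => f z + g z).
Proof.
move=> hf hg eps e0; have e2 : 0 < eps / 2 by rewrite divr_gt0.
have [p hp] := hf _ e2; have [q hq] := hg _ e2; exists (p + q) => z zr.
rewrite hornerD opprD addrACA (le_trans (nmD _ _))// (splitr eps).
by rewrite lerD ?hp ?hq.
Qed.

Lemma Ap_lim rho f : (forall eps : R, 0 < eps -> exists2 g, Ap rho g &
  forall z, nm z <= rho -> nm (f z - g z) <= eps) -> Ap rho f.
Proof.
move=> h eps e0; have e2 : 0 < eps / 2 by rewrite divr_gt0.
have [g hg fg] := h _ e2; have [p hp] := hg _ e2; exists p => z zr.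
by rewrite (le_trans (nm_sub _ (g z) _))// (splitr eps) lerD ?fg ?hp.
Qed.

(** Two replacements in turn: f by a polynomial p, at a cost controlled by the bound of g, then g by
    a polynomial, at a cost controlled by the bound of p. *)
Lemma ApM rho f g : Ap rho f -> Ap rho g -> Ap rho (fun z => f z * g z).
Proof.
move=> hf hg; apply: Ap_lim => eps e0.
have [B B0 hB] := Ap_bound hg.
have B1 : 0 < B + 1 by rewrite ltr_wpDl.
have [p hp] := hf _ (divr_gt0 e0 B1).
have [A A0 hA] := poly_bound p rho.
have A1 : 0 < A + 1 by rewrite ltr_wpDl.
exists (fun z => p.[z] * g z).
  apply: Ap_lim => eta h0; have [q hq] := hg _ (divr_gt0 h0 A1).
  exists (fun z => (p * q).[z]); first exact: Ap_poly.
  move=> z zr; rewrite hornerM -mulrBr nmM mulrC.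
  apply: (@le_trans _ _ (eta / (A + 1) * A)).
    by rewrite ler_pM ?nm_ge0 ?hq ?hA.
  by rewrite mulrAC ler_pdivrMr// ler_wpM2l ?(ltW h0)// lerDl.
move=> z zr; rewrite -mulrBl nmM; apply: (@le_trans _ _ (eps / (B + 1) * B)).
  by rewrite ler_pM ?nm_ge0 ?hp ?hB.
by rewrite mulrAC ler_pdivrMr// ler_wpM2l ?(ltW e0)// lerDl.
Qed.

Lemma ApX rho f k : Ap rho f -> Ap rho (fun z => f z ^+ k).
Proof.
move=> hf; elim: k => [|k IH]; first exact: Ap_const.
by apply: Ap_ext (ApM hf IH) => z _; rewrite exprS.
Qed.

Lemma Ap_sum rho (I : eqType) (r : seq I) (P : pred I) (F : I -> C -> C) :
  (forall i, i \in r -> Ap rho (F i)) ->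
  Ap rho (fun z => \sum_(i <- r | P i) F i z).
Proof.
elim: r => [|i r IH] h.
  by apply: Ap_ext (Ap_const rho 0) => z _; rewrite big_nil.
have h1 := IH (fun j jr => h j (mem_behead (jr : j \in behead (i :: r)))).
have hi : Ap rho (F i) by apply: h; rewrite mem_head.
case: (boolP (P i)) => Pi.
  by apply: Ap_ext (ApD hi h1) => z _; rewrite big_cons Pi.
by apply: Ap_ext h1 => z _; rewrite big_cons (negbTE Pi).
Qed.

Lemma Ap_prod rho (I : eqType) (r : seq I) (F : I -> C -> C) :
  (forall i, i \in r -> Ap rho (F i)) ->
  Ap rho (fun z => \prod_(i <- r) F i z).
Proof.
elim: r => [|i r IH] h.
  by apply: Ap_ext (Ap_const rho 1) => z _; rewrite big_nil.
have h1 := IH (fun j jr => h j (mem_behead (jr : j \in behead (i :: r)))).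
have hi : Ap rho (F i) by apply: h; rewrite mem_head.
by apply: Ap_ext (ApM hi h1) => z _; rewrite big_cons.
Qed.

Lemma geom_lim0 (t : R) : 0 <= t < 1 ->
  forall eps, 0 < eps -> exists n, t ^+ n < eps.
Proof.
move=> /andP[t0 t1] eps e0.
have /cvgrPdist_lt/(_ _ e0) : (fun n => t ^+ n) @ \oo --> (0 : R).
  by apply: cvg_expr; rewrite ger0_norm.
move=> [N _ hN]; exists N; have := hN N (leqnn _).
by rewrite sub0r normrN ger0_norm ?exprn_ge0.
Qed.

(** The geometric series in z / a converges uniformly, since |z / a| <= rho / |a| < 1. *)
Lemma Ap_inv_lin rho (a : C) : 0 < rho -> rho < nm a ->
  Ap rho (fun z => (z - a)^-1).
Proof.
move=> r0 ra; apply: Ap_lim => eps e0.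
have a0 : 0 < nm a by apply: lt_trans ra.
have aN0 : a != 0 by rewrite -nm_gt0.
pose t := rho / nm a.
have t01 : 0 <= t < 1.
  by rewrite divr_ge0 ?(ltW r0) ?nm_ge0//= ltr_pdivrMr// mul1r.
have ar : 0 < nm a - rho by rewrite subr_gt0.
have [n hn] := geom_lim0 t01 (mulr_gt0 e0 ar).
exists (fun z => \sum_(k < n) (- a^-1) * (z / a) ^+ k).
  apply: Ap_sum => k _; apply: ApM; first exact: Ap_const.
  by apply: ApX; apply: ApM; [exact: Ap_id|exact: Ap_const].
move=> z zr.
have za : z - a != 0.
  by apply/eqP => /eqP; rewrite subr_eq0 => /eqP E; move: ra; rewrite -E ltNge zr.
have -> : (z - a)^-1 - \sum_(k < n) (- a^-1) * (z / a) ^+ k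
    = (z / a) ^+ n / (z - a).
  rewrite -mulr_sumr; set s := \sum_(_ < _) _.
  have hs : (z / a) ^+ n = 1 + (z / a - 1) * s by rewrite -subrX1 addrC subrK.
  by rewrite hs; field; rewrite za aN0.
rewrite nmM nmV nmX nmM nmV ler_pdivrMr ?nm_gt0//.
apply: (@le_trans _ _ (t ^+ n)).
  rewrite lerXn2r ?nnegrE ?divr_ge0 ?nm_ge0// ?(ltW r0)//.
  by rewrite ler_wpM2r ?invr_ge0 ?nm_ge0.
rewrite (le_trans (ltW hn))// ler_wpM2l ?(ltW e0)//.
have := nm_sub a z 0; rewrite !subr0 nmBC; lra.
Qed.

(** Factor p over the algebraically closed field [R[i]]; no root lies in the disc, so [Ap_inv_lin]
    covers each factor. *)
Lemma Ap_inv_poly rho (p : {poly C}) : 0 < rho ->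
  (forall z, nm z <= rho -> p.[z] != 0) -> Ap rho (fun z => p.[z]^-1).
Proof.
move=> r0 hp; have [r Er] := closed_field_poly_normal p.
apply: (@Ap_ext _ (fun z => (lead_coef p)^-1 * \prod_(a <- r) (z - a)^-1)).
  move=> z zr; rewrite [in RHS]Er hornerZ invfM; congr (_ * _).
  rewrite horner_prod (big_morph _ (@invfM _) (@invr1 _)); apply: eq_bigr => a _.
  by rewrite hornerXsubC.
apply: ApM; first exact: Ap_const.
apply: Ap_prod => a ar; apply: Ap_inv_lin => //; rewrite ltNge; apply/negP => har.
have := hp a har; rewrite Er hornerZ horner_prod mulf_eq0 negb_or => /andP[_].
rewrite (big_rem a)//= hornerXsubC subrr mul0r eqxx//.
Qed.

End Disc.

(** * The exponential in the disc algebra and first-order estimates *)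

Section DiscExp.
Variable R : realType.
Local Notation C := R[i].

Lemma sin_mvt (y : R) : 0 <= y -> exists2 c, 0 <= c <= y & sin y = y * cos c.
Proof.
rewrite le_eqVlt => /orP[/eqP <-|y0].
  by exists 0; rewrite ?lexx// sin0 mul0r.
have [|c] := @MVT R sin cos 0 y y0.
  by apply: continuous_subspaceT => x; exact: continuous_sin.
rewrite in_itv/= => /andP[c0 cy]; rewrite sin0 !subr0 mulrC => ->.
by exists c => //; rewrite !ltW.
Qed.

Lemma sin_ub (y : R) : `|sin y| <= `|y|.
Proof.
wlog y0 : y / 0 <= y => [h|].
  by have [/h//|/ltW y0] := leP 0 y; rewrite -normrN -sinN -(normrN y) h// oppr_ge0.
have [c _ ->] := sin_mvt y0; rewrite normrM ler_piMr//.
by rewrite ler_norml cos_geN1 cos_le1.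
Qed.

Lemma cos_near1 (y : R) : `|cos y - 1| <= y ^+ 2.
Proof.
have -> : cos y - 1 = - (sin (y / 2) ^+ 2 *+ 2).
  have {1}-> : y = (y / 2) *+ 2 by rewrite -mulr_natr divfK.
  by rewrite cos_mulr2n cos2sin2; ring.
rewrite normrN ger0_norm; last by rewrite mulrn_wge0 ?sqr_ge0.
have : sin (y / 2) ^+ 2 <= (y / 2) ^+ 2.
  by rewrite -ler_sqrt ?sqr_ge0// !sqrtr_sqr sin_ub.
by rewrite -mulr_natr; have := sqr_ge0 y; nra.
Qed.

Lemma sin_near (y : R) : `|y| <= 1 -> `|sin y - y| <= y ^+ 2.
Proof.
move=> hy; wlog y0 : y hy / 0 <= y => [h|].
  have [/h->//|/ltW y0] := leP 0 y.
  rewrite -normrN opprD opprK -sinN -[X in _ <= X]sqrrN.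
  by have := h (- y); rewrite normrN opprK; apply=> //; rewrite oppr_ge0.
have [c /andP[c0 cy] ->] := sin_mvt y0.
have -> : y * cos c - y = y * (cos c - 1) by ring.
have y1 : y <= 1 by move: hy; rewrite ger0_norm.
rewrite normrM (ger0_norm y0) expr2 ler_wpM2l//.
by rewrite (le_trans (cos_near1 _))//; nra.
Qed.

Lemma expR_near (x : R) : `|x| <= 2^-1 -> `|expR x - 1 - x| <= 2 * x ^+ 2.
Proof.
rewrite ler_norml => /andP[h1 h2].
have l1 := expR_ge1Dx x; have l2 := expR_ge1Dx (- x).
have e0 := expR_gt0 x.
have : expR x * expR (- x) = 1 by rewrite -expRD subrr expR0.
rewrite ger0_norm; last by lra.
by move: l1 l2 e0; set a := expR x; set b := expR (- x) => l1 l2 e0 ab; nra.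
Qed.

Definition twopii : C := (2 * pi) *i.

Lemma e_near (z : C) : nm (twopii * z) <= 2^-1 ->
  nm (e z - (1 + twopii * z)) <= 8 * nm (twopii * z) ^+ 2.
Proof.
set u := twopii * z => hu.
pose x := complex.Re u; pose y := complex.Im u.
have Eu : e z = (expR x)%:C * (cos y +i* sin y).
  rewrite /e /x /y /u /twopii ReM ImM /=.
  by rewrite !mul0r sub0r add0r.
have hx : `|x| <= nm u by exact: ler_Re_nm.
have hy : `|y| <= nm u by exact: ler_Im_nm.
have n0 := nm_ge0 u.
have q1 := expR_near (le_trans hx hu).
have q2 := cos_near1 y.
have q3 : `|sin y - y| <= y ^+ 2.
  by apply: sin_near; apply: le_trans hy (le_trans hu _); lra.
have q4 := sin_ub y.
have x2 : x ^+ 2 <= nm u ^+ 2 by rewrite -[x ^+ 2]real_normK ?num_real// lerXn2r ?nnegrE.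
have y2 : y ^+ 2 <= nm u ^+ 2 by rewrite -[y ^+ 2]real_normK ?num_real// lerXn2r ?nnegrE.
have e2 : `|expR x - 1| <= 2 * nm u.
  have := q1; rewrite !ler_norml => /andP[].
  by move: hx; rewrite ler_norml => /andP[]; set a := expR x; nra.
have q0 : 0 <= expR x <= 2.
  by rewrite expR_ge0/=; move: e2; rewrite ler_norml => /andP[]; lra.
have -> : e z - (1 + u) = (expR x - 1 - x)%:C + (expR x * (cos y - 1))%:C
   + 'i * ((expR x - 1) * sin y)%:C + 'i * (sin y - y)%:C.
  have -> : e z = (expR x)%:C * ((cos y)%:C + 'i * (sin y)%:C).
    by rewrite Eu; congr (_ * _); rewrite [LHS]complexE.
  have -> : u = x%:C + 'i * y%:C := complexE u.
  by ring.
(* The four second-order errors are at most 2, 2, 2 and 1 times the square of [nm u]. *)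
apply: (@le_trans _ _ (2 * nm u ^+ 2 + 2 * nm u ^+ 2 + 2 * nm u * nm u + nm u ^+ 2)); last by nra.
apply: nmD_le; last by rewrite nmM nm_i mul1r nmR (le_trans q3).
apply: nmD_le; last first.
  by rewrite nmM nm_i mul1r nmR normrM ler_pM// (le_trans q4).
apply: nmD_le; rewrite nmR.
  by rewrite (le_trans q1)//; lra.
rewrite normrM ger0_norm; last by case/andP: q0.
by case/andP: q0 => ? ?; rewrite ler_pM// (le_trans q2).
Qed.

Lemma nm_subX (a b : C) (M : R) n : nm a <= M -> nm b <= M ->
  nm (a ^+ n.+1 - b ^+ n.+1) <= n.+1%:R * nm (a - b) * M ^+ n.
Proof.
move=> ha hb; rewrite subrXX nmM mulrC (mulrC n.+1%:R) -mulrA mulrC.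
rewrite ler_wpM2l ?nm_ge0// (le_trans (nm_sum _ _ _))//.
rewrite mulr_natl -[n.+1 in X in _ <= X]card_ord -sumr_const ler_sum// => i _.
rewrite nmM !nmX; apply: (@le_trans _ _ (M ^+ (n.+1.-1 - i) * M ^+ i)).
  have M0 := le_trans (nm_ge0 _) ha.
  by rewrite ler_pM ?exprn_ge0 ?nm_ge0// lerXn2r ?nnegrE ?nm_ge0.
by rewrite -exprD subnK// -ltnS ltn_ord.
Qed.

Lemma expR_mulrn (x : R) k : expR (x *+ k) = expR x ^+ k.
Proof. by elim: k => [|k IH]; rewrite ?mulr0n ?expR0// mulrS expRD IH exprS. Qed.

(** Euler's limit (1 + x / N)^N with a rate: both sides are N-th powers of numbers of modulus at
    most exp(B / N), which differ by O((B / N)^2). *)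
Lemma e_approx (z : C) (n : nat) (B : R) : nm (twopii * z) <= B ->
  2 * B <= n.+1%:R ->
  nm (e z - (1 + twopii * z / n.+1%:R) ^+ n.+1)
    <= 8 * B ^+ 2 * expR B / n.+1%:R.
Proof.
move=> hz hn; set N : R := n.+1%:R.
have N0 : 0 < N by rewrite ltr0n.
have B0 : 0 <= B := le_trans (nm_ge0 _) hz.
have nE : nm (n.+1%:R : C) = N by rewrite nm_nat.
pose v := z / n.+1%:R.
have Ez : e z = e v ^+ n.+1.
  by rewrite -e_mulrn -mulr_natr divfK// pnatr_eq0.
have hv : nm (twopii * v) <= B / N.
  by rewrite /v mulrA nmM nmV nE ler_wpM2r// invr_ge0 ltW.
have hB : B / N <= 2^-1 by rewrite ler_pdivrMr// mulrC ler_pdivlMr// mulrC.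
rewrite Ez -mulrA -/v; pose M := expR (B / N).
have hb : nm (1 + twopii * v) <= M.
  rewrite (le_trans (nmD _ _))// nm1 (le_trans _ (expR_ge1Dx _))//.
  by rewrite lerD2l.
have ha : nm (e v) <= M.
  rewrite nm_e ler_expR; apply: le_trans hv.
  rewrite -[X in X <= _](_ : complex.Re (twopii * v) = _).
    by rewrite (le_trans (ler_norm _))// ler_Re_nm.
  by rewrite ReM /= mul0r sub0r.
apply: (le_trans (nm_subX _ ha hb)).
apply: (@le_trans _ _ (N * (8 * (B / N) ^+ 2) * expR B)).
  rewrite ler_pM ?mulr_ge0 ?nm_ge0 ?exprn_ge0 ?expR_ge0 ?(ltW N0)//.
    rewrite ler_wpM2l ?(ltW N0)// (le_trans (e_near (le_trans hv hB)))//.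
    by rewrite ler_wpM2l// lerXn2r ?nnegrE ?nm_ge0// divr_ge0// ltW.
  rewrite -expR_mulrn ler_expR -mulr_natr -mulrA ler_piMr//.
  by rewrite mulrC ler_pdivrMr// mul1r ler_nat.
rewrite le_eqVlt; apply/orP; left; apply/eqP; field.
by rewrite gt_eqF.
Qed.

(** A bound for f makes the rate of [e_approx] uniform on the disc, and the approximants are powers
    of elements of the disc algebra. *)
Lemma Ap_e (rho : R) (f : C -> C) : Ap rho f -> Ap rho (fun z => e (f z)).
Proof.
move=> hf; have [B0 B00 hB0] := Ap_bound hf.
pose B := 2 * pi * B0.
have pi2 : 0 <= 2 * pi :> R by rewrite mulr_ge0// pi_ge0.
have hB z : nm z <= rho -> nm (twopii * f z) <= B.
  move=> zr; rewrite nmM /B ler_pM ?nm_ge0 ?hB0//.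
  by rewrite nmE /twopii /= expr0n/= add0r sqrtr_sqr ger0_norm.
have hBz : 0 <= B by rewrite mulr_ge0.
apply: Ap_lim => eps e0.
pose D := 8 * B ^+ 2 * expR B.
have D0 : 0 <= D.
  by apply: mulr_ge0; [apply: mulr_ge0; [exact: ler0n|exact: sqr_ge0]|exact: expR_ge0].
have [n hn] : exists n : nat, 2 * B + D / eps <= n.+1%:R.
  exists (Num.truncn (2 * B + D / eps)); exact/ltW/truncnS_gt.
exists (fun z => (1 + twopii * f z / n.+1%:R) ^+ n.+1).
  apply/ApX/ApD; first exact: Ap_const.
  by do 2 (apply: ApM; last exact: Ap_const || exact: hf); exact: Ap_const.
move=> z zr.
have De : 0 <= D / eps by rewrite divr_ge0// ltW.
have h2 : 2 * B <= n.+1%:R by apply: le_trans hn; rewrite lerDl.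
apply: (le_trans (e_approx (hB z zr) h2)); rewrite -/D.
rewrite ler_pdivrMr ?ltr0n// mulrC -ler_pdivrMr//.
by apply: le_trans hn; rewrite lerDr mulr_ge0.
Qed.

(** Cauchy-Riemann in difference form: up to second order, the step i d changes g by i times what
    the step d does. Means ignore real steps, so they will change only to second order under
    imaginary ones. *)
Lemma Ap_taylor (rho B d : R) (g : C -> C) : 0 < rho -> Ap rho g ->
  (forall z, nm z <= rho -> nm (g z) <= B) -> 0 <= d <= rho / 2 ->
  nm (g ('i * d%:C) - g 0 - 'i * (g d%:C - g 0)) <= 4 * B * (d / rho) ^+ 2.
Proof.
move=> r0 hg hB /andP[d0 hd].
have nd : nm (d%:C : C) = d by rewrite nmR ger0_norm.
have nid : nm ('i * d%:C : C) = d by rewrite nmM nm_i mul1r.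
have dr : d <= rho by lra.
have dr1 : d / rho <= 1 by rewrite ler_pdivrMr// mul1r.
have dr0 : 0 <= d / rho by rewrite divr_ge0// ltW.
(* Replacing g by p costs 1, 1 and 2 eighths of eps at the three points; the enlarged bound B + eps
   / 8 in the two Taylor remainders costs at most 4 more. *)
apply/ler_addgt0Pr => eps e0; have e8 : 0 < eps / 8 by rewrite divr_gt0.
have [p hp] := hg _ e8.
have hpB z : nm z <= rho -> nm p.[z] <= B + eps / 8.
  move=> zr; have := nm_sub p.[z] (g z) 0; rewrite !subr0 nmBC => /le_trans; apply.
  by rewrite addrC lerD ?hB ?hp.
have t1 := @poly_taylor1 _ p rho _ ('i * d%:C) r0 hpB; rewrite nid in t1.
have t2 := @poly_taylor1 _ p rho _ d%:C r0 hpB; rewrite nd in t2.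
have a1 := hp ('i * d%:C); rewrite nid in a1.
have a2 := hp d%:C; rewrite nd in a2.
have a3 := hp 0; rewrite nm0 in a3.
move: (t1 hd) (t2 hd) (a1 dr) (a2 dr) (a3 (ltW r0)) => {a3}a3 {}a2 {}a1 {}t2 {}t1.
have -> : g ('i * d%:C) - g 0 - 'i * (g d%:C - g 0) =
   (p.['i * d%:C] - p`_0 - p`_1 * ('i * d%:C))
   + - ('i * (p.[d%:C] - p`_0 - p`_1 * d%:C))
   + (g ('i * d%:C) - p.['i * d%:C]) + - ('i * (g d%:C - p.[d%:C]))
   + ('i - 1) * (g 0 - p.[0]).
  by rewrite !horner_coef0; ring.
have i1 : nm ('i - 1 : C) <= 2.
  by rewrite (le_trans (nmB _ _))// nm_i nm1; lra.
apply: le_trans (nmD_le (nmD_le (nmD_le (nmD_le (lexx _) (lexx _)) (lexx _)) (lexx _)) (lexx _)) _.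
rewrite !nmN !nmM !nm_i !mul1r.
have : nm ('i - 1 : C) * nm (g 0 - p.[0]) <= 2 * (eps / 8).
  by rewrite ler_pM ?nm_ge0.
have : eps * (d / rho) ^+ 2 <= eps.
  by rewrite ler_piMr ?(ltW e0)// expr_le1.
move: a1 a2 a3 t1 t2; set q := (d / rho) ^+ 2; set m := nm ('i - 1) * _; move: m.
by move: (nm _) (nm _) (nm _) (nm _) => ? ? ? ? ?; lra.
Qed.

Lemma Ap_lip (rho B : R) (z : C) (g : C -> C) : 0 < rho -> Ap rho g ->
  (forall z, nm z <= rho -> nm (g z) <= B) -> nm z <= rho / 2 ->
  nm (g z - g 0) <= 2 * B * (nm z / rho).
Proof.
move=> r0 hg hB hd; set d := nm z in hd *.
have dr : d <= rho by move: (r0) hd; lra.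
have dr1 : d / rho <= 1 by rewrite ler_pdivrMr// mul1r.
have dr0 : 0 <= d / rho by rewrite divr_ge0 ?nm_ge0// ltW.
apply/ler_addgt0Pr => eps e0; have e8 : 0 < eps / 8 by rewrite divr_gt0.
have [p hp] := hg _ e8.
have hpB w : nm w <= rho -> nm p.[w] <= B + eps / 8.
  move=> zr; have := nm_sub p.[w] (g w) 0; rewrite !subr0 nmBC => /le_trans; apply.
  by rewrite addrC lerD ?hB ?hp.
have := poly_taylor0 r0 hpB hd.
have a1 := hp z dr.
have := hp 0; rewrite nm0 horner_coef0 => /(_ (ltW r0)) a3 t.
have -> : g z - g 0 = (p.[z] - p`_0) + (g z - p.[z]) + - (g 0 - p`_0) by ring.
apply: le_trans (nmD_le (nmD_le (lexx _) (lexx _)) (lexx _)) _.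
rewrite nmN.
have : eps * (d / rho) <= eps by rewrite ler_piMr ?(ltW e0).
by move: t; rewrite -/d; lra.
Qed.

End DiscExp.

(** * Limits along an ultrafilter *)

Section UltraLimit.
Variable R : realType.
Local Notation C := R[i].

Lemma ultra_nat_ex :
  exists U : set_system nat, UltraFilter U /\ (\oo : set_system nat) `<=` U.
Proof. by have [U [? ?]] := @ultraFilterLemma nat \oo _; exists U. Qed.

(** Every bounded sequence converges along an ultrafilter, so [mean] below is defined and linear on
    all bounded functions; refining [\oo] keeps eventual properties available. *)
Definition UF : set_system nat := projT1 (cid ultra_nat_ex).

Lemma UF_ultra : UltraFilter UF.
Proof. by rewrite /UF; case: cid => U []. Qed.
Local Existing Instance UF_ultra.

Lemma UF_oo (A : set nat) : (\oo : set_system nat) A -> UF A.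
Proof. by rewrite /UF; case: cid => U /= [_ h]; exact: h. Qed.

Definition uconv (u : nat -> C) (l : C) : Prop :=
  forall eps : R, 0 < eps -> UF [set n | nm (u n - l) < eps].

Definition ulim (u : nat -> C) : C := xget 0 [set l | uconv u l].

Lemma uconv_uniq (u : nat -> C) (l l' : C) : uconv u l -> uconv u l' -> l = l'.
Proof.
move=> h h'; apply/eqP; rewrite -subr_eq0 -nm_eq0 eq_le nm_ge0 andbT.
apply/ler_addgt0Pr => eps e0; rewrite add0r; have e2 : 0 < eps / 2 by rewrite divr_gt0.
have [n [/= hn hn']] := filter_ex (filterI (h _ e2) (h' _ e2)).
rewrite (le_trans (nm_sub _ (u n) _))// (splitr eps) lerD// ltW//.
by rewrite nmBC.
Qed.

Lemma ulimE (u : nat -> C) (l : C) : uconv u l -> ulim u = l.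
Proof. by move=> h; apply: (uconv_uniq _ h); rewrite /ulim; case: xgetP => //= /(_ l). Qed.

(** Compactness of [-B, B] gives a cluster point; an ultrafilter contains a set or its complement,
    so a cluster point is already a limit. *)
Lemma ureal (u : nat -> R) (B : R) : (forall n, `|u n| <= B) ->
  exists l : R, forall eps, 0 < eps -> UF [set n | `|u n - l| < eps].
Proof.
move=> hB; have := @segment_compact R (- B) B.
have hU : UF [set n | u n \in `[- B, B]].
  by apply: filterS filterT => n _ /=; rewrite in_itv/= -ler_norml.
move=> /(_ (u @ UF) _) [//|].
move=> l [_ hl]; exists l => eps e0.
have [//|hC] := in_ultra_setVsetC [set n | `|u n - l| < eps] UF_ultra.
exfalso.
have h1 : (u @ UF) [set u n | n in ~` [set n | `|u n - l| < eps]].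
  by apply: filterS hC => n hn /=; exists n.
have [x [[n /= hn <-]]] := hl _ _ h1 (nbhsx_ballx (l : R) eps e0).
by rewrite /ball/= distrC => ?; apply: hn.
Qed.

Lemma uconvD u v l l' : uconv u l -> uconv v l' ->
  uconv (fun n => u n + v n) (l + l').
Proof.
move=> h h' eps e0; have e2 : 0 < eps / 2 by rewrite divr_gt0.
apply: filterS (filterI (h _ e2) (h' _ e2)) => n [/= hn hn'].
rewrite opprD addrACA (le_lt_trans (nmD _ _))// (splitr eps) ltrD//.
Qed.

Lemma uconvZ u l c : uconv u l -> uconv (fun n => c * u n) (c * l).
Proof.
move=> h eps e0.
have c0 : 0 < nm c + 1 by rewrite ltr_wpDl ?nm_ge0.
apply: filterS (h _ (divr_gt0 e0 c0)) => n /=.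
rewrite ltr_pdivlMr// -mulrBr nmM mulrC => /(le_lt_trans _); apply.
by rewrite ler_wpM2r ?nm_ge0// lerDl.
Qed.

Lemma uconv_bounded u B : (forall n, nm (u n) <= B) -> uconv u (ulim u).
Proof.
move=> hB.
have [n|a ha] := @ureal (fun n => complex.Re (u n)) B.
  exact: le_trans (ler_Re_nm _) (hB n).
have [n|b hb] := @ureal (fun n => complex.Im (u n)) B.
  exact: le_trans (ler_Im_nm _) (hB n).
suff h : uconv u (a +i* b) by rewrite (ulimE h).
move=> eps e0; have e2 : 0 < eps / 2 by rewrite divr_gt0.
apply: filterS (filterI (ha _ e2) (hb _ e2)) => n [/= hn hn'].
rewrite (le_lt_trans (nm_le_ReIm _))// (splitr eps).
by rewrite ReD ImD ReN ImN/= ltrD.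
Qed.

Lemma uconv_const c : uconv (fun=> c) c.
Proof. by move=> eps e0; apply: filterS filterT => n _ /=; rewrite subrr nm0. Qed.

Lemma uconv_le u l B : (forall n, nm (u n) <= B) -> uconv u l -> nm l <= B.
Proof.
move=> hB h; apply/ler_addgt0Pr => eps e0.
have [n /= hn] := filter_ex (h _ e0).
have := nm_sub l (u n) 0; rewrite !subr0 nmBC => /le_trans; apply.
by rewrite addrC lerD// ltW.
Qed.

Lemma uconv_Re_ge u l (B : R) : (forall n, B <= complex.Re (u n)) -> uconv u l ->
  B <= complex.Re l.
Proof.
move=> hB h; apply/ler_addgt0Pl => eps e0.
have [n /= hn] := filter_ex (h _ e0).
apply: le_trans (hB n) _.
have := le_lt_trans (ler_Re_nm _) hn; rewrite ReD ReN ltr_norml => /andP[_]; lra.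
Qed.

End UltraLimit.

(** * Means over the torus *)

Section Mean.
Local Existing Instance UF_ultra.
Variables (R : realType) (m n : nat).
Local Notation C := R[i].
Local Notation MR := 'M[R]_(m, n).
Implicit Types (f g : MR -> C).

Definition grid N (k : 'M['I_N.+1]_(m, n)) : MR :=
  map_mx (fun i : 'I_N.+1 => (i : nat)%:R / N.+1%:R) k.

Definition avg N f : C :=
  (#|{: 'M['I_N.+1]_(m, n)}|%:R)^-1 * \sum_(k : 'M['I_N.+1]_(m, n)) f (grid k).

(* A mean over the torus R^(m x n) / Z^(m x n): the limit, along a fixed
   ultrafilter, of averages over finer and finer grids. *)
Definition mean f : C := ulim (fun N => avg N f).

Lemma card_grid_neq0 N : #|{: 'M['I_N.+1]_(m, n)}|%:R != 0 :> C.
Proof. by rewrite pnatr_eq0 card_mx card_ord expn_eq0. Qed.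

Lemma avgD N f g : avg N (fun x => f x + g x) = avg N f + avg N g.
Proof. by rewrite /avg big_split mulrDr. Qed.

Lemma avgZ N c f : avg N (fun x => c * f x) = c * avg N f.
Proof. by rewrite /avg -mulr_sumr mulrCA. Qed.

Lemma avg_const N c : avg N (fun=> c) = c.
Proof.
by rewrite /avg sumr_const -[c *+ _]mulr_natl mulKf// card_grid_neq0.
Qed.

Lemma avg_le N f B : (forall x, nm (f x) <= B) -> nm (avg N f) <= B.
Proof.
move=> hB; rewrite /avg nmM nmV nm_nat.
rewrite mulrC ler_pdivrMr; last by rewrite ltr0n card_mx card_ord expn_gt0.
by rewrite (le_trans (nm_sum _ _ _))// mulr_natr -sumr_const ler_sum.
Qed.

Lemma eq_mean f g : (forall x, f x = g x) -> mean f = mean g.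
Proof. by move=> fg; congr mean; apply: funext. Qed.

Lemma mean_conv f B : (forall x, nm (f x) <= B) ->
  uconv (fun N => avg N f) (mean f).
Proof. by move=> hB; apply: (@uconv_bounded _ _ B) => N; exact: avg_le. Qed.

Lemma meanD f g A B : (forall x, nm (f x) <= A) -> (forall x, nm (g x) <= B) ->
  mean (fun x => f x + g x) = mean f + mean g.
Proof.
move=> hf hg; rewrite {1}/mean; apply: ulimE.
under [X in uconv X]funext do rewrite avgD.
by apply: uconvD; [exact: mean_conv hf|exact: mean_conv hg].
Qed.

Lemma meanZ c f B : (forall x, nm (f x) <= B) ->
  mean (fun x => c * f x) = c * mean f.
Proof.
move=> hf; rewrite {1}/mean; apply: ulimE.
under [X in uconv X]funext do rewrite avgZ.
by apply: uconvZ; exact: mean_conv hf.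
Qed.

Lemma mean_const c : mean (fun=> c) = c.
Proof.
rewrite /mean; apply: ulimE.
under [X in uconv X]funext do rewrite avg_const.
exact: uconv_const.
Qed.

Lemma mean_le f B : (forall x, nm (f x) <= B) -> nm (mean f) <= B.
Proof.
by move=> hB; apply: uconv_le (mean_conv hB) => N; exact: avg_le.
Qed.

Lemma mean_sum (I : eqType) (r : seq I) (F : I -> MR -> C) :
  (forall i, i \in r -> exists B, forall x, nm (F i x) <= B) ->
  mean (fun x => \sum_(i <- r) F i x) = \sum_(i <- r) mean (F i).
Proof.
elim: r => [|i r IH] h.
  by rewrite big_nil -[RHS]mean_const; apply: eq_mean => x; rewrite big_nil.
have [B hB] := h i (mem_head _ _).
have h' j : j \in r -> exists B, forall x, nm (F j x) <= B.
  by move=> jr; apply: h; rewrite inE jr orbT.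
have [A hA] : exists A, forall x, nm (\sum_(i <- r) F i x) <= A.
  elim: (r) h' => [|j s IHs] hs; first by exists 0 => x; rewrite big_nil nm0.
  have [A1 hA1] := hs j (mem_head _ _).
  have [|A2 hA2] := IHs; first by move=> k ks; apply: hs; rewrite inE ks orbT.
  exists (A1 + A2) => x; rewrite big_cons; exact: nmD_le.
rewrite big_cons -IH// -(meanD hB hA); apply: eq_mean => x.
by rewrite big_cons.
Qed.

Definition periodic f := forall x (z : 'M[int]_(m, n)), f (x + map_mx intr z) = f x.

Definition lipu f (L d0 : R) := forall (x y : MR) d, 0 <= d <= d0 ->
  (forall i j, `|y i j| <= d) -> nm (f (x + y) - f x) <= L * d.

(** Addition in ['I_N.+1] is modulo N + 1; the integer w is the carry, which periodicity absorbs
    later. *)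
Lemma grid_mod (N : nat) (z : int) : exists k : 'I_N.+1, forall a : 'I_N.+1,
  exists w : int, ((a + k)%R : nat)%:R / N.+1%:R =
     (a : nat)%:R / N.+1%:R + z%:~R / N.+1%:R + w%:~R :> R.
Proof.
have N0 : (N.+1%:Z != 0)%R by [].
have hm : (`|(z %% N.+1%:Z)%Z|%N < N.+1)%N.
  by rewrite -ltz_nat gez0_abs ?modz_ge0// ltz_pmod.
exists (Ordinal hm) => a.
set b := `|_|%N in hm *.
have Eb : (b%:Z = z - (z %/ N.+1%:Z)%Z * N.+1%:Z)%R.
  by rewrite /b gez0_abs ?modz_ge0// {2}(divz_eq z N.+1%:Z) addrC addKr.
exists (- (((a + b) %/ N.+1)%N%:Z) - (z %/ N.+1%:Z)%Z) => /=.
have E1 : ((a + b)%% N.+1)%N%:R = (a%:R + b%:R - ((a + b) %/ N.+1)%:R * N.+1%:R) :> R.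
  rewrite -natrD {2}(divn_eq (a + b) N.+1) natrD natrM; ring.
have E2 : b%:R = z%:~R - (z %/ N.+1%:Z)%Z%:~R * N.+1%:R :> R.
  by have := congr1 (fun t : int => t%:~R : R) Eb; rewrite /= intrD intrN intrM.
rewrite E1 E2 intrD !intrN -pmulrn; field.
by rewrite addrC natr1 pnatr_eq0.
Qed.

(** The shift permutes the grid modulo integral matrices, by [grid_mod] in each entry. *)
Lemma avg_grid_shift N f (z : 'M[int]_(m, n)) : periodic f ->
  avg N (fun x => f (x + map_mx (fun t : int => t%:~R / N.+1%:R) z)) = avg N f.
Proof.
move=> fp; rewrite /avg; congr (_ * _).
have /choice[k hk] : forall ij : 'I_m * 'I_n, exists k : 'I_N.+1,
    forall a : 'I_N.+1, exists w : int, ((a + k)%R : nat)%:R / N.+1%:R =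
     (a : nat)%:R / N.+1%:R + (z ij.1 ij.2)%:~R / N.+1%:R + w%:~R :> R.
  by move=> ij; exact: grid_mod.
pose K : 'M['I_N.+1]_(m, n) := \matrix_(i, j) k (i, j).
rewrite [RHS](reindex_inj (addIr K)); apply: eq_bigr => a _.
have /choice[w hw] : forall ij : 'I_m * 'I_n, exists w : int,
    ((a ij.1 ij.2 + k ij)%R : nat)%:R / N.+1%:R =
     (a ij.1 ij.2 : nat)%:R / N.+1%:R + (z ij.1 ij.2)%:~R / N.+1%:R + w%:~R :> R.
  by move=> ij; exact: hk.
rewrite -(fp _ (\matrix_(i, j) w (i, j))); congr f; apply/matrixP => i j.
by rewrite !mxE (hw (i, j)).
Qed.

(** Rounding u down to the grid gives v, which leaves the average unchanged; the rest u - v has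
    entries at most 1 / (N + 1), so the Lipschitz condition makes its effect vanish in the limit. *)
Lemma mean_shift f (L d0 B : R) (u : MR) : 0 < d0 -> (forall x, nm (f x) <= B) ->
  periodic f -> lipu f L d0 -> mean (fun x => f (x + u)) = mean f.
Proof.
move=> d00 hB fp fl; rewrite {1}/mean; apply: ulimE => eps e0.
have e2 : 0 < eps / 2 by rewrite divr_gt0.
have L0 : 0 <= L * d0.
  have d00' := ltW d00.
  apply: le_trans (fl 0 0 d0 _ _); rewrite ?nm_ge0 ?d00' ?lexx// => i j.
  by rewrite mxE normr0.
have {}L0 : 0 <= L by move: L0; rewrite pmulr_lge0.
(* The first term makes the grid finer than [d0], the second makes the Lipschitz error at most eps /
   2. *)
have [N0 hN0] : exists N0 : nat, d0^-1 + L / (eps / 2) + 1 <= N0%:R.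
  exists (Num.truncn (d0^-1 + L / (eps / 2) + 1)).+1; exact/ltW/truncnS_gt.
have hN : UF [set N | (N0 <= N)%N] by apply: UF_oo; exists N0.
apply: filterS (filterI hN (mean_conv hB e2)) => N [/= NN hm].
pose v : MR := map_mx (fun t : int => t%:~R / N.+1%:R)
   (\matrix_(i, j) Num.floor (u i j * N.+1%:R)).
have NP : 0 < N.+1%:R :> R by rewrite ltr0n.
have NN' : d0^-1 + L / (eps / 2) + 1 <= N.+1%:R.
  by apply: le_trans hN0 _; rewrite ler_nat leqW.
have i0 : 0 < d0^-1 by rewrite invr_gt0.
have Le : 0 <= L / (eps / 2) by rewrite divr_ge0// ltW.
have huv i j : `|(u - v) i j| <= N.+1%:R^-1.
  rewrite !mxE; have t1 := real_floor_le (num_real (u i j * N.+1%:R)).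
  have := real_floorD1_gt (num_real (u i j * N.+1%:R)); rewrite intrD.
  move: t1; set t := _%:~R => t1 t2.
  have -> : u i j - t / N.+1%:R = (u i j * N.+1%:R - t) / N.+1%:R.
    by field; rewrite addrC natr1 pnatr_eq0.
  rewrite ger0_norm; last by rewrite divr_ge0 ?subr_ge0// ltW.
  by rewrite ler_pdivrMr// mulVf ?gt_eqF//; lra.
apply: le_lt_trans (nm_sub _ (avg N f) _) _; rewrite (splitr eps) ler_ltD//.
rewrite -(avg_grid_shift N (\matrix_(i, j) Num.floor (u i j * N.+1%:R)) fp) -/v.
rewrite -mulN1r -avgZ -avgD; apply: avg_le => x; rewrite mulN1r.
have -> : x + u = (x + v) + (u - v) by rewrite addrAC -addrA subrK addrC.
apply: (le_trans (fl _ _ N.+1%:R^-1 _ huv)).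
  by rewrite invr_ge0 ler0n/= -[d0]invrK lef_pV2 ?posrE//; lra.
by rewrite ler_pdivrMr// mulrC -ler_pdivrMr//; lra.
Qed.

Lemma mean_Re_ge f g A B : (forall x, nm (f x) <= A) -> (forall x, nm (g x) <= B) ->
  (forall x, complex.Re (f x) <= complex.Re (g x)) ->
  complex.Re (mean f) <= complex.Re (mean g).
Proof.
move=> hf hg fg; rewrite -subr_ge0 -ReN -ReD.
have hf' x : nm (-1 * f x) <= A by rewrite mulN1r nmN.
rewrite -[- mean f]mulN1r -(meanZ _ hf) -(meanD hg hf').
have hs x : nm (g x + -1 * f x) <= B + A by apply: nmD_le.
apply: (uconv_Re_ge _ (mean_conv hs)) => N.
have ReZ (a : R) z : complex.Re (a%:C * z) = a * complex.Re z.
  by rewrite ReM/= mul0r subr0.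
rewrite /avg -(rmorph_nat (real_complex R)) -fmorphV/= ReZ.
rewrite mulr_ge0 ?invr_ge0 ?ler0n// Re_sum sumr_ge0// => k _.
by rewrite ReD mulN1r ReN subr_ge0.
Qed.

(** Not periodic, but the grid stays in the unit cube, so for d < 1 the mean sees the indicator of
    one cube of volume d^(m n). *)
Definition box d (x : MR) : C := `[< forall i j, 0 <= x i j <= d >]%:R.

Lemma mean_box_ge d : 0 < d < 1 -> d ^+ (m * n) <= complex.Re (mean (box d)).
Proof.
move=> /andP[d0 d1].
have hb x : nm (box d x) <= 1.
  by rewrite /box nm_nat; case: asboolP; rewrite ?ler01.
apply: (uconv_Re_ge _ (mean_conv hb)) => N.
(* In each entry the grid points 0, ..., k - 1 over N + 1 lie in [0, d]; because 0 is counted, k >=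
   d (N + 1). *)
pose k := (Num.truncn (d * N.+1%:R)).+1.
have NP : 0 < N.+1%:R :> R by rewrite ltr0n.
have dN : 0 <= d * N.+1%:R by rewrite mulr_ge0// ltW.
have kd : (k <= N.+1)%N.
  rewrite /k -(ltr_nat R) (@le_lt_trans _ _ (d * N.+1%:R)) ?truncn_le//.
  by rewrite gtr_pMl.
have hk : d * N.+1%:R <= k%:R by exact/ltW/truncnS_gt.
rewrite /avg -(rmorph_nat (real_complex R)) -fmorphV/=.
have -> (a : R) z : complex.Re (a%:C * z) = a * complex.Re z.
  by rewrite ReM/= mul0r subr0.
rewrite card_mx card_ord mulrC ler_pdivlMr; last by rewrite ltr0n expn_gt0.
rewrite natrX -exprMn.
apply: (@le_trans _ _ (k%:R ^+ (m * n))).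
  by rewrite lerXn2r ?nnegrE.
pose w (a : 'M['I_k]_(m, n)) : 'M['I_N.+1]_(m, n) := map_mx (widen_ord kd) a.
have winj : injective w.
  move=> a b /matrixP ab; apply/matrixP => i j.
  by have := ab i j; rewrite !mxE => /(congr1 val)/= /val_inj.
rewrite Re_sum (bigID [pred a | a \in codom w])/= -[leLHS]addr0 lerD//; last first.
  apply: sumr_ge0 => a _; rewrite /box -(rmorph_nat (real_complex R))/=.
  exact: ler0n.
rewrite -natrX -[k in X in X <= _]card_ord -card_mx -sumr_const.
rewrite [leRHS](eq_bigl (mem [set w a | a : 'M['I_k]_(m, n)])); last first.
  move=> a; apply/codomP/imsetP => [[b ->]|[b _ ->]]; first by exists b.
  by exists b.
rewrite big_imset/=; last by move=> a b _ _; exact: winj.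
apply: ler_sum => a _; rewrite /box asboolT// => i j.
rewrite !mxE divr_ge0 ?ler0n//= ler_pdivrMr//.
rewrite (@le_trans _ _ (Num.truncn (d * N.+1%:R))%:R) ?truncn_le// ler_nat -ltnS.
exact: ltn_ord.
Qed.

End Mean.

(** * Characters of the torus, extended to complex matrices *)

Section Characters.
Variables (R : realType) (m n : nat).
Local Notation C := R[i].
Local Notation MC := 'M[C]_(m, n).
Implicit Types (q : 'M[int]_(m, n)) (W : MC) (x : 'M[R]_(m, n)).

Definition dotC q W : C := \sum_i \sum_j (q i j)%:~R * W i j.
Definition chi q W : C := e (dotC q W).

Lemma dotCD q W W' : dotC q (W + W') = dotC q W + dotC q W'.
Proof.
rewrite /dotC -big_split; apply: eq_bigr => i _; rewrite -big_split.
by apply: eq_bigr => j _; rewrite mxE mulrDr.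
Qed.

Lemma dotDC q q' W : dotC (q + q') W = dotC q W + dotC q' W.
Proof.
rewrite /dotC -big_split; apply: eq_bigr => i _; rewrite -big_split.
by apply: eq_bigr => j _; rewrite mxE intrD mulrDl.
Qed.

Lemma dotNC q W : dotC (- q) W = - dotC q W.
Proof.
rewrite /dotC -sumrN; apply: eq_bigr => i _; rewrite -sumrN.
by apply: eq_bigr => j _; rewrite mxE intrN mulNr.
Qed.

Lemma chi_add q W W' : chi q (W + W') = chi q W * chi q W'.
Proof. by rewrite /chi dotCD eD. Qed.

Lemma chiD q q' W : chi (q + q') W = chi q W * chi q' W.
Proof. by rewrite /chi dotDC eD. Qed.

Lemma chiN q W : chi (- q) W = (chi q W)^-1.
Proof. by rewrite /chi dotNC eN. Qed.

Lemma chi0 W : chi 0 W = 1.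
Proof.
by rewrite /chi /dotC big1 ?e0// => i _; rewrite big1// => j _; rewrite mxE mul0r.
Qed.

Lemma chi_neq0 q W : chi q W != 0.
Proof. exact: e_neq0. Qed.

Lemma chi_int q (z : 'M[int]_(m, n)) : chi q (mxZ R z) = 1.
Proof.
have -> : chi q (mxZ R z) = e ((\sum_i \sum_j q i j * z i j)%:~R : C).
  congr e; rewrite /dotC rmorph_sum; apply: eq_bigr => i _.
  by rewrite rmorph_sum; apply: eq_bigr => j _; rewrite mxE rmorphM.
exact: e_int.
Qed.

Lemma mxR_int (z : 'M[int]_(m, n)) : mxR (map_mx intr z) = mxZ R z :> MC.
Proof. by apply/matrixP => i j; rewrite !mxE rmorph_int. Qed.

Lemma mxRD x y : mxR (x + y) = mxR x + mxR y.
Proof. by apply/matrixP => i j; rewrite !mxE rmorphD. Qed.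

Lemma dotC_real q x : dotC q (mxR x) = (\sum_i \sum_j (q i j)%:~R * x i j)%:C.
Proof.
rewrite rmorph_sum; apply: eq_bigr => i _; rewrite rmorph_sum.
by apply: eq_bigr => j _; rewrite mxE rmorphM/= rmorph_int.
Qed.

Lemma nm_chi_real q x : nm (chi q (mxR x)) = 1.
Proof. by rewrite /chi dotC_real nm_eR. Qed.

Lemma nm_chi q W : nm (chi q W) =
  expR (- (2 * pi * \sum_i \sum_j (q i j)%:~R * complex.Im (W i j))).
Proof.
rewrite /chi nm_e; congr (expR (- (_ * _))).
rewrite Im_sum; apply: eq_bigr => i _; rewrite Im_sum; apply: eq_bigr => j _.
by rewrite -(rmorph_int (real_complex R)) ImM/= mul0r addr0.
Qed.

Lemma chi_delta i j x :
  chi (delta_mx i j) (mxR x) = e (x i j)%:C.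
Proof.
congr e; rewrite dotC_real; congr (_%:C).
rewrite (bigD1 i)//= (bigD1 j)//= big1 ?addr0 => [|j' hj]; last first.
  by rewrite mxE (negbTE hj) andbF mul0r.
rewrite big1 ?addr0 => [|i' hi].
  by rewrite mxE !eqxx mul1r.
by rewrite big1// => j' _; rewrite mxE (negbTE hi) mul0r.
Qed.

End Characters.

(** * A function all of whose Fourier coefficients vanish is zero at 0 *)

Section FourierUnique.
Variables (R : realType) (m n : nat).
Local Notation C := R[i].
Local Notation MR := 'M[R]_(m, n).
Implicit Types (f g : MR -> C) (x : MR).

Definition mean0 g := (exists B, forall x, nm (g x) <= B) /\ mean g = 0.

Lemma mean0D f g : mean0 f -> mean0 g -> mean0 (fun x => f x + g x).
Proof.
move=> [[A hA] f0] [[B hB] g0]; split.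
  by exists (A + B) => x; exact: nmD_le.
by rewrite (meanD hA hB) f0 g0 addr0.
Qed.

Lemma mean0Z c g : mean0 g -> mean0 (fun x => c * g x).
Proof.
move=> [[B hB] g0]; split; last by rewrite (meanZ _ hB) g0 mulr0.
by exists (nm c * B) => x; rewrite nmM ler_wpM2l ?nm_ge0.
Qed.

Lemma mean0_ext f g : (forall x, f x = g x) -> mean0 f -> mean0 g.
Proof. by move=> fg; have -> : f = g by apply: funext. Qed.

Lemma mean0_sum (I : Type) (r : seq I) (F : I -> MR -> C) :
  (forall i, mean0 (F i)) -> mean0 (fun x => \sum_(i <- r) F i x).
Proof.
move=> h; elim: r => [|i r IH].
  apply: (@mean0_ext (fun=> 0)) => [x|]; first by rewrite big_nil.
  by split; [exists 0 => x; rewrite nm0|rewrite mean_const].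
by apply: (mean0_ext _ (mean0D (h i) IH)) => x; rewrite big_cons.
Qed.

(** Small enough, as 2 m n k <= 1, for [bump] to stay in [0, 1]; the successor keeps the denominator
    positive when m n = 0. *)
Let k : R := (2 * (m * n).+1%:R)^-1.

(** A trigonometric polynomial that equals 1 exactly at the integral points, so its powers
    concentrate there. *)
Definition bump x : R :=
  1 - \sum_i \sum_j k * (1 - cos (2 * pi * x i j)).

Lemma bump_trig x : (bump x)%:C =
  1 + \sum_i \sum_j ((- k%:C) + ((k / 2)%:C * chi (delta_mx i j) (mxR x) +
    (k / 2)%:C * chi (- delta_mx i j) (mxR x))).
Proof.
rewrite /bump rmorphB rmorph1/= rmorph_sum -sumrN; congr (_ + _).
apply: eq_bigr => i _; rewrite rmorph_sum -sumrN; apply: eq_bigr => j _.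
rewrite chiN chi_delta -eN /e /= !mulrN cosN sinN !(mulr0, oppr0, expR0).
by apply: complexP; rewrite !(ReD, ImD, ReN, ImN, ReM, ImM)/=; field.
Qed.

(** Multiplication by a trigonometric polynomial only mixes shifted frequencies, so orthogonality to
    all characters is preserved. *)
Lemma mean0_bump g :
  (forall q, mean0 (fun x => g x * chi q (mxR x))) ->
  forall q, mean0 (fun x => (g x * (bump x)%:C) * chi q (mxR x)).
Proof.
move=> h q.
apply: (@mean0_ext (fun x => g x * chi q (mxR x) + \sum_i \sum_j
   ((- k%:C) * (g x * chi q (mxR x)) +
     ((k / 2)%:C * (g x * chi (q + delta_mx i j) (mxR x)) +
      (k / 2)%:C * (g x * chi (q + - delta_mx i j) (mxR x)))))).
  move=> x; rewrite bump_trig mulrAC mulrDr mulr1; congr (_ + _).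
  rewrite mulr_sumr; apply: eq_bigr => i _; rewrite mulr_sumr.
  by apply: eq_bigr => j _; rewrite !chiD; ring.
apply: mean0D => //; apply: mean0_sum => i; apply: mean0_sum => j.
by do 2 ?[apply: mean0D]; apply: mean0Z.
Qed.

Lemma k_gt0 : 0 < k.
Proof. by rewrite invr_gt0 mulr_gt0// ltr0n. Qed.

Lemma sum_mn (a : R) : \sum_(i < m) \sum_(j < n) a = (m * n)%:R * a.
Proof. by rewrite mulr_natl !sumr_const !card_ord -mulrnA mulnC. Qed.

Lemma mnk_le : (m * n)%:R * k <= 2^-1.
Proof.
rewrite /k invfM mulrCA ler_piMr ?invr_ge0//.
by rewrite ler_pdivrMr ?ltr0n// mul1r ler_nat.
Qed.

Lemma bump_bound x : 0 <= bump x <= 1.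
Proof.
have k0 := k_gt0.
have hk i j : 0 <= k * (1 - cos (2 * pi * x i j)) <= k * 2.
  rewrite mulr_ge0 ?(ltW k0) ?subr_ge0 ?cos_le1//= ler_wpM2l ?(ltW k0)//.
  by have := cos_geN1 (2 * pi * x i j); lra.
rewrite /bump gerBl subr_ge0 !sumr_ge0 ?andbT; last first.
  by move=> i _; apply: sumr_ge0 => j _; case/andP: (hk i j).
apply: (@le_trans _ _ (\sum_(i < m) \sum_(j < n) k * 2)).
  by apply: ler_sum => i _; apply: ler_sum => j _; case/andP: (hk i j).
by rewrite sum_mn; have := mnk_le; lra.
Qed.

(** One entry alone lowers [bump] by this amount, the cosine being decreasing on [0, pi]. *)
Lemma bump_far x (d : R) i j : 0 < d -> d <= `|x i j| <= 2^-1 ->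
  bump x <= 1 - k * (1 - cos (2 * pi * d)).
Proof.
move=> d0 /andP[dx x2]; have k0 := k_gt0; rewrite /bump lerD2l lerN2.
have pos i' j' : 0 <= k * (1 - cos (2 * pi * x i' j')).
  by rewrite mulr_ge0 ?(ltW k0)// subr_ge0 cos_le1.
rewrite (bigD1 i)//= (bigD1 j)//= -addrA ler_wpDr//.
  by rewrite addr_ge0// sumr_ge0// => i' _; rewrite sumr_ge0.
rewrite ler_wpM2l ?(ltW k0)// lerD2l lerN2.
have -> : cos (2 * pi * x i j) = cos (2 * pi * `|x i j|).
  have [h|h] := leP 0 (x i j); rewrite ?(ger0_norm h)//.
  by rewrite (ltr0_norm h) mulrN cosN.
have p0 := pi_gt0 R.
have [->//|dx'] := eqVneq d `|x i j|.
rewrite ltW// ltr_cos ?in_itv/=.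
- by rewrite ltr_pM2l ?mulr_gt0// lt_neqAle dx'.
- by apply/andP; split; nra.
- by apply/andP; split; nra.
Qed.

Lemma bump_near x (d : R) : (forall i j, `|x i j| <= d) ->
  1 - (2 * pi * d) ^+ 2 / 2 <= bump x.
Proof.
move=> hd; have k0 := k_gt0; rewrite /bump lerD2l lerN2.
apply: (@le_trans _ _ (\sum_(i < m) \sum_(j < n) k * (2 * pi * d) ^+ 2)).
  apply: ler_sum => i _; apply: ler_sum => j _; rewrite ler_wpM2l ?(ltW k0)//.
  apply: (@le_trans _ _ ((2 * pi * x i j) ^+ 2)).
    by have := cos_near1 (2 * pi * x i j); rewrite ler_norml => /andP[]; lra.
  rewrite ![(2 * pi * _) ^+ 2]exprMn ler_wpM2l ?sqr_ge0//.
  by rewrite -[x i j ^+ 2]real_normK ?num_real// lerXn2r ?nnegrE// (le_trans _ (hd i j)).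
by rewrite sum_mn mulrA mulrC ler_wpM2l ?sqr_ge0// mnk_le.
Qed.

Lemma bump_periodic : periodic (fun x => (bump x)%:C).
Proof.
move=> x z; congr (_%:C); rewrite /bump; congr (1 - _).
apply: eq_bigr => i _; apply: eq_bigr => j _; congr (_ * (_ - _)).
have /(congr1 (@complex.Re R)) : e (x i j + (z i j)%:~R)%:C = e (x i j)%:C.
  by rewrite rmorphD/= rmorph_int eD e_int mulr1.
by rewrite /e /= !mulr0 oppr0 expR0 !mul1r !mul0r !subr0 !mxE.
Qed.

Lemma round_ex x : exists z : 'M[int]_(m, n),
  forall i j, `|(x + map_mx intr z) i j| <= 2^-1.
Proof.
exists (\matrix_(i, j) - Num.floor (x i j + 2^-1)) => i j.
rewrite !mxE intrN.
have := real_floor_le (num_real (x i j + 2^-1)).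
have := real_floorD1_gt (num_real (x i j + 2^-1)); rewrite intrD.
by set t := _%:~R => h1 h2; rewrite ler_norml; apply/andP; split; lra.
Qed.

(** Suppose g 0 <> 0 and let h = g / g 0. All means of h bump^N vanish. Yet the real part of the
    integrand is at least (1 - c / 2)^N / 2 on a cube of fixed volume at 0 and never below - A (1 -
    c)^N, which is too small to compensate for large N. *)
Lemma fourier_unique g (B : R) : (forall x, nm (g x) <= B) -> periodic g ->
  (forall eps : R, 0 < eps -> exists2 d : R, 0 < d &
     forall x, (forall i j, `|x i j| <= d) -> nm (g x - g 0) <= eps) ->
  (forall q, mean (fun x => g x * chi q (mxR x)) = 0) -> g 0 = 0.
Proof.
move=> hB gp gc g0; apply/eqP/negPn/negP => gN0.
pose h x := g x / g 0.
have hh q : mean0 (fun x => h x * chi q (mxR x)).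
  apply: (@mean0_ext (fun x => (g 0)^-1 * (g x * chi q (mxR x)))) => [x|].
    by rewrite /h; ring.
  apply: mean0Z; split=> //; exists B => x.
  by rewrite nmM nm_chi_real mulr1.
pose A := B / nm (g 0).
have hA x : nm (h x) <= A by rewrite /h nmM nmV ler_wpM2r ?invr_ge0 ?nm_ge0.
have A0 : 0 <= A by apply: le_trans (nm_ge0 _) (hA 0).
have n0 : 0 < nm (g 0) by rewrite nm_gt0.
have [|d1 d10 hd1] := gc (nm (g 0) / 2); first by rewrite divr_gt0.
pose d := Num.min d1 4^-1.
have d0 : 0 < d by rewrite lt_min d10 invr_gt0 ltr0n.
have dd1 : d <= d1 by rewrite ge_min lexx.
have d4 : d <= 4^-1 by rewrite ge_min lexx orbT.
have near x : (forall i j, `|x i j| <= d) -> 2^-1 <= complex.Re (h x).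
  move=> hx; have : nm (h x - 1) <= 2^-1.
    have -> : h x - 1 = (g x - g 0) / g 0 by rewrite mulrBl divff.
    rewrite nmM nmV ler_pdivrMr// mulrC; apply: hd1 => i j.
    exact: le_trans (hx i j) dd1.
  by move=> /(le_trans (ler_Re_nm _)); rewrite ReD ReN/= ler_norml => /andP[]; lra.
(* By [bump_far], [bump] is at most 1 - c off the d-neighbourhood of the integral points. *)
pose c := k * (1 - cos (2 * pi * d)).
have c0 : 0 < c.
  rewrite mulr_gt0 ?k_gt0// subr_gt0 -[X in _ < X]cos0.
  have p0 := pi_gt0 R.
  rewrite ltr_cos ?in_itv/=; first by rewrite !mulr_gt0.
  - by rewrite lexx pi_ge0.
  - by apply/andP; split; nra.
have c1 : c <= 1.
  have k2 : k <= 2^-1.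
    rewrite /k lef_pV2 ?posrE ?mulr_gt0 ?ltr0n//.
    by rewrite ler_peMr// ler1n.
  have := cos_geN1 (2 * pi * d); have := k_gt0; rewrite /c; nra.
(* On the cube of side e1, [bump_near] gives at least 1 - c / 2, strictly more than the bound
   outside. *)
have [e1 /andP[e10 e1d] he1] : exists2 e1 : R, 0 < e1 <= d &
    (2 * pi * e1) ^+ 2 / 2 <= c / 2.
  have p0 := pi_gt0 R; have pp : 0 < (2 * pi) ^+ 2 :> R by rewrite exprn_gt0// mulr_gt0.
  pose E := Num.min 1 (c / (2 * pi) ^+ 2).
  have E0 : 0 < E by rewrite lt_min ltr01 divr_gt0.
  pose e1 := Num.min d E; exists e1.
    by rewrite /e1; case: (leP d E) => [_|/ltW hE]; rewrite ?d0 ?E0/=.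
  have e1E : e1 <= E by rewrite /e1; case: (leP d E).
  have e1c : e1 <= c / (2 * pi) ^+ 2 by rewrite (le_trans e1E)// ge_min lexx orbT.
  have e11 : e1 <= 1 by rewrite (le_trans e1E)// ge_min lexx.
  have e10 : 0 < e1 by rewrite /e1; case: (leP d E).
  rewrite ler_pM2r ?invr_gt0// exprMn.
  rewrite mulrC -ler_pdivlMr//; apply: le_trans e1c.
  by rewrite expr2; nra.
have boxd : 0 < e1 < 1 by rewrite e10/=; lra.
pose kap := e1 ^+ (m * n).
have kap0 : 0 < kap by rewrite exprn_gt0.
have b0 : 0 < 1 - c / 2 by lra.
have hmean N : mean0 (fun x => h x * (bump x)%:C ^+ N).
  suff hq : forall q, mean0 (fun x => h x * (bump x)%:C ^+ N * chi q (mxR x)).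
    by apply: mean0_ext (hq 0) => x; rewrite chi0 mulr1.
  elim: N => [|N IH] q; first by apply: mean0_ext (hh q) => x; rewrite expr0 mulr1.
  by apply: mean0_ext (mean0_bump IH q) => x; rewrite exprSr !mulrA.
have key N : kap * 2^-1 * (1 - c / 2) ^+ N <= A * (1 - c) ^+ N.
  pose b := 2^-1 * (1 - c / 2) ^+ N.
  pose a := A * (1 - c) ^+ N.
  have b0' : 0 <= b by rewrite mulr_ge0// exprn_ge0// ltW.
  have a0' : 0 <= a by rewrite mulr_ge0// exprn_ge0// subr_ge0.
  have [[M hM] m0] := hmean N.
  have hbx x : nm (b%:C * box e1 x) <= b.
    rewrite nmM nmR ger0_norm// /box nm_nat ler_piMr//.
    by case: asboolP.
  have hbx2 x : nm (- a%:C) <= a by rewrite nmN nmR ger0_norm.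
  have := mean_Re_ge (fun x => nmD_le (hbx x) (hbx2 x)) hM.
  rewrite (meanD hbx hbx2) m0 mean_const.
  rewrite (@meanZ _ _ _ _ _ 1); last first.
    by move=> x; rewrite /box nm_nat; case: asboolP; rewrite ?ler01.
  rewrite ReD ReN ReM/= mul0r subr0 => hle; clear hbx2.
  suff hs : b * complex.Re (mean (box e1 : MR -> C)) - a <= 0.
    have h1 := ler_wpM2l b0' (mean_box_ge m n boxd).
    by rewrite -mulrA -/b -/a mulrC (le_trans h1)// -subr_le0.
  apply: hle => x; rewrite ReD ReN ReM/= mul0r subr0.
  have /andP[p0 p1] := bump_bound x.
  have -> : h x * (bump x)%:C ^+ N = ((bump x) ^+ N)%:C * h x by rewrite rmorphXn mulrC.
  rewrite ReM/= mul0r subr0 /box; case: asboolP => hx /=.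
    rewrite mulr1; have hx' i j : `|x i j| <= e1.
      by have /andP[? ?] := hx i j; rewrite ger0_norm.
    have hr := near x (fun i j => le_trans (hx' i j) e1d).
    have hbp : 1 - c / 2 <= bump x.
      by apply: le_trans (bump_near hx'); rewrite lerD2l lerN2.
    have : (1 - c / 2) ^+ N <= bump x ^+ N by rewrite lerXn2r ?nnegrE// ltW.
    have : 0 <= (1 - c / 2) ^+ N by rewrite exprn_ge0// ltW.
    by rewrite /b; move: (bump x ^+ N) ((1 - c / 2) ^+ N) (complex.Re (h x)) hr => *; nra.
  rewrite mulr0 sub0r.
  (* Move x to the unit cell centred at 0: it is then d-close to 0, where Re h > 0, or far from it,
     where [bump_far] applies. *)
  have [z hz] := round_ex x; set x0 := x + _ in hz.
  have -> : h x = h x0 by rewrite /h gp.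
  have Eb : bump x = bump x0 by have /complexI := bump_periodic x z.
  rewrite Eb in p0 p1 *.
  have [nr|/existsNP[i /existsNP[j /negP]]] := pselect (forall i j, `|x0 i j| <= d).
    rewrite (@le_trans _ _ 0) ?oppr_le0// mulr_ge0 ?exprn_ge0//.
    by apply: le_trans (near _ nr); rewrite invr_ge0.
  rewrite -ltNge => hij.
  have hf : bump x0 <= 1 - c by apply: (@bump_far _ _ i j d0); rewrite hz ltW.
  have hp : bump x0 ^+ N <= (1 - c) ^+ N by rewrite lerXn2r ?nnegrE// subr_ge0.
  have hre : - A <= complex.Re (h x0).
    rewrite lerNl; apply: le_trans (hA x0); apply: le_trans (ler_Re_nm _).
    by rewrite -normrN ler_norm.
  have p3 : 0 <= bump x0 ^+ N * (complex.Re (h x0) + A).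
    by rewrite mulr_ge0 ?exprn_ge0//; lra.
  have p4 : 0 <= A * ((1 - c) ^+ N - bump x0 ^+ N) by rewrite mulr_ge0// subr_ge0.
  by move: p3 p4; rewrite /a mulrDr mulrBr; lra.
have A1 : 0 < A + 1 by lra.
have ht : 0 <= (1 - c) / (1 - c / 2) < 1.
  by rewrite divr_ge0 ?(ltW b0) ?subr_ge0//= ltr_pdivrMr// mul1r; lra.
have kap2 : 0 < kap / 2 by rewrite divr_gt0.
have [N hN] := geom_lim0 ht (divr_gt0 kap2 A1).
have := key N; rewrite -ler_pdivlMr ?exprn_gt0// -mulrA -expr_div_n => hk.
move: hN; rewrite ltr_pdivlMr//; move: hk; set t := _ ^+ N.
have : 0 <= t by rewrite exprn_ge0//; case/andP: ht.
by move: (kap * _) => w; nra.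
Qed.

End FourierUnique.

(** * Summable weights on integer matrices *)

Section LatticeSum.
Variable R : realType.

Definition wt (k : int) : R := (1 + k%:~R ^+ 2)^-1.

Lemma wt_ge0 k : 0 <= wt k.
Proof. by rewrite invr_ge0 addr_ge0// sqr_ge0. Qed.

Lemma wtN k : wt (- k) = wt k.
Proof. by rewrite /wt intrN sqrrN. Qed.

(** Telescoping, from 1 / (1 + n^2) <= 4 / ((n + 1) (n + 2)). *)
Lemma sum_wt_nat N : \sum_(n < N) wt n%:Z <= 4 - 4 / N.+1%:R.
Proof.
elim: N => [|N IH]; first by rewrite big_ord0 divr1 subrr.
rewrite big_ord_recr/=; apply: le_trans (lerD IH (lexx _)) _.
rewrite /wt -pmulrn.
have N0 : 0 <= N%:R :> R by rewrite ler0n.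
rewrite -[N.+2%:R]natr1 -[N.+1%:R]natr1; set x : R := N%:R in N0 *.
rewrite -subr_ge0.
have -> : 4 - 4 / (x + 1 + 1) - (4 - 4 / (x + 1) + (1 + x ^+ 2)^-1) =
   (3 * x ^+ 2 - 3 * x + 2) / ((x + 1) * (x + 1 + 1) * (1 + x ^+ 2)).
  field; do !(apply/andP; split); apply/eqP => h; nra.
apply: divr_ge0; first by nra.
by rewrite !mulr_ge0//; nra.
Qed.

Lemma sum_fset_nat (f : nat -> R) N (H : {fset nat}) : (forall n, 0 <= f n) ->
  (forall n, n \in H -> (n < N)%N) -> \sum_(n <- H) f n <= \sum_(n < N) f n.
Proof.
move=> f0; elim: N H => [|N IH] H hH.
  rewrite big_ord0 big1_seq// => i /= /hH; by rewrite ltn0.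
rewrite big_ord_recr/=.
have h2 : \sum_(n <- (H `\ N)%fset) f n <= \sum_(n < N) f n.
  by apply: IH => n; rewrite !inE => /andP[nN /hH]; rewrite ltnS leq_eqVlt (negbTE nN).
case: (boolP (N \in H)) => hN.
  by rewrite (big_fsetD1 N)//= addrC lerD.
have E : (H `\ N)%fset = H by apply/fsetP => n; rewrite !inE; case: eqP => // ->; rewrite (negbTE hN).
by rewrite -E (le_trans h2)// lerDl.
Qed.

Lemma sum_wt_fset_nat (H : {fset nat}) : \sum_(n <- H) wt n%:Z <= 4.
Proof.
have [N hN] : exists N, forall n, n \in H -> (n < N)%N.
  exists (\max_(n <- H) n).+1 => n nH; rewrite ltnS.
  exact: (@leq_bigmax_seq _ _ xpredT id).
apply: (le_trans (@sum_fset_nat (fun n => wt n%:Z) N H _ hN)).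
  by move=> n; exact: wt_ge0.
by apply: (le_trans (sum_wt_nat N)); rewrite gerBl divr_ge0.
Qed.

Lemma sum_wt_abs (H : {fset int}) : {in H &, injective (fun k : int => `|k|%N)} ->
  \sum_(k <- H) wt k <= 4.
Proof.
move=> hi; rewrite (le_trans _ (sum_wt_fset_nat [fset `|k|%N | k in H]%fset))//.
rewrite big_imfset//= le_eqVlt; apply/orP; left; apply/eqP; apply: eq_bigr => k _.
by case: (intP k) => [//|n|n]; rewrite ?abszN ?wtN.
Qed.

Lemma sum_wt (H : {fset int}) : \sum_(k <- H) wt k <= 8.
Proof.
rewrite (big_fsetID _ [pred k : int | 0 <= k])/= (_ : 8 = 4 + 4); last by ring.
rewrite lerD// sum_wt_abs// => k k'; rewrite !inE /=.
  by move=> /andP[_ h] /andP[_ h'] /(congr1 Posz); rewrite !gez0_abs.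
rewrite -!ltNge => /andP[_ h] /andP[_ h'] /(congr1 Posz).
by rewrite !ltz0_abs// => /oppr_inj.
Qed.

(** Fibre G over the values of the first coordinate: each fibre is handled by induction, and the
    weights of the values sum to at most 8. *)
Lemma sum_coords (I : choiceType) (cs : seq (I -> int)) (G : {fset I}) :
  (forall x y, x \in G -> y \in G -> all (fun c => c x == c y) cs -> x = y) ->
  \sum_(x <- G) \prod_(c <- cs) wt (c x) <= 8 ^+ size cs.
Proof.
elim: cs G => [|c cs IH] G hG.
  under eq_bigr do rewrite big_nil.
  have [->|[x xG]] := fset_0Vmem G; first by rewrite big_seq_fset0 expr0.
  have -> : G = [fset x]%fset.
    apply/fsetP => y; rewrite inE; apply/idP/eqP => [yG|->//].
    by apply: hG.
  by rewrite big_seq_fset1.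
under eq_bigr do rewrite big_cons.
rewrite (partition_big_imfset _ c)/=.
apply: (@le_trans _ _ (\sum_(k <- [fset c x | x in G]%fset) wt k * 8 ^+ size cs)).
  apply: ler_sum => k _.
  rewrite big_fset_condE/= (eq_big_seq (fun x => wt k * \prod_(c <- cs) wt (c x))).
    rewrite -mulr_sumr ler_wpM2l ?wt_ge0// IH// => x y; rewrite !inE/=.
    move=> /andP[xG /eqP xk] /andP[yG /eqP yk] h; apply: hG => //=.
    by rewrite xk yk eqxx.
  by move=> x; rewrite !inE => /andP[_ /eqP ->].
by rewrite -mulr_suml exprS ler_wpM2r ?exprn_ge0// sum_wt.
Qed.

Lemma expR_wt (c : R) : 0 < c -> exists2 A, 0 < A &
  forall k : int, expR (- (c * `|k%:~R|)) <= A * wt k.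
Proof.
(* From exp(c x) >= (1 + c x / 2)^2 and (4 / c^2) (c x / 2)^2 = x^2. *)
move=> c0; exists (1 + 4 / c ^+ 2).
  by rewrite ltr_pwDl// divr_ge0// sqr_ge0.
move=> k; rewrite expRN /wt -[leRHS]invrK invfM invrK lef_pV2 ?posrE ?expR_gt0//; last first.
  by rewrite mulr_gt0// ?invr_gt0 ?ltr_pwDl ?sqr_ge0// divr_ge0// sqr_ge0.
set x : R := `|_|.
have -> : k%:~R ^+ 2 = x ^+ 2 :> R by rewrite /x real_normK ?num_real.
have x0 : 0 <= x by exact: normr_ge0.
have h1 : (1 + c * x / 2) ^+ 2 <= expR (c * x).
  have h0 : 0 <= c * x / 2 by rewrite divr_ge0// mulr_ge0// ltW.
  have {2}-> : c * x = (c * x / 2) *+ 2 by rewrite -mulr_natr divfK.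
  by rewrite expR_mulrn lerXn2r ?nnegrE ?expR_ge0 ?expR_ge1Dx// addr_ge0.
apply: le_trans h1.
have c2 : 0 < c ^+ 2 by rewrite exprn_gt0.
rewrite ler_pdivrMl; last by rewrite ltr_pwDl// divr_ge0// ltW.
have -> : (1 + 4 / c ^+ 2) * (1 + c * x / 2) ^+ 2 =
  (1 + c * x / 2) ^+ 2 + (4 / c ^+ 2 + 4 * x / c + x ^+ 2) by field; rewrite gt_eqF.
have t0 : 0 <= c * x / 2 by rewrite divr_ge0// mulr_ge0// ltW.
have : 0 <= 4 / c ^+ 2 by rewrite divr_ge0// ltW.
have : 0 <= 4 * x / c by rewrite divr_ge0 ?mulr_ge0// ltW.
by move: t0; set t := c * x / 2; nra.
Qed.

End LatticeSum.

Section LatticeMx.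
Variables (R : realType) (m n : nat).

Lemma sum_le_mx : sum_le [set: 'M[int]_(m, n)]
  (fun q => \prod_i \prod_j wt R (q i j)) (8 ^+ (m * n)).
Proof.
move=> G _; pose ps := enum {: 'I_m * 'I_n}.
pose cs := [seq (fun q : 'M[int]_(m, n) => q p.1 p.2) | p <- ps].
have hs : size cs = (m * n)%N.
  by rewrite size_map -cardE card_prod !card_ord.
rewrite -hs; apply: (@le_trans _ _ (\sum_(x <- G) \prod_(c <- cs) wt R (c x))).
  apply: ler_sum => q _; rewrite big_map /ps big_enum/=.
  by rewrite (pair_bigA _ (fun i j => wt R (q i j))).
apply: sum_coords => x y _ _; rewrite all_map => /allP h.
by apply/matrixP => i j; apply/eqP/(h (i, j)); rewrite mem_enum.
Qed.

End LatticeMx.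

(** * Absolute convergence and means of series *)

Section MeanSeries.
Variables (R : realType) (m n : nat).
Local Notation C := R[i].
Local Notation MR := 'M[R]_(m, n).

Lemma sum_real_le (I : choiceType) (G : {fset I}) (u : I -> R) (B : R) :
  (forall H : {fset I}, (H `<=` G)%fset -> `|\sum_(i <- H) u i| <= B) ->
  \sum_(i <- G) `|u i| <= 2 * B.
Proof.
move=> h; rewrite (big_fsetID _ [pred i | 0 <= u i])/= mulr_natl mulr2n lerD//.
  rewrite (eq_big_seq u) => [|i]; last by rewrite !inE/= => /andP[_ /ger0_norm].
  apply: le_trans (ler_norm _) (h _ _).
  by apply/fsubsetP => i; rewrite !inE => /andP[].
rewrite (eq_big_seq (fun i => - u i)) => [|i]; last first.
  by rewrite !inE/= => /andP[_]; rewrite -ltNge => /ltr0_norm.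
rewrite sumrN; apply: le_trans (ler_norm _) _; rewrite normrN; apply: h.
by apply/fsubsetP => i; rewrite !inE => /andP[].
Qed.

(** The Cauchy criterion bounds all finite sums disjoint from some F by 2; splitting by the signs of
    real and imaginary parts turns this into a bound for sums of moduli. *)
Lemma has_sum_abs (I : choiceType) (D : set I) (f : I -> C) (s : C) :
  has_sum D f s -> exists B, sum_le D (fun i => nm (f i)) B.
Proof.
move=> /has_sumP /(_ _ ltr01)[F FD hF].
have hd (G : {fset I}) : subD D G -> [disjoint F & G]%fset ->
    nm (\sum_(i <- G) f i) <= 2.
  move=> GD dFG.
  have -> : \sum_(i <- G) f i =
      (\sum_(i <- (F `|` G)%fset) f i - s) - (\sum_(i <- F) f i - s).
    rewrite opprB addrA subrK big_fsetD ?fsubsetUl//; congr bigop.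
    apply: congr1; apply/fsetP => i; rewrite !inE.
    by case: (boolP (i \in F)) => //= iF; rewrite (negbTE (fdisjointP dFG _ iF)).
  rewrite (le_trans (nmB _ _))// (_ : 2 = 1 + 1)// lerD// ltW// hF//.
    exact: subDU.
  exact: fsubsetUl.
have hd2 (G : {fset I}) : subD D G -> [disjoint F & G]%fset ->
    \sum_(i <- G) nm (f i) <= 2 * 2 + 2 * 2.
  move=> GD dFG; apply: (@le_trans _ _
     (\sum_(i <- G) (`|complex.Re (f i)| + `|complex.Im (f i)|))).
    by apply: ler_sum => i _; exact: nm_le_ReIm.
  have hG (H : {fset I}) : (H `<=` G)%fset -> nm (\sum_(i <- H) f i) <= 2.
    move=> HG; apply: hd; first exact: subD_sub GD.
    by apply/fdisjointP => i /(fdisjointP dFG); apply: contra => /(fsubsetP HG).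
  rewrite big_split lerD//; apply: sum_real_le => H HG.
    by rewrite -Re_sum (le_trans (ler_Re_nm _))// hG.
  by rewrite -Im_sum (le_trans (ler_Im_nm _))// hG.
exists (\sum_(i <- F) nm (f i) + (2 * 2 + 2 * 2)) => G GD.
have GUD := subDU FD GD.
apply: (@le_trans _ _ (\sum_(i <- (F `|` G)%fset) nm (f i))).
  by apply: (sum_leS _ GUD); rewrite ?fsubsetUr// => i _; exact: nm_ge0.
rewrite -lerBlDl big_fsetD ?fsubsetUl// hd2//.
  exact: subD_sub (fsubsetDl _ _) GUD.
by apply/fdisjointP => i iF; rewrite !inE iF.
Qed.

(** The majorant b is independent of x, so the truncation error is uniform in x and survives the
    mean. *)
Lemma mean_has_sum (I : choiceType) (D : set I) (F : I -> MR -> C)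
    (S : MR -> C) (b : I -> R) (B : R) :
  (forall i x, D i -> nm (F i x) <= b i) -> sum_le D b B ->
  (forall x, has_sum D (F^~ x) (S x)) -> has_sum D (fun i => mean (F i)) (mean S).
Proof.
move=> Fb hB hS; apply/has_sumP => eps e0.
have e2 : 0 < eps / 2 by rewrite divr_gt0.
have b0 i : D i -> 0 <= b i by move=> Di; apply: le_trans (Fb i 0 Di); exact: nm_ge0.
have [F0 F0D hF0] := sum_le_tail b0 hB e2.
exists F0 => // G GD FG.
have SB x : nm (S x) <= B by apply: (has_sum_le _ hB (hS x)) => i; exact: Fb.
have hbd i : i \in G -> exists B0, forall x, nm (F i x) <= B0.
  by move=> iG; exists (b i) => x; apply/Fb/GD.
rewrite -mean_sum// -[- mean S]mulN1r -(meanZ _ SB).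
have hGB x : nm (\sum_(i <- G) F i x) <= \sum_(i <- G) b i.
  rewrite (le_trans (nm_sum _ _ _))// big_seq [leRHS]big_seq ler_sum// => i /GD.
  exact: Fb.
have SB' x : nm (-1 * S x) <= B by rewrite mulN1r nmN.
rewrite -(meanD hGB SB'); apply: (@le_lt_trans _ _ (eps / 2)); last by lra.
apply: mean_le => x; rewrite mulN1r nmBC.
apply: (has_sum_tail _ GD _ (hS x)) => [i|H HD dGH]; first exact: Fb.
apply: hF0 => //; apply/fdisjointP => i /(fsubsetP FG); exact/fdisjointP.
Qed.

End MeanSeries.

(** * Means of functions holomorphic near real translates of a point *)

Section Tame.
Variables (R : realType) (m n : nat).
Local Notation C := R[i].
Local Notation MC := 'M[C]_(m, n).
Local Notation MR := 'M[R]_(m, n).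
Implicit Types (f g : MC -> C) (W U : MC) (x y u : MR).

Definition small U := forall i j, nm (U i j) <= 1.

(* Holomorphy and boundedness near W + R^(m x n), in the weak form needed:
   on every complex line through W + x the function is in the disc algebra. *)
Definition tame_at f W (rho B : R) := forall x U, small U ->
  Ap rho (fun s => f (W + mxR x + s *: U)) /\
  forall s, nm s <= rho -> nm (f (W + mxR x + s *: U)) <= B.

Definition tame_on (dom : set MC) f := forall W, dom W ->
  exists2 rho, 0 < rho & exists B, tame_at f W rho B.

Definition cperiodic f := forall W (z : 'M[int]_(m, n)), f (W + mxZ R z) = f W.

Lemma mxR0 : mxR (0 : MR) = 0.
Proof. by apply/matrixP => i j; rewrite !mxE. Qed.

Lemma mxRZ (a : R) x : mxR (a *: x) = a%:C *: mxR x.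
Proof. by apply/matrixP => i j; rewrite !mxE rmorphM. Qed.

Lemma small0 : small 0.
Proof. by move=> i j; rewrite mxE nm0. Qed.

Lemma tame_at_bound f W rho B : 0 < rho -> tame_at f W rho B ->
  forall x, nm (f (W + mxR x)) <= B.
Proof.
move=> r0 ht x; have [_ /(_ 0)] := ht x 0 small0.
by rewrite nm0 scale0r addr0; apply; exact: ltW.
Qed.

Lemma tame_atM f g W rho A B : tame_at f W rho A -> tame_at g W rho B ->
  tame_at (fun W => f W * g W) W rho (A * B).
Proof.
move=> hf hg x U sU; have [f1 f2] := hf x U sU; have [g1 g2] := hg x U sU.
split; first exact: ApM.
by move=> s sr; rewrite nmM ler_pM ?nm_ge0 ?f2 ?g2.
Qed.

Lemma tame_at_const c W rho : tame_at (fun=> c) W rho (nm c).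
Proof. by move=> x U _; split => //; exact: Ap_const. Qed.

Lemma tame_at_sum (I : eqType) (r : seq I) (F : I -> MC -> C) (B : I -> R) W rho :
  (forall i, i \in r -> tame_at (F i) W rho (B i)) ->
  tame_at (fun W => \sum_(i <- r) F i W) W rho (\sum_(i <- r) B i).
Proof.
move=> h x U sU; split.
  by apply: Ap_sum => i ir; case: (h i ir x U sU).
move=> s sr; rewrite (le_trans (nm_sum _ _ _))// big_seq [leRHS]big_seq ler_sum//.
by move=> i ir; have [_] := h i ir x U sU; exact.
Qed.

Lemma dotC_Z q W (s : C) : dotC q (s *: W) = s * dotC q W.
Proof.
rewrite /dotC mulr_sumr; apply: eq_bigr => i _; rewrite mulr_sumr.
by apply: eq_bigr => j _; rewrite mxE mulrCA.
Qed.

Lemma nm_dotC_small q U : small U ->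
  nm (dotC q U) <= \sum_i \sum_j `|(q i j)%:~R : R|.
Proof.
move=> sU; rewrite (le_trans (nm_sum _ _ _))// ler_sum// => i _.
rewrite (le_trans (nm_sum _ _ _))// ler_sum// => j _.
by rewrite nmM -(rmorph_int (real_complex R)) nmR ler_piMr.
Qed.

Lemma Ap_chi q W U rho : Ap rho (fun s => chi q (W + s *: U)).
Proof.
apply: Ap_e; apply: (@Ap_ext _ _ (fun s => dotC q W + s * dotC q U)).
  by move=> s _; rewrite dotCD dotC_Z.
apply: ApD; first exact: Ap_const.
by apply: ApM; [exact: Ap_id|exact: Ap_const].
Qed.

Lemma tame_chi q W rho : 0 <= rho -> exists B, tame_at (chi q) W rho B.
Proof.
move=> r0; pose K : R := \sum_i \sum_j `|(q i j)%:~R : R|.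
exists (nm (chi q W) * expR (2 * pi * (rho * K))) => x U sU; split.
  exact: Ap_chi.
move=> s sr; rewrite !chi_add (nmM (chi q W * _)) (nmM (chi q W)).
rewrite nm_chi_real mulr1 ler_wpM2l ?nm_ge0//.
rewrite /chi dotC_Z nm_e ler_expR -mulrN ler_wpM2l ?mulr_ge0 ?pi_ge0//.
apply: (@le_trans _ _ (nm (s * dotC q U))).
  by rewrite (le_trans _ (ler_Im_nm _))// -normrN ler_norm.
by rewrite nmM ler_pM ?nm_ge0 ?nm_dotC_small.
Qed.

Lemma small_scale y (d : R) : 0 < d -> (forall i j, `|y i j| <= d) ->
  small (d^-1%:C *: mxR y).
Proof.
move=> d0 hy i j; rewrite !mxE -rmorphM/= nmR normrM normfV (gtr0_norm d0).
by rewrite mulrC ler_pdivrMr// mul1r.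
Qed.

(** The displacement y is the point s = d on the complex line in the direction y / d, which is
    [small], so [Ap_lip] applies. *)
Lemma tame_lipu f W rho B : 0 < rho -> tame_at f W rho B ->
  lipu (fun x => f (W + mxR x)) (2 * B / rho) (rho / 2).
Proof.
move=> r0 ht x y d /andP[d0 hd] hy.
have [d1|d1] := ltP 0 d; last first.
  have y0 : y = 0.
    apply/matrixP => i j; rewrite mxE; apply/eqP; rewrite -normr_le0.
    exact: le_trans (hy i j) d1.
  have -> : d = 0 by apply/eqP; rewrite eq_le d0 d1.
  by rewrite y0 addr0 subrr nm0 mulr0.
have [h1 h2] := ht x _ (small_scale d1 hy).
have nd : nm (d%:C : C) = d by rewrite nmR ger0_norm.
have := Ap_lip r0 h1 h2 (_ : nm d%:C <= rho / 2); rewrite nd => /(_ hd).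
rewrite scalerA -rmorphM/= divff ?gt_eqF// scale1r scale0r addr0 -addrA -mxRD.
by rewrite mulrA mulrAC.
Qed.

Lemma cperiodic_mean f W : cperiodic f -> periodic (fun x => f (W + mxR x)).
Proof. by move=> hp x z; rewrite mxRD mxR_int addrA hp. Qed.

Definition mean_at f W : C := mean (fun x => f (W + mxR x)).

Lemma mean_at_real f W rho B u : 0 < rho -> tame_at f W rho B -> cperiodic f ->
  mean_at f (W + mxR u) = mean_at f W.
Proof.
move=> r0 ht hp.
have r2 : 0 < rho / 2 by rewrite divr_gt0.
rewrite -[RHS](mean_shift u r2 (tame_at_bound r0 ht) (cperiodic_mean W hp)
  (tame_lipu r0 ht)).
by apply: eq_mean => x; rewrite mxRD addrA addrAC.
Qed.

Lemma mean_comb_le (g1 g2 g3 : MR -> C) (B1 B2 B3 K : R) :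
  (forall x, nm (g1 x) <= B1) -> (forall x, nm (g2 x) <= B2) ->
  (forall x, nm (g3 x) <= B3) ->
  (forall x, nm (g1 x - g3 x - 'i * (g2 x - g3 x)) <= K) ->
  nm (mean g1 - mean g3 - 'i * (mean g2 - mean g3)) <= K.
Proof.
move=> h1 h2 h3 h.
have h3' x : nm (-1 * g3 x) <= B3 by rewrite mulN1r nmN.
have h4 x := nmD_le (h1 x) (h3' x).
have h5 x := nmD_le (h2 x) (h3' x).
have h6 x : nm (- 'i * (g2 x + -1 * g3 x)) <= B2 + B3.
  by rewrite nmM nmN nm_i mul1r.
rewrite -mulNr -[- mean g3]mulN1r -(meanZ _ h3) -(meanD h1 h3') -(meanD h2 h3').
rewrite -(meanZ _ h5) -(meanD h4 h6); apply: mean_le => x.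
by rewrite !mulN1r mulNr.
Qed.

(** [Ap_taylor] averaged over x; the term with the real step drops out by [mean_at_real]. *)
Lemma mean_at_imag f W rho B u d : 0 < rho -> tame_at f W rho B -> cperiodic f ->
  small (mxR u) -> 0 <= d <= rho / 2 ->
  nm (mean_at f (W + ('i * d%:C) *: mxR u) - mean_at f W) <= 4 * B * (d / rho) ^+ 2.
Proof.
move=> r0 ht hp su hd.
have r2 : 0 < rho / 2 by rewrite divr_gt0.
have /andP[d0 dr] := hd.
have b1 := tame_at_bound r0 ht.
have nd : nm (d%:C : C) = d by rewrite nmR ger0_norm.
have nid : nm ('i * d%:C : C) = d by rewrite nmM nm_i mul1r.
have hs s : nm s <= rho -> forall x, nm (f (W + s *: mxR u + mxR x)) <= B.
  by move=> sr x; have [_ h] := ht x _ su; rewrite addrAC; exact: h.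
have dr' : d <= rho by lra.
have b2 x : nm (f (W + ('i * d%:C) *: mxR u + mxR x)) <= B by apply: hs; rewrite nid.
have b3 x : nm (f (W + d%:C *: mxR u + mxR x)) <= B by apply: hs; rewrite nd.
have e3 : mean_at f (W + d%:C *: mxR u) = mean_at f W.
  by rewrite -mxRZ (mean_at_real _ r0 ht).
suff : nm (mean_at f (W + ('i * d%:C) *: mxR u) - mean_at f W
    - 'i * (mean_at f (W + d%:C *: mxR u) - mean_at f W)) <= 4 * B * (d / rho) ^+ 2.
  move: e3; move: (mean_at f (W + d%:C *: mxR u)) (mean_at f W)
    (mean_at f (W + ('i * d%:C) *: mxR u)) => m1 m2 m3 ->.
  by rewrite subrr mulr0 subr0.
apply: (mean_comb_le b2 b3 b1) => x.
have [h1 h2] := ht x _ su.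
by have := Ap_taylor r0 h1 h2 hd; rewrite scale0r addr0 !(addrAC W (mxR x)).
Qed.

End Tame.

(** The derivative is 0 at every point, so the mean value theorem applies; d and K are chosen after
    t, so only local bounds have to be supplied. *)
Lemma locally_quad_const (R : realType) (h : R -> R) :
  (forall t : R, 0 <= t <= 1 -> exists2 d : R, 0 < d & exists2 K : R, 0 <= K &
     forall s : R, `|s| <= d -> `|h (t + s) - h t| <= K * s ^+ 2) -> h 1 = h 0.
Proof.
move=> hq.
have hd (t : R) : 0 <= t <= 1 -> is_derive t 1 h 0.
  move=> /hq[d d0 [K K0 hK]].
  have hc : (fun s => s^-1 *: (h (s *: (1 : R) + t) - h t)) @ 0^' --> (0 : R).
    apply/cvgrPdist_le => eps e0; near=> s.
    have s0 : s != 0 by near: s; exact: nbhs_dnbhs_neq.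
    have sd : `|s| <= d by near: s; exact: dnbhs0_le.
    have se : `|s| <= eps / (K + 1) by near: s; apply: dnbhs0_le; rewrite divr_gt0// ltr_wpDl.
    rewrite sub0r normrN normrM normfV.
    rewrite mulrC ler_pdivrMr ?normr_gt0// scaler1 [s + t]addrC.
    apply: (le_trans (hK s sd)); rewrite -[s ^+ 2]real_normK ?num_real// expr2 mulrA.
    rewrite ler_wpM2r//; move: se; rewrite ler_pdivlMr ?ltr_wpDl// mulrC.
    by apply: le_trans; rewrite ler_wpM2r// lerDl.
  by apply: DeriveDef; [apply/cvg_ex; exists 0; exact: hc|exact: cvg_lim hc].
have [||c _] := @MVT R h (fun=> 0) 0 1 ltr01.
- by move=> t; rewrite in_itv/= => /andP[t0 t1]; apply: hd; rewrite !ltW.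
- apply: derivable_within_continuous => t; rewrite in_itv/= => ht.
  by have [] := hd t ht.
by rewrite mul0r => /eqP; rewrite subr_eq0 => /eqP.
Unshelve. all: by end_near. Qed.

(** * Fourier expansion on tube domains *)

Section FourierExpansion.
Variables (R : realType) (m n : nat).
Local Notation C := R[i].
Local Notation MC := 'M[C]_(m, n).
Local Notation MR := 'M[R]_(m, n).
Implicit Types (f g : MC -> C) (W U : MC) (x y u : MR) (q : 'M[int]_(m, n)).

Definition iR u : MC := 'i *: mxR u.

Definition coef f q W : C := mean_at (fun W => f W * chi (- q) W) W.

Lemma tame_coef f q W rho B : 0 < rho -> tame_at f W rho B ->
  exists B', tame_at (fun W => f W * chi (- q) W) W rho B'.
Proof.
move=> r0 hf; have [A hA] := tame_chi (- q) W (ltW r0).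
by exists (B * A); exact: tame_atM.
Qed.

Lemma cperiodic_coef f q : cperiodic f -> cperiodic (fun W => f W * chi (- q) W).
Proof. by move=> fp W z; rewrite fp chi_add chi_int mulr1. Qed.

(** A tube over an open convex base: real directions are free, and openness and convexity concern
    the imaginary part. *)
Record tame_domain (dom : set MC) := TameDomain {
  dom_real : forall W x, dom W -> dom (W + mxR x);
  dom_open : forall W, dom W -> exists2 d : R, 0 < d &
     forall y, (forall i j, `|y i j| <= d) -> dom (W + iR y);
  dom_seg : forall W y (t : R), dom W -> dom (W + iR y) -> 0 <= t <= 1 ->
     dom (W + iR (t *: y)) }.

Lemma iRD x y : iR (x + y) = iR x + iR y.
Proof. by rewrite /iR mxRD scalerDr. Qed.

Lemma mxR_Re_Im W : W = mxR (map_mx (@complex.Re R) W) +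
  iR (map_mx (@complex.Im R) W).
Proof. by apply/matrixP => i j; rewrite !mxE [LHS]complexE. Qed.

Lemma mx_bound u : exists2 K : R, 0 < K & forall i j, `|u i j| <= K.
Proof.
exists (1 + \sum_i \sum_j `|u i j|).
  by rewrite ltr_pwDl// sumr_ge0// => i _; rewrite sumr_ge0.
move=> i j; rewrite (bigD1 i)//= (bigD1 j)//=.
have h1 : 0 <= \sum_(k | k != j) `|u i k| by rewrite sumr_ge0.
have h2 : 0 <= \sum_(k | k != i) \sum_l `|u k l|.
  by rewrite sumr_ge0// => k _; rewrite sumr_ge0.
lra.
Qed.

Lemma tame_at_quad f W rho B u (K : R) : 0 < rho -> tame_at f W rho B ->
  cperiodic f -> 0 < K -> (forall i j, `|u i j| <= K) ->
  forall s : R, `|s| <= rho / 2 / K ->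
  nm (mean_at f (W + iR (s *: u)) - mean_at f W) <= 4 * B * (K / rho) ^+ 2 * s ^+ 2.
Proof.
move=> r0 ht fp K0 hu s hs.
pose v := (Num.sg s / K) *: u.
have hv : small (mxR v).
  move=> i j; rewrite !mxE nmR !normrM normfV (gtr0_norm K0) mulrAC.
  rewrite ler_pdivrMr// mul1r; apply: le_trans (hu i j).
  by rewrite ler_piMl// normr_sg; case: (s != 0).
have d0 : 0 <= `|s| * K by rewrite mulr_ge0// ltW.
have hd : 0 <= `|s| * K <= rho / 2 by rewrite d0/= -ler_pdivlMr.
have := mean_at_imag r0 ht fp hv hd.
have -> : ('i * (`|s| * K)%:C) *: mxR v = iR (s *: u).
  rewrite /iR !mxRZ !scalerA -mulrA -!rmorphM/= {3}[s]numEsg.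
  congr (('i * _%:C) *: _).
  by rewrite mulrA [_ * K * _]mulrAC mulfK ?gt_eqF// mulrC.
move/le_trans; apply; by rewrite !exprMn real_normK ?num_real//; lra.
Qed.

(** Real displacements are covered by [mean_at_real]; along an imaginary segment the mean varies
    only quadratically around each point, hence is constant. *)
Lemma mean_at_indep dom f W W' : tame_domain dom -> tame_on dom f -> cperiodic f ->
  dom W -> dom W' -> mean_at f W = mean_at f W'.
Proof.
move=> hdom ht fp dW dW'.
pose x := map_mx (@complex.Re R) (W' - W).
pose y := map_mx (@complex.Im R) (W' - W).
have EW : W' = W + iR y + mxR x.
  by rewrite -addrA [iR y + _]addrC -mxR_Re_Im addrC subrK.
have dWy : dom (W + iR y).
  rewrite (_ : W + iR y = W' + mxR (- x)); first exact: dom_real.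
  rewrite EW -addrA -mxRD subrr (_ : mxR 0 = 0) ?addr0//.
  exact: mxR0.
rewrite EW; have [rho r0 [B hB]] := ht _ dWy.
rewrite (mean_at_real _ r0 hB fp).
have [K K0 hK] := mx_bound y.
(* p will be the real, then the imaginary part, the mean value theorem being about real
   functions. *)
have hconst (p : C -> R) : (forall a b, p a - p b = p (a - b)) ->
   (forall a, `|p a| <= nm a) ->
   p (mean_at f (W + iR (1 *: y))) = p (mean_at f (W + iR (0 *: y))).
  move=> pB pn; apply: (@locally_quad_const _ (fun t => p (mean_at f (W + iR (t *: y))))).
  move=> t ht01; have dt : dom (W + iR (t *: y)) by exact: dom_seg ht01.
  have [r' r'0 [B' hB']] := ht _ dt.
  exists (r' / 2 / K); first by rewrite !divr_gt0.
  have B'0 : 0 <= B' := le_trans (nm_ge0 _) (tame_at_bound r'0 hB' 0).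
  exists (4 * B' * (K / r') ^+ 2); first by rewrite mulr_ge0 ?sqr_ge0// mulr_ge0.
  move=> s hs; rewrite pB; apply: (le_trans (pn _)).
  by rewrite scalerDl iRD addrA; exact: tame_at_quad hs.
have h0 : iR (0 *: y) = 0 by rewrite scale0r /iR mxR0 scaler0.
move: hconst; rewrite h0 addr0 scale1r => hconst.
apply: complexP; apply/esym.
  by apply: (hconst (@complex.Re R)) => [a b|a]; [rewrite ReD ReN|exact: ler_Re_nm].
by apply: (hconst (@complex.Im R)) => [a b|a]; [rewrite ImD ImN|exact: ler_Im_nm].
Qed.

Lemma coef_indep dom f q W W' : tame_domain dom -> tame_on dom f -> cperiodic f ->
  dom W -> dom W' -> coef f q W = coef f q W'.
Proof.
move=> hdom ht fp; apply: mean_at_indep => //; last exact: cperiodic_coef.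
by move=> V /ht[rho r0 [B hB]]; exists rho => //; exact: tame_coef hB.
Qed.

(** Where the coefficient is non-zero this forces [chi q (mxR u)] = c: every known multiplier
    restricts the support of the expansion. *)
Lemma coef_translate dom f q W u c : tame_domain dom -> tame_on dom f -> cperiodic f ->
  dom W -> (forall W, dom W -> f (W + mxR u) = c * f W) ->
  chi q (mxR u) * coef f q W = c * coef f q W.
Proof.
move=> hdom ht fp dW hc.
have [rho r0 [B hB]] := ht _ dW; have [B' hB'] := tame_coef q r0 hB.
rewrite {1}(coef_indep q hdom ht fp dW (dom_real hdom u dW)) /coef /mean_at.
have hb := tame_at_bound r0 hB'.
rewrite -(meanZ _ hb) -(@meanZ _ _ _ _ _ (nm c * B')).
  apply: eq_mean => x; rewrite addrAC hc ?chi_add; last exact: dom_real.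
  rewrite [X in _ * (_ * (_ * X))]chiN; have h := chi_neq0 q (mxR u).
  move: h; move: (chi q (mxR u)) (chi (- q) W) (chi (- q) (mxR x)) (f (W + mxR x)).
  by move=> a1 a2 a3 a4 h; field.
move=> x; rewrite addrAC hc; last exact: dom_real.
rewrite chi_add mulrA nmM nm_chi_real mulr1 -mulrA nmM ler_wpM2l ?nm_ge0//.
Qed.

Lemma nm_coef_le f q W B : (forall x, nm (f (W + mxR x)) <= B) ->
  nm (coef f q W) <= B / nm (chi q W).
Proof.
move=> hB; apply: mean_le => x; rewrite nmM chi_add nmM nm_chi_real mulr1 chiN nmV.
by rewrite ler_wpM2r ?invr_ge0 ?nm_ge0.
Qed.

Lemma mean_chi q : mean (fun x => chi q (mxR x)) = (q == 0)%:R.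
Proof.
have [->|q0] := eqVneq q 0.
  by rewrite -[RHS](@mean_const R m n); apply: eq_mean => x; rewrite chi0.
have [i [j qij]] : exists i j, q i j != 0.
  apply/not_existsP => h; move/eqP: q0; apply; apply/matrixP => i j; rewrite mxE.
  apply/eqP/negPn/negP => qij; apply: (h i); by exists j.
(* Half a period of the character in an entry where q is non-zero; the translation changes its sign,
   so the mean is its own opposite. *)
pose u : MR := (2 * (q i j)%:~R)^-1 *: delta_mx i j.
have hu : chi q (mxR u) = -1.
  rewrite /chi dotC_real (bigD1 i)//= (bigD1 j)//= big1 ?addr0 => [|j' hj]; last first.
    by rewrite !mxE (negbTE hj) andbF mulr0 mulr0.
  rewrite big1 ?addr0 => [|i' hi]; last first.
    by rewrite big1// => j' _; rewrite !mxE (negbTE hi) mulr0 mulr0.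
  rewrite !mxE !eqxx mulr1 invfM mulrCA divff ?intr_eq0// mulr1.
  by rewrite fmorphV rmorph_nat e_half.
have [B hB] := tame_chi q 0 (@ler01 R).
have hp : cperiodic (chi q : MC -> C) by move=> W z; rewrite chi_add chi_int mulr1.
have := mean_at_real u ltr01 hB hp.
rewrite /mean_at add0r => h.
have hb x : nm (chi q (0 + mxR x)) <= 1 by rewrite add0r nm_chi_real.
have : mean (fun x => chi q (mxR u + mxR x)) = - mean (fun x => chi q (0 + mxR x)).
  rewrite -mulN1r -(meanZ _ hb); apply: eq_mean => x.
  by rewrite chi_add hu add0r.
rewrite h => /eqP; rewrite -addr_eq0 -mulr2n mulrn_eq0/= => /eqP E.
by rewrite -[RHS]E; apply: eq_mean => x; rewrite add0r.
Qed.

(** Each coefficient is computed at W moved by d in the imaginary direction - sgn q, where the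
    character of q is large; this gains the factor exp(-2 pi d sum |q i j|). *)
Lemma coef_summable dom f W0 W : tame_domain dom -> tame_on dom f -> cperiodic f ->
  dom W0 -> dom W -> exists2 b : 'M[int]_(m, n) -> R,
    (exists B, sum_le setT b B) & (forall q, nm (coef f q W0 * chi q W) <= b q).
Proof.
move=> hdom ht fp dW0 dW.
have [rho r0 [B hB]] := ht _ dW.
have [d1 d10 hd1] := dom_open hdom dW.
pose d := Num.min d1 rho.
have d0 : 0 < d by rewrite /d; case: (leP d1 rho).
have dd1 : d <= d1 by rewrite ge_min lexx.
have drho : d <= rho by rewrite ge_min lexx orbT.
have B0 : 0 <= B := le_trans (nm_ge0 _) (tame_at_bound r0 hB 0).
have dp : 0 < 2 * pi * d by rewrite !mulr_gt0 ?pi_gt0.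
have [A A0 hA] := expR_wt dp.
exists (fun q => (B * A ^+ (m * n)) * \prod_i \prod_j wt R (q i j)).
  exists (B * A ^+ (m * n) * 8 ^+ (m * n)); apply: sum_leZ; last exact: sum_le_mx.
  by rewrite mulr_ge0// exprn_ge0// ltW.
move=> q; pose sg : MR := map_mx (fun k : int => - Num.sg (k%:~R : R)) q.
have sgle i j : `|sg i j| <= 1.
  by rewrite mxE normrN normr_sg; case: (_ != 0).
have dW' : dom (W + iR (d *: sg)).
  apply: hd1 => i j; rewrite mxE normrM (gtr0_norm d0) (le_trans _ dd1)//.
  by rewrite ler_piMr// ltW.
rewrite (coef_indep q hdom ht fp dW0 dW') nmM.
have hb x : nm (f (W + iR (d *: sg) + mxR x)) <= B.
  have ssg : small (mxR sg) by move=> i j; rewrite mxE nmR.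
  have [_ /(_ ('i * d%:C))] := hB x _ ssg.
  rewrite nmM nm_i mul1r nmR (gtr0_norm d0) => /(_ drho).
  by rewrite /iR mxRZ scalerA addrAC.
have hc := nm_coef_le q hb.
apply: (le_trans (ler_wpM2r (nm_ge0 _) hc)).
rewrite -!mulrA ler_wpM2l// chi_add nmM invfM mulrAC mulVf ?gt_eqF ?nm_gt0 ?chi_neq0//.
rewrite mul1r nm_chi -expRN opprK.
have -> : 2 * pi * (\sum_i \sum_j (q i j)%:~R * complex.Im (iR (d *: sg) i j)) =
    \sum_i \sum_j - (2 * pi * d * `|(q i j)%:~R|).
  rewrite mulr_sumr; apply: eq_bigr => i _; rewrite mulr_sumr; apply: eq_bigr => j _.
  rewrite !mxE ImM/= mul0r mul1r add0r (normrEsg (q i j)%:~R); ring.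
rewrite (big_morph _ (@expRD R) (@expR0 R)).
apply: (@le_trans _ _ (\prod_(i < m) \prod_(j < n) (A * wt R (q i j)))).
  apply: ler_prod => i _; rewrite expR_ge0/= (big_morph _ (@expRD R) (@expR0 R)).
  by apply: ler_prod => j _; rewrite expR_ge0/=.
rewrite le_eqVlt; apply/orP; left; apply/eqP.
transitivity (\prod_(i < m) (A ^+ n * \prod_(j < n) wt R (q i j))).
  by apply: eq_bigr => i _; rewrite big_split/= prodr_const card_ord.
by rewrite big_split/= prodr_const card_ord -exprM mulnC.
Qed.

Lemma nm_chi_shift q W x : nm (chi q (W + mxR x)) = nm (chi q W).
Proof. by rewrite chi_add nmM nm_chi_real mulr1. Qed.

Lemma lipu_cont f W rho B (eps : R) : 0 < rho -> tame_at f W rho B -> 0 < eps ->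
  exists2 d, 0 < d & forall d', d' <= d -> forall x, (forall i j, `|x i j| <= d') ->
    nm (f (W + mxR x) - f W) <= eps.
Proof.
move=> r0 ht e0.
have B0 : 0 <= B := le_trans (nm_ge0 _) (tame_at_bound r0 ht 0).
have L0 : 0 <= 2 * B / rho by rewrite divr_ge0 ?mulr_ge0// ltW.
pose d := Num.min (rho / 2) (eps / (2 * B / rho + 1)).
have d0 : 0 < d by rewrite lt_min !divr_gt0// ltr_wpDl.
exists d => // d' dd' x hx.
have hx' i j : `|x i j| <= d := le_trans (hx i j) dd'.
have hd : 0 <= d <= rho / 2 by rewrite (ltW d0)/= ge_min lexx.
have := tame_lipu r0 ht 0 hd hx'; rewrite add0r mxR0 addr0 => /le_trans; apply.
have : d <= eps / (2 * B / rho + 1) by rewrite ge_min lexx orbT.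
rewrite ler_pdivlMr ?ltr_wpDl// mulrC; apply: le_trans.
by rewrite ler_wpM2r ?(ltW d0)// lerDl.
Qed.

(** Along real translates of W, the difference of f and its Fourier series is periodic, continuous
    at 0 and has only zero coefficients, so [fourier_unique] applies. *)
Lemma fourier_tame dom f W0 W : tame_domain dom -> tame_on dom f -> cperiodic f ->
  dom W0 -> dom W -> has_sum setT (fun q => coef f q W0 * chi q W) (f W).
Proof.
move=> hdom ht fp dW0 dW.
have [b [B hB] hb] := coef_summable hdom ht fp dW0 dW.
pose a q := coef f q W0.
have hbx q x : nm (a q * chi q (W + mxR x)) <= b q.
  by rewrite nmM nm_chi_shift -nmM hb.
have /choice[S hS] : forall x, exists s,
    has_sum setT (fun q => a q * chi q (W + mxR x)) s.
  by move=> x; apply: (has_sum_ex _ hB) => q _; exact: hbx.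
have [rho r0 [Bf hBf]] := ht _ dW.
have fB := tame_at_bound r0 hBf.
have SB x : nm (S x) <= B by apply: (has_sum_le _ hB (hS x)) => q _; exact: hbx.
have b0 q : 0 <= b q := le_trans (nm_ge0 _) (hb q).
suff : f (W + mxR 0) - S 0 = 0.
  move/eqP; rewrite subr_eq0 => /eqP E.
  by have := hS 0; rewrite -E mxR0 addr0.
apply: (@fourier_unique _ _ _ (fun x => f (W + mxR x) - S x) (Bf + B)).
- by move=> x; apply: nmD_le; rewrite ?nmN.
- move=> x z; congr (_ - _).
    by rewrite mxRD mxR_int addrA fp.
  apply: (has_sum_uniq (hS _)); apply: eq_has_sum (hS x) => q _.
  by rewrite mxRD mxR_int addrA [chi q (_ + mxZ R z)]chi_add chi_int mulr1.
(* Continuity at 0: the series is uniformly close to a finite sum P, and f and P are Lipschitz near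
   W. *)
- move=> eps e0; have e4 : 0 < eps / 4 by rewrite divr_gt0.
  have [F FD hF] := sum_le_tail (fun q _ => b0 q) hB e4.
  pose P V := \sum_(q <- F) a q * chi q V.
  have /choice[Bq hBq] : forall q, exists Bq, tame_at (fun V => a q * chi q V) W 1 Bq.
    move=> q; have [Bq hBq] := tame_chi q W (@ler01 R).
    by exists (nm (a q) * Bq); apply: tame_atM => //; exact: tame_at_const.
  have hP : tame_at P W 1 (\sum_(q <- F) Bq q) by apply: tame_at_sum.
  have [d1 d10 hd1] := lipu_cont r0 hBf e4.
  have [d2 d20 hd2] := lipu_cont ltr01 hP e4.
  exists (Num.min d1 d2); first by rewrite lt_min d10.
  move=> x hx.
  have h1 := hd1 _ (_ : Num.min d1 d2 <= d1) _ hx.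
  have h2 := hd2 _ (_ : Num.min d1 d2 <= d2) _ hx.
  have hSP y : nm (S y - P (W + mxR y)) <= eps / 4.
    by apply: (has_sum_tail _ FD hF (hS y)) => q _; exact: hbx.
  have h3 := hSP x; have := hSP 0; rewrite mxR0 addr0 => h4.
  have -> : f (W + mxR x) - S x - (f W - S 0) =
     (f (W + mxR x) - f W) - (S x - P (W + mxR x)) - (P (W + mxR x) - P W)
     + (S 0 - P W) by ring.
  have -> : eps = eps / 4 + eps / 4 + eps / 4 + eps / 4 by field.
  by do ![apply: nmD_le; rewrite ?nmN//]; rewrite ?h1 ?h2// ge_min lexx ?orbT.
move=> q.
have fcB x : nm (f (W + mxR x) * chi q (mxR x)) <= Bf by rewrite nmM nm_chi_real mulr1.
have ScB x : nm (S x * chi q (mxR x)) <= B by rewrite nmM nm_chi_real mulr1.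
have ScB' x : nm (-1 * (S x * chi q (mxR x))) <= B by rewrite mulN1r nmN.
have -> : mean (fun x => (f (W + mxR x) - S x) * chi q (mxR x)) =
    mean (fun x => f (W + mxR x) * chi q (mxR x)) -
    mean (fun x => S x * chi q (mxR x)).
  rewrite -[- mean _]mulN1r -(meanZ _ ScB) -(meanD fcB ScB').
  by apply: eq_mean => x; rewrite mulN1r mulrBl.
(* A mean against [chi q] selects the frequency - q. *)
have -> : mean (fun x => f (W + mxR x) * chi q (mxR x)) = a (- q) * chi (- q) W.
  rewrite /a (coef_indep (- q) hdom ht fp dW0 dW) /coef /mean_at opprK.
  have hcb x : nm (f (W + mxR x) * chi q (W + mxR x)) <= Bf * nm (chi q W).
    by rewrite nmM nm_chi_shift ler_wpM2r ?nm_ge0.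
  rewrite mulrC -(meanZ _ hcb); apply: eq_mean => x.
  by rewrite chiN chi_add; have h := chi_neq0 q W; field.
have hs : has_sum setT (fun q' => mean (fun x => a q' * chi q' (W + mxR x) * chi q (mxR x)))
    (mean (fun x => S x * chi q (mxR x))).
  apply: (mean_has_sum _ hB) => [q' x _|x].
    by rewrite nmM nm_chi_real mulr1.
  have := has_sumZ (chi q (mxR x)) (hS x); rewrite mulrC.
  by apply: eq_has_sum => q' _; rewrite mulrC.
have hm q' : mean (fun x => a q' * chi q' (W + mxR x) * chi q (mxR x)) =
    a q' * chi q' W * (q' + q == 0)%:R.
  have h1 x : nm (chi (q' + q) (mxR x)) <= 1 by rewrite nm_chi_real.
  rewrite -mean_chi -(meanZ _ h1); apply: eq_mean => x.
  by rewrite chi_add chiD !mulrA.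
have hs' : has_sum setT (fun q' => mean (fun x => a q' * chi q' (W + mxR x) * chi q (mxR x)))
   (a (- q) * chi (- q) W).
  apply/(@has_sum_sub _ _ [set` [fset - q]%fset]) => //.
    move=> q' _ /=; rewrite inE => /negP hq; rewrite hm addr_eq0 (negbTE hq).
    by rewrite mulr0.
  have := has_sum_fset [fset - q]%fset
     (fun q' => mean (fun x => a q' * chi q' (W + mxR x) * chi q (mxR x))).
  by rewrite big_seq_fset1 hm addNr eqxx mulr1.
by rewrite (has_sum_uniq hs hs') subrr.
Qed.

End FourierExpansion.

(** * Positive definite real matrices *)

Section PosDef.
Variable R : realType.

Definition qf (m : nat) (A : 'M[R]_m) (x : 'rV[R]_m) : R := (x *m A *m x^T) 0 0.

(** The squared Frobenius norm. With Y = V^T V, traces become values of [fro], and its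
    submultiplicativity takes the place of eigenvalues. *)
Definition fro (p q : nat) (A : 'M[R]_(p, q)) : R := \sum_i \sum_j A i j ^+ 2.

Lemma fro_ge0 p q (A : 'M[R]_(p, q)) : 0 <= fro A.
Proof. by apply: sumr_ge0 => i _; apply: sumr_ge0 => j _; exact: sqr_ge0. Qed.

Lemma fro_tr p q (A : 'M[R]_(p, q)) : fro A = \tr (A *m A^T).
Proof.
apply: eq_bigr => i _; rewrite mxE; apply: eq_bigr => j _.
by rewrite mxE expr2.
Qed.

Lemma fro_trmx p q (A : 'M[R]_(p, q)) : fro A^T = fro A.
Proof. by rewrite !fro_tr trmxK mxtrace_mulC. Qed.

Lemma fro_eq0 p q (A : 'M[R]_(p, q)) : fro A = 0 -> A = 0.
Proof.
move=> h; apply/matrixP => i j; rewrite mxE.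
have h1 := psumr_eq0P (fun i _ => sumr_ge0 _ (fun j _ => sqr_ge0 (A i j))) h.
have h2 := psumr_eq0P (fun j _ => sqr_ge0 (A i j)) (h1 i isT).
by have /eqP := h2 j isT; rewrite sqrf_eq0 => /eqP.
Qed.

Lemma fro_gt0 p q (A : 'M[R]_(p, q)) : A != 0 -> 0 < fro A.
Proof.
by move=> A0; rewrite lt_def fro_ge0 andbT; apply: contra A0 => /eqP/fro_eq0 ->.
Qed.

Lemma cauchy_schwarz (I : finType) (u v : I -> R) :
  (\sum_i u i * v i) ^+ 2 <= (\sum_i u i ^+ 2) * (\sum_i v i ^+ 2).
Proof.
set a := \sum_i u i ^+ 2; set b := \sum_i v i ^+ 2; set c := \sum_i u i * v i.
have a0 : 0 <= a by apply: sumr_ge0 => i _; exact: sqr_ge0.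
have h : 0 <= \sum_i (a * v i - c * u i) ^+ 2 by apply: sumr_ge0 => i _; exact: sqr_ge0.
have E : \sum_i (a * v i - c * u i) ^+ 2 = a * (a * b - c ^+ 2).
  transitivity (\sum_i (a ^+ 2 * v i ^+ 2 + - (2 * a * c) * (u i * v i) + c ^+ 2 * u i ^+ 2)).
    by apply: eq_bigr => i _; ring.
  by rewrite !big_split/= -!mulr_sumr -/a -/b -/c; ring.
have [a_0|an0] := eqVneq a 0.
  suff -> : c = 0 by rewrite expr0n mulr_ge0// sumr_ge0// => i _; exact: sqr_ge0.
  rewrite /c big1// => i _.
  have /(_ i isT)/eqP := psumr_eq0P (fun i _ => sqr_ge0 (u i)) a_0.
  by rewrite sqrf_eq0 => /eqP ->; rewrite mul0r.
by move: h; rewrite E pmulr_rge0 ?subr_ge0// lt_def an0.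
Qed.

Lemma fro_mul p q r (A : 'M[R]_(p, q)) (B : 'M[R]_(q, r)) : fro (A *m B) <= fro A * fro B.
Proof.
rewrite -(fro_trmx B) /fro mulr_suml ler_sum// => i _; rewrite mulr_sumr ler_sum// => k _.
rewrite mxE; apply: le_trans (cauchy_schwarz _ _) _.
by rewrite ler_wpM2l ?sumr_ge0// => [j _|]; rewrite ?sqr_ge0// ler_sum// => j _; rewrite mxE.
Qed.

Lemma qf_tr m (V : 'M[R]_m) (x : 'rV[R]_m) : qf (V^T *m V) x = fro (x *m V^T).
Proof.
by rewrite fro_tr trace_mx11 /qf trmx_mul trmxK !mulmxA.
Qed.

Lemma chol_posdef m (V : 'M[R]_m) : V \in unitmx -> posdef (V^T *m V).
Proof.
move=> uV; split; first by rewrite trmx_mul trmxK.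
move=> x x0; rewrite -/(qf _ x) qf_tr fro_gt0//.
apply: contra x0 => /eqP h.
by rewrite -(mulmxK (_ : V^T \in unitmx) x) ?h ?mul0mx// unitmx_tr.
Qed.

(** Cholesky factorisation: the Schur complement of the first entry a is positive definite, and its
    factor is completed by the row (s, b / s) with s^2 = a. *)
Lemma posdef_chol m (A : 'M[R]_m) : posdef A ->
  exists2 V, V \in unitmx & A = V^T *m V.
Proof.
elim: m A => [|m IH] A [sA pA].
  by exists 1%:M; [exact: unitmx1|apply/matrixP; case].
rewrite -[m.+1]/(1 + m)%N in A sA pA *.
pose a := A 0 0; pose b : 'rV[R]_m := ursubmx A; pose A' : 'M[R]_m := drsubmx A.
have EA : A = block_mx a%:M b b^T A'.
  rewrite -{1}[A]submxK; congr block_mx.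
    rewrite [ulsubmx A]mx11_scalar !mxE; congr (A _ _)%:M; exact: val_inj.
  by rewrite /b trmx_ursub sA.
have a0 : 0 < a.
  have := pA (row_mx 1%:M 0 : 'rV[R]_(1 + m)) _; rewrite EA mul_row_block tr_row_mx.
  rewrite mul_row_col !mul0mx !addr0 trmx0 mulmx0 addr0 trmx1 mulmx1 mul1mx mxE mulr1n.
  apply; apply/eqP => /(congr1 lsubmx); rewrite row_mxKl => /matrixP /(_ 0 0).
  by rewrite !mxE eqxx => /eqP; rewrite oner_eq0.
have sA' : A'^T = A' by rewrite /A' trmx_drsub sA.
pose s := Num.sqrt a.
have s0 : 0 < s by rewrite sqrtr_gt0.
have ss : s * s = a by rewrite -expr2 sqr_sqrtr// ltW.
have pS : posdef (A' - a^-1 *: (b^T *m b)).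
  split; first by rewrite linearB/= linearZ/= trmx_mul trmxK sA'.
  (* This t minimises the form in its first variable, leaving the form of the Schur complement. *)
  move=> x x0; pose t := - a^-1 *: (x *m b^T).
  have := pA (row_mx t x) _; rewrite EA mul_row_block tr_row_mx mul_row_col.
  rewrite mul_mx_scalar.
  have -> : a *: t + x *m b^T = 0.
    by rewrite /t scalerA mulrN divff ?gt_eqF// scaleN1r addNr.
  rewrite mul0mx add0r => /(_ _)/[dup].
  have -> : (t *m b + x *m A') *m x^T = x *m (A' - a^-1 *: (b^T *m b)) *m x^T.
    congr (_ *m _); rewrite mulmxBr addrC; congr (_ + _).
    by rewrite /t -scalemxAl scaleNr -scalemxAr mulmxA.
  move=> h _; apply: h; apply: contra x0 => /eqP/(congr1 rsubmx).
  by rewrite row_mxKr linear0 => ->.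
have [V uV EV] := IH _ pS.
exists (block_mx s%:M (s^-1 *: b) 0 V).
  by rewrite unitmxE det_ublock det_scalar1 unitrM unitfE gt_eqF//= -unitmxE.
rewrite EA tr_block_mx mulmx_block tr_scalar_mx trmx0 !mul0mx !addr0.
rewrite -scalar_mxM ss mul_scalar_mx scalerA divff ?gt_eqF// scale1r.
rewrite linearZ/= mul_mx_scalar scalerA divff ?gt_eqF// scale1r.
rewrite -scalemxAl -scalemxAr scalerA -invfM ss -EV.
by rewrite mulmx0 addr0 [a^-1 *: _ + _]addrC subrK.
Qed.

Lemma posdef_unit m (A : 'M[R]_m) : posdef A -> A \in unitmx.
Proof. by move=> /posdef_chol[V uV ->]; rewrite unitmx_mul unitmx_tr uV. Qed.

Lemma posdef_det m (A : 'M[R]_m) : posdef A -> 0 < \det A.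
Proof.
move=> /posdef_chol[V uV ->]; rewrite det_mulmx det_tr -expr2.
by rewrite exprn_even_gt0//= -unitfE -unitmxE.
Qed.

Lemma posdef_inv m (A : 'M[R]_m) : posdef A -> posdef (invmx A).
Proof.
move=> /posdef_chol[V uV ->].
have -> : invmx (V^T *m V) = (invmx V^T)^T *m invmx V^T.
  have uVV : V^T *m V \in unitmx by rewrite unitmx_mul unitmx_tr uV.
  apply: (can_inj (mulKmx uVV)); rewrite mulmxV//.
  by rewrite -trmx_inv trmxK -!mulmxA (mulmxA V) mulmxV// mul1mx trmx_inv mulmxV// unitmx_tr.
by apply: chol_posdef; rewrite unitmx_inv unitmx_tr.
Qed.

Lemma posdef_entry m (A : 'M[R]_m) i j : posdef A -> `|A i j| <= \tr A.
Proof.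
move=> /posdef_chol[V uV EA].
have tA : \tr A = fro V by rewrite EA -(fro_trmx V) fro_tr trmxK.
have t0 : 0 <= \tr A by rewrite tA fro_ge0.
have col k : \sum_l V l k ^+ 2 <= \tr A.
  rewrite tA -fro_trmx /fro [leRHS](bigD1 k)//= ler_wpDr//.
    by rewrite sumr_ge0// => *; rewrite sumr_ge0// => *; rewrite sqr_ge0.
  by under [leRHS]eq_bigr do rewrite mxE.
rewrite -ler_sqr ?nnegrE// real_normK ?num_real//.
have -> : A i j = \sum_l V l i * V l j.
  by rewrite EA mxE; apply: eq_bigr => l _; rewrite mxE.
apply: (le_trans (cauchy_schwarz _ _)).
by rewrite expr2 ler_pM ?sumr_ge0// => *; rewrite sqr_ge0.
Qed.

Lemma posdef_tr_gt0 m (A : 'M[R]_m) : (0 < m)%N -> posdef A -> 0 < \tr A.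
Proof.
case: m A => // m A _ /posdef_chol[V uV ->].
rewrite -[V in _ *m V]trmxK -fro_tr fro_gt0//; apply: contraTneq uV => E.
by rewrite -unitmx_tr E unitmxE det0 unitr0.
Qed.

Lemma det_le m (A : 'M[R]_m) (t : R) : 0 <= t -> (forall i j, `|A i j| <= t) ->
  `|\det A| <= m`!%:R * t ^+ m.
Proof.
move=> t0 h; rewrite /determinant (le_trans (ler_norm_sum _ _ _))//.
apply: (@le_trans _ _ (\sum_(s : 'S_m) t ^+ m)); last first.
  by rewrite sumr_const card_Sn mulr_natl.
apply: ler_sum => s _; rewrite normrM normrX normrN1 expr1n mul1r normr_prod.
rewrite -[m in t ^+ m]card_ord -prodr_const ler_prod// => i _.
by rewrite normr_ge0 h.
Qed.

Lemma posdef_det_le m (A : 'M[R]_m) : posdef A -> \det A <= m`!%:R * (\tr A) ^+ m.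
Proof.
move=> pA; apply: le_trans (ler_norm _) _; apply: det_le => [|i j].
  case: m A pA => [|m] A pA; first by rewrite /mxtrace big_ord0.
  exact/ltW/posdef_tr_gt0.
exact: posdef_entry.
Qed.

(** The left side is the trace of the adjugate, whose minors have entries bounded by tr A. *)
Lemma posdef_det_tr_inv m (A : 'M[R]_m.+1) : posdef A ->
  \det A * \tr (invmx A) <= (m.+1)`!%:R * (\tr A) ^+ m.
Proof.
move=> pA; have uA := posdef_unit pA.
have d0 := posdef_det pA.
have t0 : 0 <= \tr A by apply/ltW/posdef_tr_gt0.
rewrite /invmx uA mxtraceZ mulVKf ?gt_eqF//.
apply: (@le_trans _ _ (\sum_(i < m.+1) m`!%:R * (\tr A) ^+ m)); last first.
  by rewrite sumr_const card_ord factS natrM -mulrA [leRHS]mulr_natl.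
apply: ler_sum => i _; rewrite mxE /cofactor.
apply: le_trans (ler_norm _) _; rewrite normrM normrX normrN1 expr1n mul1r.
by apply: det_le => // k l; rewrite !mxE; exact: posdef_entry.
Qed.

(** With L = U^T U and Y = V^T V, write V^T = U^-1 (U V^T) and use [fro_mul]. *)
Lemma posdef_tr_mul_ge m (L Y : 'M[R]_m) : posdef L -> posdef Y ->
  \tr Y <= \tr (invmx L) * \tr (L *m Y).
Proof.
move=> /posdef_chol[U uU EL] /posdef_chol[V uV EY].
have -> : \tr Y = fro V^T by rewrite EY fro_tr trmxK.
have -> : \tr (L *m Y) = fro (U *m V^T).
  by rewrite EL EY fro_tr trmx_mul trmxK -mulmxA mxtrace_mulC -!mulmxA mxtrace_mulC !mulmxA.
have -> : \tr (invmx L) = fro (invmx U).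
  rewrite fro_tr EL; congr (\tr _).
  have uVV : U^T *m U \in unitmx by rewrite unitmx_mul unitmx_tr uU.
  apply: (can_inj (mulKmx uVV)); rewrite mulmxV//.
  by rewrite -!mulmxA (mulmxA U) mulmxV// mul1mx trmx_inv mulmxV// unitmx_tr.
by rewrite -{1}(mulKmx uU V^T) fro_mul.
Qed.

Lemma tr_inv_sandwich_ge m p (P : 'M[R]_(p, m)) (Y : 'M[R]_m) : posdef Y ->
  fro P <= \tr Y * \tr (P *m invmx Y *m P^T).
Proof.
move=> /posdef_chol[V uV EY].
have -> : \tr Y = fro V by rewrite EY -(fro_trmx V) fro_tr trmxK.
have -> : \tr (P *m invmx Y *m P^T) = fro (P *m invmx V).
  rewrite fro_tr trmx_mul -!mulmxA; congr (\tr (_ *m _)); rewrite !mulmxA; congr (_ *m _).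
  rewrite EY; have uVV : V^T *m V \in unitmx by rewrite unitmx_mul unitmx_tr uV.
  apply: (can_inj (mulKmx uVV)); rewrite mulmxV//.
  by rewrite -!mulmxA (mulmxA V) mulmxV// mul1mx trmx_inv mulmxV// unitmx_tr.
by rewrite -{1}(mulmxKV uV P) mulrC fro_mul.
Qed.

Lemma tr_sandwich_qf m p (P : 'M[R]_(p, m)) (Y : 'M[R]_m) :
  \tr (P *m Y *m P^T) = \sum_i qf Y (row i P).
Proof.
apply: eq_bigr => i _; rewrite /qf -row_mul !mxE.
by apply: eq_bigr => j _; rewrite !mxE.
Qed.

Lemma fro_row m p (P : 'M[R]_(p, m)) : fro P = \sum_i fro (row i P).
Proof.
apply: eq_bigr => i _; rewrite /fro big_ord1; apply: eq_bigr => j _.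
by rewrite mxE.
Qed.

(** 1 / tr(Y^-1) serves as a lower bound for the least eigenvalue of Y. *)
Lemma posdef_qf_ge m (Y : 'M[R]_m) (x : 'rV[R]_m) : posdef Y ->
  fro x <= \tr (invmx Y) * qf Y x.
Proof.
move=> pY; have := tr_inv_sandwich_ge x (posdef_inv pY).
by rewrite invmxK trace_mx11.
Qed.

End PosDef.

(** * The symplectic action on the Siegel half-space *)

Section Symplectic.
Variables (R : realType) (p : nat).
Local Notation C := R[i].
Local Notation MC := 'M[C]_p.
Local Notation MR := 'M[R]_p.

Definition cj q r (M : 'M[C]_(q, r)) : 'M[C]_(q, r) := map_mx (@conjc R) M.

Lemma cjM q r s (M : 'M[C]_(q, r)) (N : 'M[C]_(r, s)) : cj (M *m N) = cj M *m cj N.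
Proof. exact: map_mxM. Qed.
Lemma cjD q r (M N : 'M[C]_(q, r)) : cj (M + N) = cj M + cj N.
Proof. exact: map_mxD. Qed.
Lemma cj_tr q r (M : 'M[C]_(q, r)) : cj M^T = (cj M)^T.
Proof. by rewrite /cj map_trmx. Qed.
Lemma cj_mxZ q r (M : 'M[int]_(q, r)) : cj (mxZ R M) = mxZ R M.
Proof.
apply/matrixP => i j; rewrite !mxE -(rmorph_int (real_complex R)).
exact: conjc_real.
Qed.
Lemma cj_mxR q r (M : 'M[R]_(q, r)) : cj (mxR M) = mxR M.
Proof. by apply/matrixP => i j; rewrite !mxE conjc_real. Qed.
Lemma conj_i : conjc ('i : C) = - 'i.
Proof. by apply: complexP; rewrite /= ?oppr0. Qed.
Lemma cj_iZ q r (M : 'M[C]_(q, r)) : cj ('i *: M) = - ('i *: cj M).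
Proof. by apply/matrixP => i j; rewrite !mxE -mulNr -conj_i -rmorphM. Qed.

Lemma mxRM q r s (M : 'M[R]_(q, r)) (N : 'M[R]_(r, s)) : mxR (M *m N) = mxR M *m mxR N.
Proof. exact: map_mxM. Qed.
Lemma mxR_tr q r (M : 'M[R]_(q, r)) : mxR M^T = (mxR M)^T.
Proof. by rewrite /mxR map_trmx. Qed.
Lemma mxR_inj q r : injective (@mxR R q r).
Proof.
by move=> M N /matrixP h; apply/matrixP => i j; have := h i j; rewrite !mxE => /complexI.
Qed.
Lemma tr_mxR (M : MR) : \tr (mxR M) = (\tr M)%:C.
Proof. by rewrite rmorph_sum; apply: eq_bigr => i _; rewrite mxE. Qed.
Lemma mxZ_R q r (M : 'M[int]_(q, r)) : mxZ R M = mxR (map_mx intr M).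
Proof. by rewrite mxR_int. Qed.

Definition ReM_ q r (M : 'M[C]_(q, r)) : 'M[R]_(q, r) := map_mx (@complex.Re R) M.
Definition ImM_ q r (M : 'M[C]_(q, r)) : 'M[R]_(q, r) := map_mx (@complex.Im R) M.

Lemma mx_ReIm q r (M : 'M[C]_(q, r)) : M = mxR (ReM_ M) + 'i *: mxR (ImM_ M).
Proof. exact: mxR_Re_Im. Qed.

Lemma sub_cj q r (M : 'M[C]_(q, r)) : M - cj M = (2 * 'i) *: mxR (ImM_ M).
Proof.
rewrite {1}[M]mx_ReIm {1}[M in cj M]mx_ReIm cjD cj_iZ !cj_mxR.
by rewrite opprD addrACA subrr add0r opprK -scalerDl mulr_natl mulr2n.
Qed.

Lemma trmxD q r (M N : 'M[C]_(q, r)) : (M + N)^T = M^T + N^T.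
Proof. by rewrite linearD. Qed.
Lemma trmx_iZ q r (x : C) (M : 'M[C]_(q, r)) : (x *: M)^T = x *: M^T.
Proof. by rewrite linearZ. Qed.

Lemma herm_expand q r (U V : 'M[C]_(q, r)) (Y : 'M[C]_r) (U' V' : 'M[C]_(r, q)) :
  (U - 'i *: V) *m Y *m (U' + 'i *: V') =
  (U *m Y *m U' + V *m Y *m V') + 'i *: (U *m Y *m V' - V *m Y *m U').
Proof.
rewrite mulmxDr !mulmxBl -!scalemxAr -!scalemxAl !scalerA -expr2 sqr_i scaleN1r.
rewrite [in RHS]scalerBr !opprK.
move: (U *m Y *m U') (_ *m V') ('i *: _) ('i *: _) => A1 A2 A3 A4.
by apply/matrixP => i j; rewrite !mxE; ring.
Qed.

Lemma herm_form (Y : MR) (v : 'rV[C]_p) : Y^T = Y ->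
  (cj v *m mxR Y *m v^T) 0 0 = (qf Y (ReM_ v) + qf Y (ImM_ v))%:C.
Proof.
move=> sY; set u := ReM_ v; set w := ImM_ v.
have -> : cj v *m mxR Y *m v^T = mxR (u *m Y *m u^T + w *m Y *m w^T)
    + 'i *: mxR (u *m Y *m w^T - w *m Y *m u^T).
  rewrite [v]mx_ReIm -/u -/w cjD cj_iZ !cj_mxR trmxD trmx_iZ -!mxR_tr herm_expand.
  rewrite -!mxRM mxRD; congr (_ + 'i *: _).
  by apply/matrixP => i j; rewrite !mxE rmorphB.
have -> : u *m Y *m w^T - w *m Y *m u^T = 0.
  apply/eqP; rewrite subr_eq0; apply/eqP.
  rewrite -[RHS]trmxK; apply/matrixP => i j; rewrite [RHS]mxE !ord1.
  by rewrite !trmx_mul trmxK sY mulmxA.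
by rewrite mxR0 scaler0 addr0 /mxR [LHS]mxE; congr (_%:C); rewrite mxE.
Qed.

Lemma herm_form_gt0 (Y : MR) (v : 'rV[C]_p) : posdef Y -> v != 0 ->
  0 < qf Y (ReM_ v) + qf Y (ImM_ v).
Proof.
move=> [sY pY] v0.
have qf0 x : 0 <= qf Y x.
  have [->|/pY/ltW//] := eqVneq x 0.
  by rewrite /qf mul0mx mul0mx mxE.
have [r0|r0] := eqVneq (ReM_ v) 0; last by rewrite ltr_pwDl//; exact: pY.
rewrite ltr_wpDl//; apply: pY; apply: contra v0 => /eqP i0.
rewrite [v]mx_ReIm r0 i0 (_ : mxR 0 = 0) ?scaler0 ?addr0//.
by apply/matrixP => i j; rewrite !mxE.
Qed.

Definition symp (a b c d : 'M[int]_p) : Prop :=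
  [/\ a^T *m c = c^T *m a, b^T *m d = d^T *m b & a^T *m d - c^T *m b = 1%:M].

Definition autj (c d : 'M[int]_p) (Z : MC) : MC := mxZ R c *m Z + mxZ R d.

Definition mobius (a b c d : 'M[int]_p) (Z : MC) : MC :=
  autj a b Z *m invmx (autj c d Z).

Lemma mxZM q r s (M : 'M[int]_(q, r)) (N : 'M[int]_(r, s)) :
  mxZ R (M *m N) = mxZ R M *m mxZ R N.
Proof. exact: map_mxM. Qed.
Lemma mxZ_tr q r (M : 'M[int]_(q, r)) : mxZ R M^T = (mxZ R M)^T.
Proof. by rewrite /mxZ map_trmx. Qed.

Lemma mul_affine (P Q M N Z1 Z2 : MC) :
  (Z1 *m P + Q) *m (M *m Z2 + N) =
  Z1 *m (P *m M) *m Z2 + (Q *m M) *m Z2 + Z1 *m (P *m N) + Q *m N.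
Proof. by rewrite mulmxDr !mulmxDl !mulmxA addrA. Qed.

(** Invariance of the symplectic pairing of the columns (Z1, 1) and (Z2, 1). Equal points give the
    symmetry of the image; conjugate points give its imaginary part. *)
Lemma symp_pairing a b c d Z1 Z2 : symp a b c d -> Z1^T = Z1 ->
  (autj c d Z1)^T *m autj a b Z2 - (autj a b Z1)^T *m autj c d Z2 = Z2 - Z1.
Proof.
move=> [s1 s2 s3] sZ.
have t1 := congr1 (@mxZ R p p) s1; have t2 := congr1 (@mxZ R p p) s2.
rewrite !mxZM !mxZ_tr in t1 t2.
have t3 : (mxZ R a)^T *m mxZ R d - (mxZ R c)^T *m mxZ R b = 1%:M.
  rewrite -!mxZ_tr -!mxZM -[RHS](map_mx1 intr) -s3 /mxZ.
  by rewrite [RHS]map_mxB.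
have t4 : (mxZ R d)^T *m mxZ R a - (mxZ R b)^T *m mxZ R c = 1%:M.
  by rewrite -[RHS]trmx1 -t3 linearB/= !trmx_mul !trmxK.
have {}t3 : (mxZ R c)^T *m mxZ R b = (mxZ R a)^T *m mxZ R d - 1%:M.
  by rewrite -t3 opprB addrC subrK.
have {}t4 : (mxZ R d)^T *m mxZ R a = 1%:M + (mxZ R b)^T *m mxZ R c.
  by rewrite -t4 subrK.
rewrite /autj !trmxD !trmx_mul sZ !mul_affine t1 t2 t3 t4.
rewrite mulmxDl mul1mx mulmxBr mulmx1.
set M1 := Z1 *m (_ *m _) *m Z2; set M2 := (mxZ R b)^T *m _ *m Z2.
set M3 := Z1 *m (_ *m _); set M4 := _ *m mxZ R b; clearbody M1 M2 M3 M4.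
by apply/matrixP => i j; rewrite !mxE; ring.
Qed.

Definition siegelP (Z : MC) : Prop := Z^T = Z /\ posdef (ImM_ Z).

Section Action.
Variables (a b c d : 'M[int]_p) (Z : MC).
Hypotheses (sy : symp a b c d) (hZ : siegelP Z).
Let J := autj c d Z.
Let N := autj a b Z.
Let W := mobius a b c d Z.
Let Y := ImM_ Z.

Let cj_autj (u v : 'M[int]_p) : cj (autj u v Z) = autj u v (cj Z).
Proof. by rewrite /autj cjD cjM !cj_mxZ. Qed.

Let cjZ_tr : (cj Z)^T = cj Z.
Proof. by rewrite -cj_tr hZ.1. Qed.

Lemma symp_herm : (cj J)^T *m N - (cj N)^T *m J = (2 * 'i) *: mxR Y.
Proof. by rewrite !cj_autj symp_pairing// sub_cj. Qed.

Lemma twoi_neq0 : 2 * 'i != 0 :> C.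
Proof. by rewrite -nm_eq0 nmM nm_i mulr1 nm_nat pnatr_eq0. Qed.

(** By [symp_herm], a kernel vector of J would be a zero of the hermitian form of Y. *)
Lemma autj_unit : J \in unitmx.
Proof.
rewrite -unitmx_tr -row_free_unit; apply: inj_row_free => v hv.
apply/eqP/negPn/negP => v0; have := herm_form_gt0 hZ.2 v0.
suff : (cj v *m mxR Y *m v^T) 0 0 = 0.
  by rewrite (herm_form _ hZ.2.1) => /complexI ->; rewrite ltxx.
have hv' : J *m v^T = 0 by rewrite -[J]trmxK -trmx_mul hv trmx0.
have hv2 : cj v *m (cj J)^T = 0.
  by rewrite -cj_tr -cjM hv; apply/matrixP => i j; rewrite !mxE conjc0.
have : cj v *m ((2 * 'i) *: mxR Y) *m v^T = 0.
  rewrite -symp_herm mulmxBr mulmxBl !mulmxA hv2 !mul0mx -!mulmxA hv'.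
  by rewrite !mulmx0 subrr.
rewrite -scalemxAr -scalemxAl => /eqP; rewrite scaler_eq0 (negbTE twoi_neq0)/=.
by move=> /eqP ->; rewrite mxE.
Qed.

Lemma mobiusK : W *m J = N.
Proof. by rewrite /W /mobius (mulmxKV autj_unit). Qed.

Lemma mobius_sym : W^T = W.
Proof.
have uJ := autj_unit; have uJt : J^T \in unitmx by rewrite unitmx_tr.
have /eqP := symp_pairing Z sy hZ.1; rewrite -/J -/N subrr subr_eq0 => /eqP h.
have h2 : J^T *m W^T *m J = J^T *m W *m J.
  by rewrite -trmx_mul -[in RHS]mulmxA mobiusK h.
by apply: (can_inj (mulKmx uJt)); apply: (can_inj (mulmxK uJ)).
Qed.

(** The identity [symp_herm] with N replaced by W J. *)
Lemma mobius_imE : (cj J)^T *m mxR (ImM_ W) *m J = mxR Y.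
Proof.
apply: (scalerI twoi_neq0); rewrite -symp_herm.
rewrite scalemxAl scalemxAr -sub_cj mulmxBr mulmxBl -[_ *m W *m J]mulmxA mobiusK.
congr (_ - _ *m J).
by rewrite -{1}mobius_sym cj_tr -trmx_mul -cjM mobiusK.
Qed.

Lemma imW_posdef : posdef (ImM_ W).
Proof.
have uJ := autj_unit; split; first by rewrite /ImM_ map_trmx mobius_sym.
move=> x x0; pose v := mxR x *m invmx J^T.
have hv : v *m J^T = mxR x by rewrite mulmxKV// unitmx_tr.
have v0 : v != 0.
  apply: contra x0 => /eqP v0; move: hv; rewrite v0 mul0mx => h.
  apply/eqP/(@mxR_inj 1 p); rewrite -h.
  by apply/matrixP => i j; rewrite !mxE.
have := herm_form_gt0 hZ.2 v0; rewrite -ltcR -(herm_form _ hZ.2.1) -/Y -mobius_imE.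
rewrite !mulmxA -cj_tr -cjM hv cj_mxR -!mulmxA -[J *m v^T]trmxK trmx_mul trmxK hv.
by rewrite -mxR_tr -!mxRM mxE rmorph0 ltcR !mulmxA.
Qed.

Lemma det_imW : nm (\det J) ^+ 2 * \det (ImM_ W) = \det Y.
Proof.
have := congr1 determinant mobius_imE; rewrite !det_mulmx det_tr.
rewrite /cj !det_map_mx => /(congr1 (@nm R)); rewrite !nmM nm_conj !nmR.
rewrite !ger0_norm ?ltW// ?posdef_det//; first by move <-; ring.
- exact: hZ.2.
- exact: imW_posdef.
Qed.

Let P : 'M[R]_p := map_mx intr c *m ReM_ Z + map_mx intr d.
Let cR : 'M[R]_p := map_mx intr c.

Lemma autj_ReIm : J = mxR P + 'i *: mxR (cR *m Y).
Proof.
rewrite /J /autj {1}[Z]mx_ReIm mulmxDr -scalemxAr !mxZ_R -!mxRM /P mxRD.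
by rewrite addrAC.
Qed.

(** (Im W)^-1 is J Y^-1 times the conjugate transpose of J, and J = P + i c Y; the mixed terms
    cancel in the trace. The result is explicit in the bottom row (c, d), as the summation needs. *)
Lemma tr_inv_imW : \tr (invmx (ImM_ W)) =
  \tr (P *m invmx Y *m P^T) + \tr (cR *m Y *m cR^T).
Proof.
have uY := posdef_unit hZ.2; have uW := posdef_unit imW_posdef.
have sY : Y^T = Y := hZ.2.1.
have E : mxR (invmx (ImM_ W)) = J *m mxR (invmx Y) *m (cj J)^T.
  have uWC : mxR (ImM_ W) \in unitmx by rewrite map_unitmx.
  have uJc : (cj J)^T \in unitmx by rewrite unitmx_tr map_unitmx autj_unit.
  have h1 : mxR Y *m mxR (invmx Y) = 1%:M by rewrite -mxRM (mulmxV uY); exact: map_mx1.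
  have h2 : (cj J)^T *m mxR (ImM_ W) *m (J *m mxR (invmx Y) *m (cj J)^T) = (cj J)^T.
    by rewrite !mulmxA mobius_imE h1 mul1mx.
  have h3 : mxR (ImM_ W) *m mxR (invmx (ImM_ W)) = 1%:M.
    by rewrite -mxRM (mulmxV uW); exact: map_mx1.
  apply: (can_inj (mulKmx uWC)); apply: (can_inj (mulKmx uJc)).
  by rewrite h3 mulmx1 [RHS]mulmxA h2.
apply: complexI; rewrite -tr_mxR E autj_ReIm cjD cj_iZ !cj_mxR.
rewrite -[X in \tr X]trmxK mxtrace_tr !trmx_mul !trmxK trmxD trmx_iZ -!mxR_tr mulmxA.
rewrite herm_expand mxtraceD mxtraceZ linearB/= -!mxRM !tr_mxR.
have sYi : (invmx Y)^T = invmx Y by rewrite trmx_inv sY.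
rewrite sYi.
have -> : \tr (P *m invmx Y *m (cR *m Y)^T) = \tr (cR *m Y *m invmx Y *m P^T).
  by rewrite -[LHS]mxtrace_tr [(_ *m _^T)^T]trmx_mul trmxK trmx_mul sYi !mulmxA.
rewrite subrr mulr0 addr0 mxtraceD !tr_mxR -rmorphD/=; congr ((_ + \tr _)%:C).
by rewrite trmx_mul sY (mulmxK uY) mulmxA.
Qed.

End Action.

End Symplectic.

(** * Bounds for a single term of the series *)

Section AutomorphyBound.
Variable R : realType.
Local Notation C := R[i].

(** The q-th power of exp(x) >= x at x = a s / q; the exact maximum is smaller by the factor e^(-q)
    only. *)
Lemma pow_exp_le (a s : R) q : 0 < a -> 0 <= s ->
  s ^+ q * expR (- (a * s)) <= (q%:R / a) ^+ q.
Proof.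
move=> a0 s0; case: q => [|q].
  by rewrite !expr0 mul1r -[leRHS]expR0 ler_expR oppr_le0 mulr_ge0// ltW.
have q0 : 0 < q.+1%:R :> R by rewrite ltr0n.
rewrite expRN ler_pdivrMr ?expR_gt0//.
have -> : expR (a * s) = expR (a * s / q.+1%:R) ^+ q.+1.
  by rewrite -expR_mulrn; congr expR; rewrite -[RHS]mulr_natr divfK// gt_eqF.
rewrite -exprMn lerXn2r ?nnegrE//.
  by rewrite mulr_ge0 ?expR_ge0// divr_ge0// ltW.
rewrite -ler_pdivrMl ?divr_gt0// invf_div.
apply: le_trans (expR_ge1Dx _).
by rewrite mulrAC -[leLHS]add0r lerD.
Qed.

Lemma posdef_det_tr_inv' p (A : 'M[R]_p) : (0 < p)%N -> posdef A ->
  \det A * \tr (invmx A) <= p`!%:R * (\tr A) ^+ p.-1.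
Proof. by case: p A => // p A _; exact: posdef_det_tr_inv. Qed.

(* Comes from maximizing s^q exp(- 2 pi s / tr L^-1) over s = tr (Im W), with
   q = p K - N. *)
Definition Gbound p (L : 'M[R]_p) (K N : nat) : R :=
  p`!%:R ^+ K * ((p * K - N)%:R * \tr (invmx L) / (2 * pi)) ^+ (p * K - N).

Lemma Gbound_ge0 p (L : 'M[R]_p) K N : (0 < p)%N -> posdef L -> 0 <= Gbound L K N.
Proof.
move=> p0 pL; have t0 := ltW (posdef_tr_gt0 p0 (posdef_inv pL)).
by rewrite mulr_ge0 ?exprn_ge0 ?divr_ge0 ?mulr_ge0 ?pi_ge0.
Qed.

Definition pterm p (L : 'M[R]_p) K (a b c d : 'M[int]_p) (Z : 'M[C]_p) : C :=
  (\det (autj c d Z)) ^- (2 * K) * e (\tr (mxR L *m mobius a b c d Z)).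

(** By [tr_inv_imW], the trace of (Im W)^-1 for every symplectic matrix with bottom row (c, d). *)
Definition tauZ p (c d : 'M[int]_p) (Z : 'M[C]_p) : R :=
  let P := map_mx intr c *m ReM_ Z + map_mx intr d in
  \tr (P *m invmx (ImM_ Z) *m P^T) +
  \tr (map_mx intr c *m ImM_ Z *m (map_mx intr c)^T).

(** With t = tr(Im W), det(Im W) is at most p! t^(p-1) / tau, used for N of the K factors, and at
    most p! t^p, used for the others. This leaves t^(pK - N), which exp(-2 pi tr(L Im W)) absorbs
    through [pow_exp_le]. *)
Lemma pterm_le p (L : 'M[R]_p) K N (a b c d : 'M[int]_p) (Z : 'M[C]_p) :
  (0 < p)%N -> posdef L -> (N <= K)%N -> symp a b c d -> siegelP Z ->
  nm (pterm L K a b c d Z) <= (\det (ImM_ Z)) ^- K * Gbound L K N * (tauZ c d Z) ^- N.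
Proof.
move=> p0 pL NK sy hZ; set tau := tauZ c d Z.
pose W := mobius a b c d Z; pose Yg := ImM_ W.
have pY : posdef (ImM_ Z) := hZ.2.
have pYg : posdef Yg := imW_posdef sy hZ.
have detY := posdef_det pY; have detYg := posdef_det pYg.
have Etau : tau = \tr (invmx Yg) by rewrite (tr_inv_imW sy hZ).
have tau0 : 0 < tau by rewrite Etau; apply: posdef_tr_gt0 => //; exact: posdef_inv.
pose t := \tr Yg; have t0 : 0 < t by exact: posdef_tr_gt0.
pose T := \tr (invmx L).
have T0 : 0 < T by apply: posdef_tr_gt0 => //; exact: posdef_inv.
have hLY : t <= T * \tr (L *m Yg) by exact: posdef_tr_mul_ge.
have hd1 : \det Yg <= p`!%:R * t ^+ p by exact: posdef_det_le.
have hd2 : \det Yg <= p`!%:R * t ^+ p.-1 / tau.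
  by rewrite ler_pdivlMr// Etau; exact: posdef_det_tr_inv'.
have hdet := det_imW sy hZ; rewrite -/W -/Yg in hdet.
set j := \det (autj c d Z) in hdet *.
have nj0 : 0 < nm j ^+ 2.
  by rewrite -(pmulr_lgt0 _ detYg) hdet.
have -> : nm (pterm L K a b c d Z) =
    \det Yg ^+ K / \det (ImM_ Z) ^+ K * expR (- (2 * pi * \tr (L *m Yg))).
  rewrite /pterm nmM nmV nmX nm_e -/W; congr (_ * expR (- (_ * _))).
    rewrite -/j exprM -hdet [(_ * \det Yg) ^+ K]exprMn.
    have : \det Yg ^+ K != 0 by rewrite gt_eqF ?exprn_gt0.
    have : (nm j ^+ 2) ^+ K != 0 by rewrite gt_eqF// exprn_gt0.
    by move: (_ ^+ K) (_ ^+ K) => u v u0 v0; field; rewrite ?u0 ?v0.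
  rewrite /mxtrace Im_sum; apply: eq_bigr => i _; rewrite !mxE Im_sum.
  by apply: eq_bigr => k _; rewrite !mxE ImM/= mul0r addr0.
have -> : \det Yg ^+ K / \det (ImM_ Z) ^+ K * expR (- (2 * pi * \tr (L *m Yg))) =
    \det (ImM_ Z) ^- K * (\det Yg ^+ K * expR (- (2 * pi * \tr (L *m Yg)))) by ring.
rewrite -!mulrA ler_wpM2l ?invr_ge0 ?exprn_ge0 ?(ltW detY)//.
apply: (@le_trans _ _ ((p`!%:R ^+ K * t ^+ (p * K - N) / tau ^+ N) * expR (- (2 * pi / T * t)))).
  apply: ler_pM; rewrite ?exprn_ge0 ?expR_ge0 ?(ltW detYg)//.
    rewrite -(subnK NK) addnC exprD.
    apply: (@le_trans _ _ ((p`!%:R * t ^+ p.-1 / tau) ^+ N * (p`!%:R * t ^+ p) ^+ (K - N))).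
      have g1 : 0 <= p`!%:R * t ^+ p by rewrite mulr_ge0// exprn_ge0// ltW.
      have g2 : 0 <= p`!%:R * t ^+ p.-1 / tau.
        by rewrite divr_ge0 ?(ltW tau0)// mulr_ge0// exprn_ge0// ltW.
      by apply: ler_pM; rewrite ?exprn_ge0 ?(ltW detYg)// lerXn2r ?nnegrE ?(ltW detYg).
    rewrite le_eqVlt; apply/orP; left; apply/eqP.
    rewrite !exprMn -!exprM exprVn [p`!%:R ^+ (N + _)]exprD.
    have -> : (p * (N + (K - N)) - N = p.-1 * N + p * (K - N))%N.
      rewrite -{1 3}(prednK p0); move: (p.-1) (K - N)%N => p' k.
      by rewrite !mulSn mulnDr; lia.
    by rewrite exprD; ring.
  rewrite ler_expR lerN2 -!mulrA ler_wpM2l// ler_wpM2l ?pi_ge0//.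
  by rewrite mulrC ler_pdivrMr// mulrC.
have := @pow_exp_le (2 * pi / T) t (p * K - N) _ (ltW t0).
rewrite divr_gt0 ?mulr_gt0 ?pi_gt0// => /(_ isT) h.
rewrite /Gbound -/T.
have -> : (p`!%:R ^+ K * t ^+ (p * K - N) / tau ^+ N) * expR (- (2 * pi / T * t))
  = p`!%:R ^+ K / tau ^+ N * (t ^+ (p * K - N) * expR (- (2 * pi / T * t))) by ring.
rewrite [X in _ <= _ * X]mulrC [leRHS]mulrA.
rewrite ler_wpM2l ?divr_ge0 ?exprn_ge0 ?(ltW tau0)//.
by move: h; rewrite invf_div.
Qed.

(** The first trace is at least fro P / tr Y by [tr_inv_sandwich_ge]; the second is a sum of values
    of the form of Y at the rows of c. *)
Lemma tau_lower p (c : 'M[R]_p) (P Y : 'M[R]_p) (eta sigma : R) :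
  (0 < p)%N -> posdef Y -> \tr Y <= sigma ->
  (forall x, eta * fro x <= qf Y x) ->
  fro P / sigma + eta * fro c <= \tr (P *m invmx Y *m P^T) + \tr (c *m Y *m c^T).
Proof.
move=> p0 pY hs he; have t0 := posdef_tr_gt0 p0 pY.
have s0 : 0 < sigma by exact: lt_le_trans hs.
apply: lerD.
  rewrite ler_pdivrMr// mulrC; apply: le_trans (tr_inv_sandwich_ge P pY) _.
  rewrite ler_wpM2r// -(pmulr_rge0 _ t0).
  exact: le_trans (fro_ge0 P) (tr_inv_sandwich_ge P pY).
rewrite tr_sandwich_qf fro_row mulr_sumr; apply: ler_sum => i _; exact: he.
Qed.

Lemma froD_le p q (A B : 'M[R]_(p, q)) : fro (A + B) <= 2 * fro A + 2 * fro B.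
Proof.
rewrite /fro !mulr_sumr -big_split ler_sum// => i _.
rewrite !mulr_sumr -big_split ler_sum// => j _ /=; rewrite mxE.
have := sqr_ge0 (A i j - B i j); nra.
Qed.

(** Write d = (c X + d) - c X; the constants 2 and 1 + 2 beta so obtained are merged into 3 + 2
    beta. *)
Lemma fro_row_lower p (c d X : 'M[R]_p) (beta : R) : fro X <= beta ->
  fro c + fro d <= (3 + 2 * beta) * (fro (c *m X + d) + fro c).
Proof.
move=> hX; have b0 : 0 <= beta := le_trans (fro_ge0 X) hX.
have -> : fro d = fro ((c *m X + d) + - (c *m X)) by rewrite addrAC subrr add0r.
have h1 := froD_le (c *m X + d) (- (c *m X)).
have h2 : fro (- (c *m X)) = fro (c *m X).
  by apply: eq_bigr => i _; apply: eq_bigr => j _; rewrite mxE sqrrN.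
have h3 := fro_mul c X.
have c0 := fro_ge0 c; have p0 := fro_ge0 (c *m X + d).
move: h1 h2 h3; set u := fro (_ + - _); set v := fro (- _); set w := fro (c *m X).
set q := fro (_ + d) in p0 *; move: (fro c) c0 (fro X) hX => f f0 x hx; nra.
Qed.

Lemma fro_int_ge1 p q (c : 'M[int]_(p, q)) : c != 0 -> 1 <= fro (map_mx intr c : 'M[R]_(p, q)).
Proof.
move=> c0; have [i [j cij]] : exists i j, c i j != 0.
  apply/not_existsP => h; move/eqP: c0; apply; apply/matrixP => i j; rewrite mxE.
  by apply/eqP/negPn/negP => cij; apply: (h i); exists j.
rewrite /fro (bigD1 i)//= (bigD1 j)//= -addrA ler_wpDr//.
  rewrite addr_ge0// sumr_ge0// => *; rewrite ?sqr_ge0//.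
  by rewrite sumr_ge0// => *; rewrite sqr_ge0.
have -> : map_mx intr c i j ^+ 2 = (c i j ^+ 2)%:~R :> R by rewrite mxE rmorphXn.
by rewrite (ler_int _ 1); have : 0 < c i j ^+ 2; [rewrite exprn_even_gt0|lia].
Qed.

(** Each factor 1 + (v i)^2 is at most 1 + x; a negative power of the norm is thus dominated by the
    product weight, whose sum is known. *)
Lemma prod_wt_ge (I : finType) (v : I -> int) (x : R) :
  \sum_i (v i)%:~R ^+ 2 <= x -> (1 + x) ^- #|I| <= \prod_i wt R (v i).
Proof.
move=> hx.
have hp i : 0 < 1 + (v i)%:~R ^+ 2 :> R by rewrite ltr_pwDl// sqr_ge0.
have x0 : 0 <= x by apply: le_trans hx; apply: sumr_ge0 => i _; exact: sqr_ge0.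
rewrite /wt -(big_morph _ (@invfM _) (@invr1 _)).
rewrite lef_pV2 ?posrE ?exprn_gt0 ?prodr_gt0//; last by rewrite ltr_pwDl.
rewrite -prodr_const; apply: ler_prod => i _; rewrite (ltW (hp i))/= lerD2l.
apply: le_trans hx; rewrite (bigD1 i)//= lerDl.
by apply: sumr_ge0 => j _; exact: sqr_ge0.
Qed.

End AutomorphyBound.

(** * Noncommutative matrix identities and symplectic relations *)

Section MxRing.
Variable V : zmodType.

Lemma mxtrD p q (M N : 'M[V]_(p, q)) : (M + N)^T = M^T + N^T.
Proof. by apply/matrixP => i j; rewrite !mxE. Qed.
Lemma mxtrN p q (M : 'M[V]_(p, q)) : (- M)^T = - M^T.
Proof. by apply/matrixP => i j; rewrite !mxE. Qed.
Lemma mxtrB p q (M N : 'M[V]_(p, q)) : (M - N)^T = M^T - N^T.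
Proof. by apply/matrixP => i j; rewrite !mxE. Qed.

End MxRing.

Lemma mxD_E (V : pzRingType) p q (M N : 'M[V]_(p, q)) i j : (M + N) i j = M i j + N i j.
Proof. by rewrite mxE. Qed.
Lemma mxN_E (V : pzRingType) p q (M : 'M[V]_(p, q)) i j : (- M) i j = - M i j.
Proof. by rewrite mxE. Qed.

(** Distributes transposes and products over sums and associates products to the right, so that
    equal products become identical atoms for [mx_ring]. *)
Ltac mnorm := rewrite ?(mxtrD, mxtrB, mxtrN, trmx_mul, trmxK, trmx1);
  rewrite ?(mulmxDl, mulmxDr, mulmxBl, mulmxBr, mulNmx, mulmxN, mul1mx, mulmx1);
  rewrite -?mulmxA.

(* Proves identities between sums of matrix products, the products being atoms. *)
Ltac mx_ring :=
  repeat (match goal with |- context [@mulmx ?R ?a ?b ?c ?M ?N] =>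
    let u := fresh "u" in set u := (@mulmx R a b c M N); clearbody u end);
  apply/matrixP => ? ?; rewrite ?(mxD_E, mxN_E, mxE); ring.

Section SympAlgebra.
Variable p : nat.
Implicit Types a b c d s : 'M[int]_p.

Lemma symp_left a b c d : symp a b c d ->
  [/\ d^T *m a = 1%:M + b^T *m c, d^T *m b = b^T *m d, a^T *m c = c^T *m a &
      a^T *m d = 1%:M + c^T *m b].
Proof.
move=> [s1 s2 s3]; split=> //; last by rewrite -s3 subrK.
have := congr1 trmx s3; rewrite linearB/= !trmx_mul !trmxK trmx1 => <-.
by rewrite subrK.
Qed.

(** The left relations exhibit a left inverse of the full matrix, which is then a right inverse. *)
Lemma symp_right a b c d : symp a b c d ->
  [/\ a *m d^T = 1%:M + b *m c^T, a *m b^T = b *m a^T, c *m d^T = d *m c^T &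
      d *m a^T = 1%:M + c *m b^T].
Proof.
move=> /symp_left[h1 h2 h3 h4].
have : block_mx d^T (- b^T) (- c^T) a^T *m block_mx a b c d = 1%:M.
  rewrite mulmx_block !mulNmx h1 h2 h3 h4 !addrK subrr addNr addrC addrK.
  by rewrite [RHS]scalar_mx_block.
move/mulmx1C; rewrite mulmx_block !mulmxN [RHS]scalar_mx_block.
case/eq_block_mx => e1 e2 e3 e4; split.
- by rewrite -e1 subrK.
- by apply/eqP; rewrite eq_sym -subr_eq0 addrC e2.
- by apply/eqP; rewrite -subr_eq0 e3.
- by rewrite -e4 addrC addNKr.
Qed.

(** The left relations as rules inside the right-associated products that [mnorm] leaves. *)
Lemma symp_left_act a b c d : symp a b c d -> forall q (X : 'M[int]_(p, q)),
  [/\ d^T *m (a *m X) = X + b^T *m (c *m X), d^T *m (b *m X) = b^T *m (d *m X),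
      a^T *m (c *m X) = c^T *m (a *m X) & a^T *m (d *m X) = X + c^T *m (b *m X)].
Proof.
move=> /symp_left[h1 h2 h3 h4] q X.
by rewrite !mulmxA h1 h2 h3 h4 !mulmxDl !mul1mx.
Qed.

Lemma symp_right_act a b c d : symp a b c d -> forall q (X : 'M[int]_(p, q)),
  [/\ a *m (d^T *m X) = X + b *m (c^T *m X), a *m (b^T *m X) = b *m (a^T *m X),
      c *m (d^T *m X) = d *m (c^T *m X) & d *m (a^T *m X) = X + c *m (b^T *m X)].
Proof.
move=> /symp_right[h1 h2 h3 h4] q X.
by rewrite !mulmxA h1 h2 h3 h4 !mulmxDl !mul1mx.
Qed.

Lemma symp_same_row a b a' b' c d : symp a b c d -> symp a' b' c d ->
  exists s, [/\ s^T = s, a' = a + s *m c & b' = b + s *m d].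
Proof.
move=> sy sy'.
have [l1 l2 l3 l4] := symp_left sy.
have [r1 r2 r3 r4] := symp_right sy.
have q1 q (X : 'M[int]_(p, q)) : a' *m (d^T *m X) = X + b' *m (c^T *m X).
  by have [] := symp_right_act sy' X.
have [_ q2 _ _] := symp_right sy'.
(* The upper right block of M' M^-1, a matrix with unit diagonal blocks and lower left block 0. *)
pose s := b' *m a^T - a' *m b^T.
have Ea : a' = a + s *m c.
  rewrite /s; mnorm; rewrite l3 (_ : b^T *m c = d^T *m a - 1%:M); last first.
    by rewrite l1 addrC addKr.
  by rewrite mulmxBr q1 mulmx1; mx_ring.
have Eb : b' = b + s *m d.
  by rewrite /s; mnorm; rewrite l4 -l2 mulmxDr q1 mulmx1; mx_ring.
(* The symmetry of s comes from that of a' b'^T. *)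
exists s; split=> //; move: q2; rewrite Ea Eb; clearbody s; clear Ea Eb.
mnorm; have [-> _ -> _] := symp_right_act sy s^T; rewrite r2 r4 mulmxDr mulmx1.
move=> /eqP; rewrite -subr_eq0 => /eqP h; apply/eqP; rewrite -subr_eq0; apply/eqP.
by rewrite -[RHS]h; mx_ring.
Qed.

Lemma symp_mul_unip a b c d s : s^T = s -> symp a b c d ->
  symp (a + s *m c) (b + s *m d) c d.
Proof.
move=> ss [s1 s2 s3]; split; mnorm; rewrite ss.
- by rewrite s1.
- by rewrite s2.
- by rewrite -s3; mx_ring.
Qed.

Lemma symp_unip_mul a b c d s : s^T = s -> symp a b c d ->
  symp a (a *m s + b) c (c *m s + d).
Proof.
move=> ss sy; have [s1 s2 s3] := sy.
have [l1 l2 l3 l4] := symp_left sy; have [k1 _ k3 _] := symp_left_act sy s.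
split=> //; mnorm; rewrite ?ss.
- by rewrite k1 k3 l2 l4 mulmxDr mulmx1; mx_ring.
- by rewrite k3 l4; mx_ring.
Qed.

End SympAlgebra.

(** * The Jacobi group: cosets and bottom rows *)

Section Jacobi.
Variables n g : nat.
Implicit Types x y : jacobi n g.

(* The Jacobi group embeds into Sp_(n+g): x goes to the matrix with blocks
   jA x, jB x, jC x, jD x. *)
Definition jA x : 'M[int]_(n + g) := block_mx (ulsubmx x.1) 0 x.2.1.1 1%:M.
Definition jB x : 'M[int]_(n + g) := block_mx (ursubmx x.1)
  (ulsubmx x.1 *m x.2.1.2^T - ursubmx x.1 *m x.2.1.1^T) x.2.1.2 x.2.2.
Definition jC x : 'M[int]_(n + g) := block_mx (dlsubmx x.1) 0 0 0.
Definition jD x : 'M[int]_(n + g) := block_mx (drsubmx x.1)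
  (dlsubmx x.1 *m x.2.1.2^T - drsubmx x.1 *m x.2.1.1^T) 0 1%:M.

Lemma SpP (M : 'M[int]_(n + n)) :
  Sp M <-> symp (ulsubmx M) (ursubmx M) (dlsubmx M) (drsubmx M).
Proof.
rewrite /Sp /=; set a := ulsubmx M; set b := ursubmx M; set c := dlsubmx M.
set d := drsubmx M; rewrite -[M]submxK -/a -/b -/c -/d tr_block_mx !mulmx_block.
rewrite !mulmx0 !mulmx1 !add0r !addr0 !mulmxN !mulmx1 !mulNmx.
split=> [/eq_block_mx[e1 e2 e3 e4]|[s1 s2 s3]].
  split.
  - by apply/eqP; rewrite -subr_eq0 addrC e1.
  - by apply/eqP; rewrite -subr_eq0 addrC e4.
  - by rewrite addrC.
have t3 : d^T *m a - b^T *m c = 1%:M.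
  by have := congr1 trmx s3; rewrite linearB/= !trmx_mul !trmxK trmx1.
congr block_mx; [by rewrite s1 addNr|by rewrite addrC|
  by rewrite -t3 opprB addrC|by rewrite s2 addNr].
Qed.

Lemma jsymp x : Gamma_J x -> symp (jA x) (jB x) (jC x) (jD x).
Proof.
case: x => M [[lam mu] kap] [/= /SpP sM hH].
rewrite /jA /jB /jC /jD /=.
have [l1 l2 l3 l4] := symp_left sM; case: sM => s1 s2 s3.
move: (ulsubmx M) (ursubmx M) (dlsubmx M) (drsubmx M) l1 l2 l3 l4 s1 s2 s3 => a b c d.
move=> l1 l2 l3 l4 s1 s2 s3; rewrite /heisZ/= in hH.
(* The condition defining [heisZ] as a rewrite rule; it is what makes the lower right block identity
   [e4] true. *)
have hk : kap^T = kap + mu *m lam^T - lam *m mu^T.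
  by rewrite -hH linearD/= trmx_mul trmxK addrK.
have sM : symp a b c d by split.
have e2 : b^T *m (c *m mu^T - d *m lam^T) + mu^T = d^T *m (a *m mu^T - b *m lam^T).
  by mnorm; have [-> _ _ _] := symp_left_act sM mu^T;
    have [_ -> _ _] := symp_left_act sM lam^T; mx_ring.
have e3 : (a *m mu^T - b *m lam^T)^T *m d = (c *m mu^T - d *m lam^T)^T *m b + mu.
  by mnorm; rewrite l4 s2 mulmxDr mulmx1; mx_ring.
have e4 : (a *m mu^T - b *m lam^T)^T *m (c *m mu^T - d *m lam^T) + kap^T =
    (c *m mu^T - d *m lam^T)^T *m (a *m mu^T - b *m lam^T) + kap.
  rewrite hk; mnorm; have [-> _ -> _] := symp_left_act sM mu^T.
  by have [_ -> _ ->] := symp_left_act sM lam^T; mnorm; mx_ring.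
have e5 : a^T *m (c *m mu^T - d *m lam^T) + lam^T - c^T *m (a *m mu^T - b *m lam^T) = 0.
  mnorm; have [_ _ -> _] := symp_left_act sM mu^T.
  by have [_ _ _ ->] := symp_left_act sM lam^T; mx_ring.
split; rewrite !tr_block_mx !mulmx_block
  ?(mulmx0, mul0mx, trmx0, trmx1, mulmx1, mul1mx, addr0, add0r).
- by rewrite s1.
- by rewrite e2 e3 e4 s2.
- by rewrite opp_block_mx add_block_mx ?(oppr0, addr0) s3 e5 scalar_mx_block.
Qed.

Definition bot x := row_mx (jC x) (jD x).

Lemma botP x y : bot x = bot y <->
  [/\ dlsubmx x.1 = dlsubmx y.1, drsubmx x.1 = drsubmx y.1 &
      dlsubmx x.1 *m x.2.1.2^T - drsubmx x.1 *m x.2.1.1^T =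
      dlsubmx y.1 *m y.2.1.2^T - drsubmx y.1 *m y.2.1.1^T].
Proof.
split=> [/eq_row_mx[/eq_block_mx[e1 _ _ _] /eq_block_mx[e2 e3 _ _]]|[e1 e2 e3]] //.
by rewrite /bot /jC /jD e3 e1 e2.
Qed.

Lemma jacobi_mul_inf s mu kap y :
  jacobi_mul (block_mx 1%:M s 0 1%:M, (0, mu, kap)) y =
  (block_mx (ulsubmx y.1 + s *m dlsubmx y.1) (ursubmx y.1 + s *m drsubmx y.1)
      (dlsubmx y.1) (drsubmx y.1),
   (mu *m dlsubmx y.1 + y.2.1.1, mu *m drsubmx y.1 + y.2.1.2,
    kap + y.2.2 + mu *m dlsubmx y.1 *m y.2.1.2^T - mu *m drsubmx y.1 *m y.2.1.1^T)).
Proof.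
case: y => M [[lam' mu'] kap']; rewrite /jacobi_mul /heis_act /=.
have E : row_mx 0 mu *m M = row_mx (mu *m dlsubmx M) (mu *m drsubmx M).
  by rewrite -{1}[M]submxK mul_row_block !mul0mx !add0r.
by rewrite E row_mxKl row_mxKr -{1}[M]submxK mulmx_block !mul0mx !mul1mx !add0r.
Qed.

Lemma Gamma_J_infP (s : 'M[int]_n) (mu : 'M[int]_(g, n)) (kap : 'M[int]_g) :
  s^T = s -> kap^T = kap ->
  Gamma_J_inf (block_mx 1%:M s 0 1%:M, (0, mu, kap)).
Proof.
move=> ss sk; split; last by exists s, mu, kap.
split => /=; last by rewrite /heisZ/= trmx0 mulmx0 addr0.
apply/SpP; rewrite block_mxKul block_mxKur block_mxKdl block_mxKdr.
by split; rewrite ?(trmx0, trmx1, mul0mx, mulmx0, mul1mx, mulmx1, subr0, ss).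
Qed.

Lemma Gamma_J_inf_sym (d : jacobi n g) : Gamma_J_inf d -> exists s mu kap,
  [/\ d = (block_mx 1%:M s 0 1%:M, (0, mu, kap)), s^T = s & kap^T = kap].
Proof.
move=> [[hS hH] [s [mu [kap E]]]]; exists s, mu, kap; rewrite E /= in hS hH.
split=> //; last by rewrite /heisZ/= trmx0 mulmx0 addr0 in hH.
move/SpP: hS; rewrite block_mxKul block_mxKur block_mxKdl block_mxKdr.
by case=> _; rewrite mulmx1 trmx1 mul1mx.
Qed.

Lemma bot_inf (d : jacobi n g) y : Gamma_J_inf d -> Gamma_J y ->
  Gamma_J (jacobi_mul d y) /\ bot (jacobi_mul d y) = bot y.
Proof.
move=> /Gamma_J_inf_sym[s [mu [kap [-> ss sk]]]] [/SpP sM hH].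
rewrite jacobi_mul_inf.
case: y sM hH => M [[lam' mu'] kap'] /=.
set a := ulsubmx M; set b := ursubmx M; set c := dlsubmx M; set e := drsubmx M.
move=> sM hH; have [_ _ r3 _] := symp_right_act sM mu^T.
split; last first.
  apply/botP; rewrite /= block_mxKdl block_mxKdr; split=> //.
  by mnorm; rewrite r3 -/c -/e; mx_ring.
split=> /=.
  by apply/SpP; rewrite block_mxKul block_mxKur block_mxKdl block_mxKdr; exact: symp_mul_unip.
rewrite /heisZ/= in hH *.
have hk : kap'^T = kap' + mu' *m lam'^T - lam' *m mu'^T.
  by rewrite -hH mxtrD trmx_mul trmxK addrK.
by rewrite !mxtrD hk sk; mnorm; rewrite r3; mx_ring.
Qed.

(** With [bot_inf], this makes [bot] a complete invariant of the cosets of [Gamma_J_inf]. *)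
Lemma bot_eq_inf x y : Gamma_J x -> Gamma_J y -> bot x = bot y ->
  exists2 d, Gamma_J_inf d & x = jacobi_mul d y.
Proof.
case: x => M [[lam mu] kap]; case: y => M' [[lam' mu'] kap'].
move=> [/= /SpP sM hH] [/= /SpP sM' hH'] /botP/= [e1 e2 e3].
rewrite -[M]submxK e1 e2; rewrite e1 e2 in sM e3.
have [s [ss -> ->]] := symp_same_row sM' sM.
rewrite /heisZ/= in hH hH'.
have hk : kap^T = kap + mu *m lam^T - lam *m mu^T.
  by rewrite -hH mxtrD trmx_mul trmxK addrK.
have hk' : kap'^T = kap' + mu' *m lam'^T - lam' *m mu'^T.
  by rewrite -hH' mxtrD trmx_mul trmxK addrK.
set a := ulsubmx M' in sM' *; set b := ursubmx M' in sM' *.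
set c := dlsubmx M' in sM' e3 *; set e := drsubmx M' in sM' e3 *.
have [l1 l2 l3 l4] := symp_left sM'.
have [dl Edl] : exists dl, dl = lam - lam' by eexists.
have [dm Edm] : exists dm, dm = mu - mu' by eexists.
(* Solves (dl, dm) = m0 (c, e): in (dl, dm) M'^-1 the first block vanishes by [F1] and m0 is the
   second. *)
have [m0 Em0] : exists m0, m0 = dm *m a^T - dl *m b^T by eexists.
have F1 : dm *m c^T = dl *m e^T.
  have /eqP := congr1 trmx e3; rewrite Edl Edm; mnorm.
  rewrite -subr_eq0 => /eqP h; apply/eqP; rewrite -subr_eq0; apply/eqP.
  by rewrite -[RHS]h; mx_ring.
have F2 : m0 *m c = dl.
  rewrite Em0; mnorm; rewrite l3 (_ : b^T *m c = e^T *m a - 1%:M); last first.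
    by rewrite l1 addrC addKr.
  by rewrite mulmxBr mulmx1 !mulmxA F1; mx_ring.
have F3 : m0 *m e = dm.
  rewrite Em0; mnorm; rewrite l4 -l2 mulmxDr mulmx1 !mulmxA F1; mx_ring.
have F4 : dl *m dm^T = dm *m dl^T.
  rewrite -F2 -F3; mnorm; have [_ _ -> _] := symp_right_act sM' m0^T; by [].
pose k0 := kap - kap' - dl *m mu'^T + dm *m lam'^T.
exists (block_mx 1%:M s 0 1%:M, (0, m0, k0)).
  apply: Gamma_J_infP => //; rewrite /k0 Edl Edm; mnorm; rewrite hk hk'.
  have /eqP := F4; rewrite -subr_eq0 Edl Edm; mnorm => /eqP h.
  by apply/eqP; rewrite -subr_eq0; apply/eqP; rewrite -[RHS]oppr0 -[in RHS]h; mx_ring.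
rewrite jacobi_mul_inf/= -/a -/b -/c -/e F2 F3 {1}Edl {1}Edm !subrK.
congr (_, (_, _, _)); rewrite /k0; mx_ring.
Qed.

Lemma bot_shift x (T : 'M[int]_(n + g)) : Gamma_J x -> T^T = T ->
  exists2 x', Gamma_J x' & jC x' = jC x /\ jD x' = jC x *m T + jD x.
Proof.
case: x => M [[lam mu] kap] [/= /SpP sM _] sT.
set a := ulsubmx M in sM; set b := ursubmx M in sM.
set c := dlsubmx M in sM; set e := drsubmx M in sM.
pose s := ulsubmx T; pose t := dlsubmx T.
have ss : s^T = s by rewrite /s trmx_ulsub sT.
have st : ursubmx T = t^T by rewrite /t trmx_dlsub sT.
(* mu2 is dictated by the required bottom row; kappa is free there and is chosen to make kappa + mu2
   lam^T = 0. *)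
pose mu2 := mu + t + lam *m s.
exists (block_mx a (a *m s + b) c (c *m s + e), (lam, mu2, - (mu2 *m lam^T))).
  split=> /=.
    by apply/SpP; rewrite block_mxKul block_mxKur block_mxKdl block_mxKdr; exact: symp_unip_mul.
  by rewrite /heisZ/= addNr trmx0.
rewrite /jC /jD/= block_mxKdl block_mxKdr -/c -/e; split=> //.
rewrite -[T]submxK -/s -/t st mulmx_block !mul0mx !addr0 add_block_mx !add0r.
by congr block_mx; rewrite /mu2; mnorm; rewrite ss; mx_ring.
Qed.

End Jacobi.

(** * Half-integral matrices and the invariance of terms *)

Section HalfIntegral.
Variable R : realType.
Local Notation C := R[i].

Definition half_integral p (L : 'M[R]_p) : Prop :=
  [/\ L^T = L, forall i, L i i \is a Num.int & forall i j, L i j *+ 2 \is a Num.int].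

(** Off-diagonal entries of T occur twice, so the trace is an integral combination of the 2 L i j
    and the L i i. *)
Lemma half_integral_tr p (L : 'M[R]_p) (T : 'M[int]_p) : half_integral L -> T^T = T ->
  \tr (L *m map_mx intr T) \is a Num.int.
Proof.
move=> [sL dL oL] sT.
pose U : 'M[int]_p := \matrix_(i, j) (if (i < j)%N then T i j else 0).
pose D : 'M[int]_p := \matrix_(i, j) (if i == j then T i j else 0).
have ET : T = U + U^T + D.
  apply/matrixP => i j; rewrite !mxE; case: (ltngtP i j) => [ij|ij|/val_inj ->].
  - by rewrite (_ : (i == j) = false) ?addr0//; apply/eqP => E; rewrite E ltnn in ij.
  - rewrite (_ : (i == j) = false) ?addr0 ?add0r//; last first.
      by apply/eqP => E; rewrite E ltnn in ij.
    by rewrite -{1}sT mxE.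
  - by rewrite eqxx !add0r.
have tE (V : 'M[int]_p) : \tr (L *m map_mx intr V) = \sum_i \sum_j L i j * (V j i)%:~R.
  by apply: eq_bigr => i _; rewrite mxE; apply: eq_bigr => j _; rewrite mxE.
have -> : \tr (L *m map_mx intr T) = \sum_i \sum_j (L i j *+ 2) * (U j i)%:~R
    + \sum_i L i i * (T i i)%:~R.
  have tU : \tr (L *m map_mx intr U^T) = \tr (L *m map_mx intr U).
    by rewrite -mxtrace_tr trmx_mul sL -map_trmx trmxK mxtrace_mulC.
  rewrite {1}ET !map_mxD !mulmxDr !mxtraceD tU !tE; congr (_ + _).
    rewrite -mulr2n -sumrMnl; apply: eq_bigr => i _.
    by rewrite -sumrMnl; apply: eq_bigr => j _; rewrite mulrnAl.
  apply: eq_bigr => i _; rewrite (bigD1 i)//= big1 ?addr0 => [|j hj].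
    by rewrite mxE eqxx.
  by rewrite mxE (negbTE hj) mulr0.
rewrite rpredD// rpred_sum// => i _; last by rewrite rpredM// intr_int.
by rewrite rpred_sum// => j _; rewrite rpredM// intr_int.
Qed.

Lemma e_half_integral_tr p (L : 'M[R]_p) (T : 'M[int]_p) : half_integral L -> T^T = T ->
  e (\tr (mxR L *m mxZ R T)) = 1.
Proof.
move=> hL sT; have /intrP[z Ez] := half_integral_tr hL sT.
by rewrite mxZ_R -mxRM tr_mxR Ez rmorph_int e_int.
Qed.

(** Two symplectic matrices with the same bottom row differ by a symmetric integral s, which is
    added to W and disappears in e(tr(L W)). *)
Lemma pterm_same_row p (L : 'M[R]_p) K (a b a' b' c d : 'M[int]_p) (Z : 'M[C]_p) :
  half_integral L -> siegelP Z -> symp a b c d -> symp a' b' c d ->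
  pterm L K a' b' c d Z = pterm L K a b c d Z.
Proof.
move=> hL hZ sy sy'; have [s [ss -> ->]] := symp_same_row sy sy'.
have EM : mobius (a + s *m c) (b + s *m d) c d Z = mobius a b c d Z + mxZ R s.
  have uJ := autj_unit sy hZ.
  rewrite /mobius (_ : autj _ _ Z = autj a b Z + mxZ R s *m autj c d Z).
    by rewrite mulmxDl (mulmxK uJ).
  rewrite /autj /mxZ !map_mxD !map_mxM; mnorm; mx_ring.
by rewrite /pterm EM mulmxDr mxtraceD eD (e_half_integral_tr hL ss) mulr1.
Qed.

Lemma pterm_shift p (L : 'M[R]_p) K (a b c d T : 'M[int]_p) (Z : 'M[C]_p) :
  pterm L K a b c d (Z + mxZ R T) = pterm L K a (a *m T + b) c (c *m T + d) Z.
Proof.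
have E (u v : 'M[int]_p) : autj u v (Z + mxZ R T) = autj u (u *m T + v) Z.
  by rewrite /autj /mxZ map_mxD map_mxM; mnorm; mx_ring.
by rewrite /pterm /mobius !E.
Qed.

End HalfIntegral.

(** Bookkeeping for [slashE]: the hypothesis turns one of the two copies of tr(S lam z^t) into tr(S
    z lam^t). *)
Lemma tr_shuffle (V : comPzRingType) q (M A B D E T zl lz : 'M[V]_q) :
  \tr (M *m lz) = \tr (M *m zl) ->
  \tr (M *m (- A + B + lz *+ 2 + D + E)) + \tr (M *m T) =
  \tr (M *m (- A + (zl + B + E) + (lz + T + D))).
Proof. by move=> h; rewrite mulr2n !(mulmxDr M) !mxtraceD h; ring. Qed.

Section IndexTrace.
Variables (R : realType) (n g : nat).
Local Notation C := R[i].

Lemma mxR_block (A : 'M[R]_n) (B : 'M[R]_(n, g)) (B' : 'M[R]_(g, n)) (D : 'M[R]_g) :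
  mxR (block_mx A B B' D) = block_mx (mxR A) (mxR B) (mxR B') (mxR D).
Proof. exact: map_block_mx. Qed.

Lemma tr_index_block (S : 'M[R]_g) (T : 'M[R]_n) (r : 'M[int]_(n, g)) (tau : 'M[C]_n) (z : 'M[C]_(g, n)) (tau2 : 'M[C]_g) :
  \tr (mxR (index_mx S T r) *m block_mx tau z^T z tau2) =
  \tr (mxR T *m tau + mxZ R r *m z) + \tr (mxR S *m tau2).
Proof.
rewrite /index_mx mxR_block mulmx_block mxtrace_block !mxtraceD.
have Er : \tr (mxR (2^-1 *: map_mx intr r) *m z) = 2^-1 * \tr (mxZ R r *m z).
  rewrite mxRZ -mxZ_R -scalemxAl mxtraceZ; congr (_ * _).
  by rewrite fmorphV rmorph_nat.
have -> : \tr (mxR (2^-1 *: map_mx intr r)^T *m z^T) = 2^-1 * \tr (mxZ R r *m z).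
  by rewrite -Er mxR_tr -trmx_mul mxtrace_tr mxtrace_mulC.
rewrite Er.
repeat (match goal with |- context [@mxtrace ?V ?q ?M] =>
  let u := fresh "u" in set u := (@mxtrace V q M); clearbody u end).
by field.
Qed.

End IndexTrace.

(** * The Poincare series as a sum over bottom rows *)

Section JacobiSeries.
Variables (R : realType) (n g : nat) (S : 'M[R]_g) (l : 'M[R]_n)
  (r : 'M[int]_(n, g)) (K : nat).
Local Notation C := R[i].
Local Notation p := (n + g)%N.
Local Notation L := (index_mx S l r).
Implicit Types (x y : jacobi n g) (Z : 'M[C]_p) (b : 'M[int]_(p, p + p)).

Definition jterm x Z : C := pterm L K (jA x) (jB x) (jC x) (jD x) Z.

Lemma mxZ_block (A : 'M[int]_n) (B : 'M[int]_(n, g)) (B' : 'M[int]_(g, n)) (D : 'M[int]_g) :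
  mxZ R (block_mx A B B' D) = block_mx (mxZ R A) (mxZ R B) (mxZ R B') (mxZ R D).
Proof. exact: map_block_mx. Qed.

Lemma mxZ1 q : mxZ R (1%:M : 'M[int]_q) = 1%:M. Proof. exact: map_mx1. Qed.
Lemma mxZ0 q q' : mxZ R (0 : 'M[int]_(q, q')) = 0.
Proof. by apply/matrixP => i j; rewrite !mxE. Qed.
Lemma mxZB q q' (A B : 'M[int]_(q, q')) : mxZ R (A - B) = mxZ R A - mxZ R B.
Proof. exact: map_mxB. Qed.

(** Solve W J = N by blocks, J being block triangular. The first block column of W holds the two
    arguments of the slashed function; the lower right block is tau2 plus the matrix in the
    automorphy factor, up to a transposition under the trace. *)
Lemma slashE x (tau : 'M[C]_n) (z : 'M[C]_(g, n)) (tau2 : 'M[C]_g) :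
  S^T = S -> Gamma_J x -> let Z := block_mx tau z^T z tau2 in siegelP Z ->
  slash K.*2 S x (expTR l r) tau z * e (\tr (mxR S *m tau2)) = jterm x Z.
Proof.
move=> sS gx Z hZ.
have sy := jsymp gx.
have uJ := autj_unit sy hZ; have sW := mobius_sym sy hZ.
have WJ := mobiusK sy hZ.
rewrite /jterm /pterm.
move: uJ sW WJ; case: x gx sy => M [[lam mu] kap] gx sy.
set a := mxZ R (ulsubmx M); set b := mxZ R (ursubmx M).
set c := mxZ R (dlsubmx M); set d := mxZ R (drsubmx M).
set j := c *m tau + d.
pose q := c *m z^T + c *m (mxZ R mu)^T - d *m (mxZ R lam)^T.
have EJ : autj (jC (M, (lam, mu, kap))) (jD (M, (lam, mu, kap))) Z = block_mx j q 0 1%:M.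
  rewrite /autj /jC /jD /= !mxZ_block /Z mulmx_block !mxZ0 !mxZ1 !mul0mx !addr0.
  rewrite add_block_mx !add0r mxZB !mxZM !mxZ_tr -/c -/d; congr block_mx.
  by rewrite /q addrA.
pose w := z + mxZ R lam *m tau + mxZ R mu.
pose v := mxZ R lam *m z^T + tau2 + mxZ R kap.
have EN : autj (jA (M, (lam, mu, kap))) (jB (M, (lam, mu, kap))) Z =
    block_mx (a *m tau + b) (a *m z^T + (a *m (mxZ R mu)^T - b *m (mxZ R lam)^T)) w v.
  rewrite /autj /jA /jB /= !mxZ_block /Z mulmx_block !mxZ0 !mxZ1 !mul0mx !addr0 !mul1mx.
  rewrite add_block_mx mxZB !mxZM !mxZ_tr -/a -/b; congr block_mx.
  by rewrite /w [mxZ R lam *m tau + z]addrC.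
rewrite EJ EN => uJ sW WJ.
have uj : j \in unitmx.
  by move: uJ; rewrite !unitmxE det_ublock det1 mulr1.
set W := mobius _ _ _ _ Z in sW WJ *.
have EW : W *m block_mx j q 0 1%:M = block_mx (ulsubmx W *m j) (ulsubmx W *m q + ursubmx W)
    (dlsubmx W *m j) (dlsubmx W *m q + drsubmx W).
  by rewrite -{1}[W]submxK mulmx_block !mulmx0 !mulmx1 !addr0.
move: WJ; rewrite EW => /eq_block_mx[w11 _ w21 w22]; clearbody W.
have E11 : ulsubmx W = (a *m tau + b) *m invmx j by rewrite -w11 (mulmxK uj).
have E21 : dlsubmx W = w *m invmx j by rewrite -w21 (mulmxK uj).
have E12 : ursubmx W = (dlsubmx W)^T by rewrite trmx_dlsub sW.
have st : tau^T = tau.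
  by have := hZ.1; rewrite /Z tr_block_mx => /eq_block_mx[].
have Eq : q = c *m w^T - j *m (mxZ R lam)^T.
  by rewrite /q /w /j; mnorm; rewrite st; mx_ring.
have E22 : drsubmx W = - (w *m invmx j *m c *m w^T) + w *m (mxZ R lam)^T + v.
  apply/eqP; rewrite eq_sym -subr_eq0; apply/eqP; rewrite -w22 E21 Eq.
  rewrite mulmxBr !mulmxA (mulmxKV uj); mx_ring.
have -> : \det (block_mx j q 0 1%:M) = \det j by rewrite det_ublock det1 mulr1.
rewrite /slash -/a -/b -/c -/d -/j -/w -mul2n -mulrA -mulrA; congr (_ * _).
rewrite /expTR -E11 -E21 -eD -eD; congr e.
have -> : mxR L *m W =
    mxR L *m block_mx (ulsubmx W) (dlsubmx W)^T (dlsubmx W) (drsubmx W).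
  by rewrite -E12 submxK.
rewrite tr_index_block.
have Ew : w *m (mxZ R lam)^T = z *m (mxZ R lam)^T + mxZ R lam *m tau *m (mxZ R lam)^T
    + mxZ R mu *m (mxZ R lam)^T by rewrite /w !mulmxDl.
have Esym : \tr (mxR S *m (mxZ R lam *m z^T)) = \tr (mxR S *m (z *m (mxZ R lam)^T)).
  rewrite -mxtrace_tr !trmx_mul trmxK -mxR_tr sS mxtrace_mulC.
  by [].
rewrite E22 -E21 Ew /v [LHS]addrAC [LHS]addrC; congr (_ + _); exact: tr_shuffle.
Qed.

Definition Bots : set 'M[int]_(p, p + p) := (@bot n g) @` @Gamma_J n g.

(** On [Bots] the default is never reached ([repP]), and by [jterm_bot] the choice of representative
    does not change the term. *)
Definition rep b : jacobi n g := xget (1%:M, (0, 0, 0)) [set x | Gamma_J x /\ bot x = b].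

Definition bterm b Z : C := jterm (rep b) Z.

Lemma repP b : Bots b -> Gamma_J (rep b) /\ bot (rep b) = b.
Proof.
by move=> [x gx xb]; rewrite /rep; case: xgetP => [y _ //|/(_ x)[]].
Qed.

Lemma rep_rows b : Bots b -> lsubmx b = jC (rep b) /\ rsubmx b = jD (rep b).
Proof.
move=> /repP[_ bx]; split; first by rewrite -[in LHS]bx row_mxKl.
by rewrite -[in LHS]bx row_mxKr.
Qed.

Lemma jterm_bot x y Z : half_integral L -> siegelP Z -> Gamma_J x -> Gamma_J y ->
  bot x = bot y -> jterm x Z = jterm y Z.
Proof.
move=> hL hZ gx gy /eq_row_mx[ec ed]; have sx := jsymp gx; have sy := jsymp gy.
by rewrite ec ed in sx; rewrite /jterm ec ed (pterm_same_row _ hL hZ sy sx).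
Qed.

Lemma bterm_bot x Z : half_integral L -> siegelP Z -> Gamma_J x ->
  bterm (bot x) Z = jterm x Z.
Proof.
move=> hL hZ gx; have [|gr br] := @repP (bot x); first by exists x.
exact: jterm_bot.
Qed.

Lemma Gamma_J_inf1 : Gamma_J_inf (1%:M, (0, 0, 0) : heis n g).
Proof.
rewrite (_ : 1%:M = block_mx 1%:M 0 0 1%:M :> 'M[int]_(n + n)) ?scalar_mx_block//.
by apply: Gamma_J_infP; rewrite trmx0.
Qed.

Lemma coset_rep x : Gamma_J x -> let y := xget (1%:M, (0, 0, 0)) (Gcoset x) in
  Gamma_J y /\ bot y = bot x.
Proof.
move=> gx /=; case: xgetP => [y _ [d gd <-]|h]; first exact: bot_inf.
exfalso; apply: (h (jacobi_mul (1%:M, (0, 0, 0)) x)).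
by exists (1%:M, (0, 0, 0)) => //; exact: Gamma_J_inf1.
Qed.

(** Taking the bottom row of the representative chosen by [xget] is a bijection from [Gcosets] to
    [Bots]; the factor e(tr(S tau2)) of [slashE] is divided out. *)
Lemma has_sum_cosets (tau : 'M[C]_n) (z : 'M[C]_(g, n)) (tau2 : 'M[C]_g) (s : C) :
  S^T = S -> half_integral L -> siegelP (block_mx tau z^T z tau2) ->
  has_sum Bots (fun b => bterm b (block_mx tau z^T z tau2)) s ->
  has_sum (@Gcosets n g)
    (fun X => slash K.*2 S (xget (1%:M, (0, 0, 0)) X) (expTR l r) tau z)
    ((e (\tr (mxR S *m tau2)))^-1 * s).
Proof.
move=> sS hL hZ hs.
pose rx (X : set (jacobi n g)) := xget (1%:M, (0, 0, 0)) X.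
have bij : set_bij (@Gcosets n g) Bots (fun X => bot (rx X)).
  split.
  - by move=> _ [x gx <-]; have [gy by_] := coset_rep gx; exists (rx (Gcoset x)).
  - move=> X Y /set_mem[x gx <-] /set_mem[y gy <-].
    have [_ bx] := coset_rep gx; have [_ by_] := coset_rep gy.
    rewrite /rx bx by_ => exy.
    have sub u v : Gamma_J u -> Gamma_J v -> bot u = bot v -> Gcoset u `<=` Gcoset v.
      move=> gu gv euv _ [d gd <-]; have [gdu bdu] := bot_inf gd gu.
      have [|d' gd' E] := bot_eq_inf gdu gv; first by rewrite bdu.
      by exists d'.
    by apply/seteqP; split; apply: sub.
  - move=> b [x gx <-]; exists (Gcoset x); first by exists x.
    by have [_ ->] := coset_rep gx.
have := has_sumZ (e (\tr (mxR S *m tau2)))^-1 (proj2 (has_sum_reindex _ _ bij) hs).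
apply: eq_has_sum => X [x gx <-] /=.
have [gy by_] := coset_rep gx; rewrite bterm_bot//.
by rewrite /rx -(slashE sS gy hZ) mulrC mulfK// e_neq0.
Qed.

(** The effect of Z -> Z + T on bottom rows, a permutation of [Bots] when T is symmetric. *)
Definition bshift (T : 'M[int]_p) b : 'M[int]_(p, p + p) :=
  row_mx (lsubmx b) (lsubmx b *m T + rsubmx b).

Lemma bshiftK T : cancel (bshift T) (bshift (- T)).
Proof.
move=> b; rewrite /bshift row_mxKl row_mxKr mulmxN addKr.
by rewrite hsubmxK.
Qed.

Lemma bshift_Bots T b : T^T = T -> Bots b -> Bots (bshift T b).
Proof.
move=> sT [x gx <-]; have [x' gx' [ec ed]] := bot_shift gx sT.
by exists x' => //; rewrite /bshift /bot row_mxKl row_mxKr ec ed.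
Qed.

Lemma bterm_shift T b Z : half_integral L -> siegelP Z -> T^T = T -> Bots b ->
  bterm b (Z + mxZ R T) = bterm (bshift T b) Z.
Proof.
move=> hL hZ sT bb; have [gx bx] := repP bb.
have bb' := bshift_Bots sT bb; have [gy _] := repP bb'.
have [ec ed] := rep_rows bb'; have [fc fd] := rep_rows bb.
rewrite row_mxKl fc in ec; rewrite row_mxKr fc fd in ed.
have sx := symp_unip_mul sT (jsymp gx); have sy := jsymp gy.
rewrite -ec -ed in sy.
by rewrite /bterm /jterm pterm_shift -ec -ed; exact: pterm_same_row.
Qed.

Lemma has_sum_bterm_shift T Z s : half_integral L -> siegelP Z -> T^T = T ->
  has_sum Bots (bterm^~ Z) s -> has_sum Bots (bterm^~ (Z + mxZ R T)) s.
Proof.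
move=> hL hZ sT hs.
have sNT : (- T)^T = - T by rewrite mxtrN sT.
have bij : set_bij Bots Bots (bshift T).
  split.
  - by move=> b; exact: bshift_Bots.
  - by move=> b b' _ _; exact: (can_inj (bshiftK T)).
  - move=> b bb; exists (bshift (- T) b); first exact: bshift_Bots.
    by have := bshiftK (- T) b; rewrite opprK.
apply: eq_has_sum (proj2 (has_sum_reindex _ _ bij) hs) => b bb.
by rewrite /= bterm_shift.
Qed.

Lemma bterm_tau_le b Z N : (0 < n)%N -> posdef L -> (N <= K)%N -> Bots b -> siegelP Z ->
  nm (bterm b Z) <=
  (\det (ImM_ Z)) ^- K * Gbound L K N * (tauZ (lsubmx b) (rsubmx b) Z) ^- N.
Proof.
move=> n0 pL NK bb hZ; have [gx bx] := repP bb.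
have [-> ->] := rep_rows bb; apply: pterm_le => //.
  by rewrite addn_gt0 n0.
exact: jsymp.
Qed.

Lemma Bots_neq0 b : (0 < n)%N -> Bots b -> lsubmx b != 0 \/ rsubmx b != 0.
Proof.
move=> n0 bb; have [gx _] := repP bb; have [_ _ s3] := jsymp gx.
have [-> ->] := rep_rows bb.
have [c0|] := eqVneq (jC (rep b)) 0; [right|by left].
apply/eqP => d0; move: s3; rewrite c0 d0 trmx0 mulmx0 mul0mx subrr.
have p0 : (0 < p)%N by rewrite addn_gt0 n0.
by move=> /matrixP/(_ (Ordinal p0) (Ordinal p0)); rewrite !mxE eqxx.
Qed.

(** The minimum comes from [tau_lower] and 3 + 2 beta from [fro_row_lower]; the 2 pays for the
    summand 1 in [tau_ge], every bottom row having squared norm at least 1. *)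
Definition kappa (sigma eta beta : R) : R :=
  Num.min sigma^-1 eta / (2 * (3 + 2 * beta)).

Lemma tau_ge b Z (sigma eta beta : R) : (0 < n)%N -> Bots b -> siegelP Z ->
  0 < eta -> 0 <= beta -> \tr (ImM_ Z) <= sigma ->
  (forall v : 'rV_p, eta * fro v <= qf (ImM_ Z) v) -> fro (ReM_ Z) <= beta ->
  kappa sigma eta beta * (1 + \sum_i \sum_j (b i j)%:~R ^+ 2) <=
    tauZ (lsubmx b) (rsubmx b) Z.
Proof.
move=> n0 bb hZ e0 b0 hs he hx.
have p0 : (0 < p)%N by rewrite addn_gt0 n0.
pose c : 'M[R]_p := map_mx intr (lsubmx b); pose d : 'M[R]_p := map_mx intr (rsubmx b).
have s0 : 0 < sigma by apply: lt_le_trans (posdef_tr_gt0 p0 hZ.2) hs.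
have hl := tau_lower c (c *m ReM_ Z + d) p0 hZ.2 hs he.
apply: le_trans hl.
have hr := fro_row_lower c d hx.
have -> : \sum_i \sum_j (b i j)%:~R ^+ 2 = fro c + fro d.
  rewrite /fro -big_split; apply: eq_bigr => i _; rewrite big_split_ord/=.
  by congr (_ + _); apply: eq_bigr => j _; rewrite !mxE.
have h1 : 1 <= fro c + fro d.
  have [/(fro_int_ge1 R)|/(fro_int_ge1 R)] := Bots_neq0 n0 bb => h.
    by rewrite (le_trans h)// lerDl fro_ge0.
  by rewrite (le_trans h)// lerDr fro_ge0.
set m := Num.min sigma^-1 eta.
have m0 : 0 < m by rewrite lt_min invr_gt0 s0.
have m1 : m <= sigma^-1 by rewrite ge_min lexx.
have m2 : m <= eta by rewrite ge_min lexx orbT.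
have fP := fro_ge0 (c *m ReM_ Z + d); have fc := fro_ge0 c.
apply: (@le_trans _ _ (m * (fro (c *m ReM_ Z + d) + fro c))); last first.
  by rewrite mulrDr mulrC lerD ?ler_wpM2l ?ler_wpM2r.
rewrite /kappa -/m -mulrA ler_wpM2l ?(ltW m0)// mulrC.
have k0 : 0 < 2 * (3 + 2 * beta) by lra.
by rewrite ler_pdivrMr//; lra.
Qed.

(** The number of entries of a bottom row: at this exponent [prod_wt_ge] yields one weight per
    entry. *)
Definition NL : nat := (p * (p + p))%N.

Lemma tau_pow_le b Z (sigma eta beta : R) : (0 < n)%N -> Bots b -> siegelP Z ->
  0 < eta -> 0 <= beta -> \tr (ImM_ Z) <= sigma ->
  (forall v : 'rV_p, eta * fro v <= qf (ImM_ Z) v) -> fro (ReM_ Z) <= beta ->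
  (tauZ (lsubmx b) (rsubmx b) Z) ^- NL <=
    (kappa sigma eta beta) ^- NL * \prod_i \prod_j wt R (b i j).
Proof.
move=> n0 bb hZ e0 b0 hs he hx.
have p0 : (0 < p)%N by rewrite addn_gt0 n0.
have s0 : 0 < sigma by apply: lt_le_trans (posdef_tr_gt0 p0 hZ.2) hs.
have ht := tau_ge n0 bb hZ e0 b0 hs he hx.
have k0 : 0 < kappa sigma eta beta.
  by rewrite /kappa divr_gt0 ?lt_min ?invr_gt0 ?s0//; lra.
set x := \sum_i _ in ht.
have x0 : 0 <= x by apply: sumr_ge0 => i _; apply: sumr_ge0 => j _; exact: sqr_ge0.
have kx : 0 < kappa sigma eta beta * (1 + x) by rewrite mulr_gt0// ltr_pwDl.
apply: (@le_trans _ _ ((kappa sigma eta beta * (1 + x)) ^- NL)).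
  rewrite lef_pV2 ?posrE ?exprn_gt0//; last exact: lt_le_trans ht.
  by rewrite lerXn2r ?nnegrE ?(ltW kx)// (le_trans (ltW kx)).
rewrite exprMn invfM ler_wpM2l ?invr_ge0 ?exprn_ge0 ?(ltW k0)//.
have -> : NL = #|{: 'I_p * 'I_(p + p)}| by rewrite card_prod !card_ord.
rewrite (pair_bigA _ (fun i j => wt R (b i j)))/=.
by apply: prod_wt_ge; rewrite /x (pair_bigA _ (fun i j => (b i j)%:~R ^+ 2)).
Qed.

Lemma bterm_le b Z N (sigma eta beta : R) : (0 < n)%N -> posdef L -> (NL <= K)%N ->
  Bots b -> siegelP Z -> N = NL ->
  0 < eta -> 0 <= beta -> \tr (ImM_ Z) <= sigma ->
  (forall v : 'rV_p, eta * fro v <= qf (ImM_ Z) v) -> fro (ReM_ Z) <= beta ->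
  nm (bterm b Z) <= (\det (ImM_ Z)) ^- K * Gbound L K N * (kappa sigma eta beta) ^- N
     * \prod_i \prod_j wt R (b i j).
Proof.
move=> n0 pL NK bb hZ -> e0 b0 hs he hx.
have p0 : (0 < p)%N by rewrite addn_gt0 n0.
apply: le_trans (bterm_tau_le n0 pL NK bb hZ) _.
rewrite -[leRHS]mulrA ler_wpM2l ?tau_pow_le//.
by rewrite mulr_ge0 ?Gbound_ge0 ?invr_ge0 ?exprn_ge0// ltW// posdef_det//; case: hZ.
Qed.

End JacobiSeries.

(** * Single terms along complex lines *)

Section PtermLine.
Variable R : realType.
Local Notation C := R[i].

(** The line A + s B as a matrix of polynomials in s, so that determinant and adjugate along it are
    polynomials too. *)
Definition pm p (A B : 'M[C]_p) : 'M[{poly C}]_p := map_mx polyC A + 'X *: map_mx polyC B.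

Lemma pm_horner p (A B : 'M[C]_p) (s : C) : map_mx (horner_eval s) (pm A B) = A + s *: B.
Proof.
by apply/matrixP => i j; rewrite !mxE /horner_eval hornerD hornerM hornerX !hornerC.
Qed.

Lemma det_line p (A B : 'M[C]_p) (s : C) : \det (A + s *: B) = (\det (pm A B)).[s].
Proof. by rewrite -pm_horner det_map_mx. Qed.

Lemma adj_line p (A B : 'M[C]_p) (s : C) i j :
  (\adj (A + s *: B)) i j = ((\adj (pm A B)) i j).[s].
Proof. by rewrite -pm_horner -map_mx_adj mxE. Qed.

Lemma autj_line p (c d : 'M[int]_p) (Z U : 'M[C]_p) (s : C) :
  autj c d (Z + s *: U) = autj c d Z + s *: (mxZ R c *m U).
Proof. by rewrite /autj mulmxDr -scalemxAr addrAC. Qed.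

(** By Cramer's rule the entries of W are polynomials in s divided by a determinant without zeros in
    the disc, to which [Ap_inv_poly] applies. *)
Lemma Ap_pterm p (L : 'M[R]_p) K (a b c d : 'M[int]_p) (Z U : 'M[C]_p) (rho : R) :
  0 < rho -> (forall s, nm s <= rho -> autj c d (Z + s *: U) \in unitmx) ->
  Ap rho (fun s => pterm L K a b c d (Z + s *: U)).
Proof.
move=> r0 hu.
pose P := pm (autj c d Z) (mxZ R c *m U).
have detE s : \det (autj c d (Z + s *: U)) = (\det P).[s] by rewrite autj_line det_line.
have hinv : Ap rho (fun s => ((\det P).[s])^-1).
  apply: Ap_inv_poly => // s sr; rewrite -detE.
  by have := hu s sr; rewrite unitmxE unitfE.
apply: ApM.
  apply: (@Ap_ext _ _ (fun s => ((\det P).[s])^-1 ^+ (2 * K))); last exact: ApX.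
  by move=> s sr; rewrite exprVn detE.
apply: Ap_e.
pose N i j (s : C) := autj a b Z i j + s * (mxZ R a *m U) i j.
apply: (@Ap_ext _ _ (fun s => \sum_i \sum_k mxR L i k *
   (\sum_q N k q s * (((\det P).[s])^-1 * ((\adj P) q i).[s])))).
  move=> s sr; apply: eq_bigr => i _; rewrite mxE; apply: eq_bigr => k _.
  rewrite [X in _ = _ * X]mxE; congr (_ * _); apply: eq_bigr => q _.
  rewrite autj_line [X in _ = X * _]mxE [X in (_ + X) * _ = _]mulrC.
  rewrite [X in _ = (_ + X) * _]mxE [in RHS]/invmx (hu s sr) [X in _ = _ * X]mxE.
  by rewrite detE autj_line adj_line mulrC.
apply: Ap_sum => i _; apply: Ap_sum => k _; apply: ApM; first exact: Ap_const.
apply: Ap_sum => q _; apply: ApM.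
  by apply: ApD; [exact: Ap_const|apply: ApM; [exact: Ap_id|exact: Ap_const]].
by apply: ApM => //; exact: Ap_poly.
Qed.

End PtermLine.

(** * Perturbation and lower bounds of quadratic forms *)

Section Perturb.
Variables (R : realType) (p : nat).

Lemma qf_perturb (E : 'M[R]_p) (x : 'rV[R]_p) (d : R) : 0 <= d ->
  (forall i j, `|E i j| <= d) -> `|qf E x| <= d * p%:R * fro x.
Proof.
move=> d0 hE.
have -> : qf E x = \sum_j \sum_i x 0 i * E i j * x 0 j.
  rewrite /qf mxE; apply: eq_bigr => j _; rewrite mxE mulr_suml.
  by apply: eq_bigr => i _; rewrite !mxE.
apply: (@le_trans _ _ (d * (\sum_i `|x 0 i| * 1) ^+ 2)).
  rewrite (le_trans (ler_norm_sum _ _ _))// expr2 mulr_suml mulr_sumr ler_sum// => j _.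
  rewrite (le_trans (ler_norm_sum _ _ _))// mulr1 !mulr_sumr ler_sum// => i _.
  have h := hE i j; rewrite !normrM mulr1.
  move: (normr_ge0 (x 0 i)) (normr_ge0 (x 0 j)); move: (`|E i j|) (`|x 0 i|) (`|x 0 j|) h.
  move=> ae a1 a2 h h1 h2; rewrite [a1 * ae]mulrC -mulrA [a2 * _]mulrC ler_wpM2r//.
  by rewrite mulr_ge0.
rewrite -mulrA ler_wpM2l// (le_trans (cauchy_schwarz _ _))//.
rewrite mulrC; under eq_bigr do rewrite expr1n.
rewrite sumr_const card_ord ler_wpM2l// /fro big_ord1.
by apply: ler_sum => i _; rewrite real_normK ?num_real.
Qed.

Lemma qfD (A B : 'M[R]_p) (x : 'rV[R]_p) : qf (A + B) x = qf A x + qf B x.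
Proof. by rewrite /qf mulmxDr mulmxDl mxE. Qed.

Lemma qf_gt0_posdef (Y : 'M[R]_p) (eta : R) : Y^T = Y -> 0 < eta ->
  (forall v : 'rV_p, eta * fro v <= qf Y v) -> posdef Y.
Proof.
move=> sY e0 he; split=> // x x0; apply: lt_le_trans (he x).
by rewrite mulr_gt0// fro_gt0.
Qed.

(** For Y = V^T V and Q = (V^T)^-1, Q Y Q^T is the identity, with trace p; the lower bound on the
    rows of Q gives eta fro Q, and fro Q = tr(Y^-1). *)
Lemma tr_inv_le (Y : 'M[R]_p) (eta : R) : posdef Y ->
  (forall v : 'rV_p, eta * fro v <= qf Y v) -> eta * \tr (invmx Y) <= p%:R.
Proof.
move=> pY he; have [V uV EY] := posdef_chol pY.
have uVt : V^T \in unitmx by rewrite unitmx_tr.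
have -> : p%:R = \tr (invmx V^T *m Y *m (invmx V^T)^T) :> R.
  by rewrite EY mulmxA (mulVmx uVt) mul1mx trmx_inv trmxK (mulmxV uV) mxtrace1.
have -> : \tr (invmx Y) = fro (invmx V^T).
  rewrite -fro_trmx fro_tr trmxK trmx_inv trmxK; congr (\tr _).
  have uY := posdef_unit pY; apply: (can_inj (mulKmx uY)); rewrite (mulmxV uY).
  by rewrite EY -!mulmxA (mulmxA V) (mulmxV uV) mul1mx (mulmxV uVt).
by rewrite tr_sandwich_qf fro_row mulr_sumr ler_sum.
Qed.

Lemma det_inv_le (Y : 'M[R]_p) (eta : R) : 0 < eta -> posdef Y ->
  (forall v : 'rV_p, eta * fro v <= qf Y v) ->
  (\det Y)^-1 <= p`!%:R * (p%:R / eta) ^+ p.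
Proof.
move=> e0 pY he; rewrite -det_inv.
apply: le_trans (posdef_det_le (posdef_inv pY)) _; rewrite ler_wpM2l//.
have h := tr_inv_le pY he.
have t0 : 0 <= \tr (invmx Y).
  have [V _ ->] := posdef_chol (posdef_inv pY).
  by rewrite mxtrace_mulC -fro_tr fro_ge0.
by rewrite lerXn2r ?nnegrE// ?divr_ge0 ?(ltW e0)// ler_pdivlMr// mulrC.
Qed.

End Perturb.

(* Fourier analysis is done with all entries of W independent; the variable of
   the Siegel half-space is W + W^T. *)
Definition symW (R : realType) p (W : 'M[R[i]]_p) : 'M[R[i]]_p := W + W^T.

(** * Convergence and tameness of the lifted Poincare series *)

Section PoincareTame.
Variables (R : realType) (n g : nat) (S : 'M[R]_g) (l : 'M[R]_n)
  (r : 'M[int]_(n, g)) (K : nat).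
Local Notation C := R[i].
Local Notation p := (n + g)%N.
Local Notation L := (index_mx S l r).
Hypotheses (n0 : (0 < n)%N) (pL : posdef L) (hL : half_integral L)
  (NK : (NL n g <= K)%N).
Implicit Types (W U : 'M[C]_p) (b : 'M[int]_(p, p + p)).

Definition domW : set 'M[C]_p := [set W | posdef (ImM_ (symW W))].

Lemma symW_siegel W : domW W -> siegelP (symW W).
Proof. by split=> //; rewrite /symW trmxD trmxK addrC. Qed.

Lemma ImM_D q q' (A B : 'M[C]_(q, q')) : ImM_ (A + B) = ImM_ A + ImM_ B.
Proof. by apply/matrixP => i j; rewrite !mxE ImD. Qed.
Lemma ReM_D q q' (A B : 'M[C]_(q, q')) : ReM_ (A + B) = ReM_ A + ReM_ B.
Proof. by apply/matrixP => i j; rewrite !mxE ReD. Qed.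
Lemma ImM_tr q q' (A : 'M[C]_(q, q')) : ImM_ A^T = (ImM_ A)^T.
Proof. by apply/matrixP => i j; rewrite !mxE. Qed.
Lemma ImM_mxR q q' (A : 'M[R]_(q, q')) : ImM_ (mxR A) = 0.
Proof. by apply/matrixP => i j; rewrite !mxE. Qed.
Lemma ImM_iR q q' (A : 'M[R]_(q, q')) : ImM_ (iR A) = A.
Proof. by apply/matrixP => i j; rewrite !mxE ImM/= mul0r mul1r add0r. Qed.

Lemma ImM_symW W : ImM_ (symW W) = ImM_ W + (ImM_ W)^T.
Proof. by rewrite ImM_D ImM_tr. Qed.

Lemma domW_open W : domW W -> exists2 d : R, 0 < d & exists2 eta : R, 0 < eta &
  forall V, (forall i j, `|(ImM_ V - ImM_ W) i j| <= d) ->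
    (forall v : 'rV_p, eta * fro v <= qf (ImM_ (symW V)) v) /\ domW V.
Proof.
move=> dW; have p0 : (0 < p)%N by rewrite addn_gt0 n0.
have t0 := posdef_tr_gt0 p0 (posdef_inv dW).
set t := \tr _ in t0.
have pp : 0 < p%:R :> R by rewrite ltr0n.
(* E + E^T has entries at most 2 d, so its form is at most 2 d p |v|^2 = |v|^2 / (2 t), half of the
   lower bound |v|^2 / t at W; the other half is eta |v|^2. *)
pose d : R := (4 * t * p%:R)^-1.
have d0 : 0 < d by rewrite invr_gt0 !mulr_gt0.
exists d => //; exists (2 * t)^-1; first by rewrite invr_gt0 mulr_gt0.
move=> V hV.
have he v : (2 * t)^-1 * fro v <= qf (ImM_ (symW V)) v.
  set E := ImM_ V - ImM_ W in hV.
  have -> : ImM_ (symW V) = ImM_ (symW W) + (E + E^T).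
    by rewrite !ImM_symW /E mxtrB; mx_ring.
  rewrite qfD.
  have hE i j : `|(E + E^T) i j| <= 2 * d.
    rewrite mxE [E^T i j]mxE (le_trans (ler_normD _ _))//.
    by have := hV i j; have := hV j i; lra.
  have := @qf_perturb _ _ _ v _ (mulr_ge0 (ler0n _ 2) (ltW d0)) hE.
  have h1 := posdef_qf_ge v dW; rewrite -/t mulrC -ler_pdivrMr// in h1.
  have -> : 2 * d * p%:R * fro v = (2 * t)^-1 * fro v.
    rewrite /d; move: (lt0r_neq0 t0) (lt0r_neq0 pp); move: (fro v) (p%:R : R) (t).
    by move=> a1 a2 a3 h3 h4; field; rewrite h3.
  rewrite ler_norml => /andP[h2 _].
  have : (2 * t)^-1 * fro v + (2 * t)^-1 * fro v = fro v / t by field; rewrite gt_eqF.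
  lra.
split=> //; apply: qf_gt0_posdef he; last by rewrite invr_gt0 mulr_gt0.
by rewrite ImM_symW mxtrD trmxK addrC.
Qed.

Lemma posdef_segment (Y0 Y1 : 'M[R]_p) (t : R) : posdef Y0 -> posdef Y1 -> 0 <= t <= 1 ->
  posdef ((1 - t) *: Y0 + t *: Y1).
Proof.
move=> [s0 p0] [s1 p1] /andP[t0 t1]; split; first by rewrite mxtrD !linearZ/= s0 s1.
move=> x x0.
have -> : (x *m ((1 - t) *: Y0 + t *: Y1) *m x^T) 0 0 =
    (1 - t) * (x *m Y0 *m x^T) 0 0 + t * (x *m Y1 *m x^T) 0 0.
  by rewrite mulmxDr mulmxDl -!scalemxAr -!scalemxAl !mxE.
have q0 := p0 x x0; have q1 := p1 x x0.
have [->|tn0] := eqVneq t 0; first by rewrite subr0 mul1r mul0r addr0.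
have tp : 0 < t by rewrite lt_def tn0.
by rewrite ltr_wpDl// ?mulr_gt0// mulr_ge0 ?(ltW q0)// subr_ge0.
Qed.

Lemma sym_segment (A y : 'M[R]_p) (t : R) : A + t *: y + (A + t *: y)^T =
  (1 - t) *: (A + A^T) + t *: (A + y + (A + y)^T).
Proof. by apply/matrixP => i j; rewrite !mxE; ring. Qed.

Lemma tame_domain_W : tame_domain domW.
Proof.
split.
- by move=> W x; rewrite /domW/= !ImM_symW ImM_D ImM_mxR addr0.
- move=> W /domW_open[d d0 [eta e0 h]]; exists d => // y hy.
  by apply: (h _ _).2 => i j; rewrite ImM_D ImM_iR addrAC subrr add0r.
- have E W y : ImM_ (symW (W + iR y)) = ImM_ W + y + (ImM_ W + y)^T.
    by rewrite ImM_symW ImM_D ImM_iR.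
  move=> W y t h0 h1 t01; rewrite /domW /mkset in h0 h1 *.
  rewrite E sym_segment; rewrite ImM_symW in h0; rewrite E in h1.
  exact: posdef_segment.
Qed.

(** The value 0 off [domW] makes [cperiodic], which quantifies over all W, hold there too. *)
Definition poincare_lift W : C :=
  if `[< domW W >] then xget 0 [set s | has_sum (@Bots n g) ((bterm S l r K)^~ (symW W)) s]
  else 0.

(** One constant M for a whole neighbourhood of W gives convergence, boundedness and uniform
    truncation at once. Larger real shifts are brought into the cube by periodicity. *)
Lemma bterm_bound W : domW W -> exists2 rho : R, 0 < rho & exists2 M : R, 0 <= M &
  forall (x : 'M[R]_p) U (s : C) b,
    (forall i j, `|x i j| <= 2^-1) -> small U -> nm s <= rho -> Bots b ->
    let V := W + mxR x + s *: U in
    domW V /\ nm (bterm S l r K b (symW V)) <= M * \prod_i \prod_j wt R (b i j).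
Proof.
move=> dW; have [d d0 [eta e0 hV]] := domW_open dW.
have p0 : (0 < p)%N by rewrite addn_gt0 n0.
pose rho := Num.min d 1.
have r0 : 0 < rho by rewrite lt_min d0 ltr01.
have [A A0 hA] := mx_bound (ReM_ W); have [B B0 hB] := mx_bound (ImM_ W).
(* Entries of Im V will be at most B + 1 and those of Re V at most A + 2; passing to [symW] doubles
   both bounds. *)
pose sigma := p%:R * (2 * (B + 1)).
pose beta := (p * p)%:R * (2 * (A + 2)) ^+ 2.
exists rho => //.
exists ((p`!%:R * (p%:R / eta) ^+ p) ^+ K * Gbound L K (NL n g) * (kappa sigma eta beta) ^- (NL n g)).
  have b0 : 0 <= beta by rewrite mulr_ge0 ?sqr_ge0.
  have s0 : 0 < sigma by rewrite !mulr_gt0 ?ltr0n//; lra.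
  apply: mulr_ge0; last first.
    rewrite invr_ge0 exprn_ge0// divr_ge0//.
      by rewrite le_min ?invr_ge0 (ltW s0) (ltW e0).
    by rewrite mulr_ge0//; lra.
  apply: mulr_ge0; last exact: Gbound_ge0.
  by rewrite exprn_ge0// mulr_ge0// exprn_ge0// divr_ge0// ltW.
move=> x U s b hx sU sr bb V.
have sUij i j : nm (s * U i j) <= rho.
  rewrite nmM -[rho]mulr1 ler_pM ?nm_ge0//.
have eV : forall i j, `|(ImM_ V - ImM_ W) i j| <= d.
  move=> i j; rewrite /V !mxE !ImD /= addr0 addrAC subrr add0r.
  by rewrite (le_trans (ler_Im_nm _))// (le_trans (sUij i j))// ge_min lexx.
have [he dV] := hV V eV; split=> //.
have hZ := symW_siegel dV.
have rho1 : rho <= 1 by rewrite ge_min lexx orbT.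
have bIm i j : `|ImM_ V i j| <= B + 1.
  rewrite /V !mxE !ImD/= addr0 (le_trans (ler_normD _ _))// lerD//.
    by have := hB i j; rewrite mxE.
  by rewrite (le_trans (ler_Im_nm _))// (le_trans (sUij i j)).
have bRe i j : `|ReM_ V i j| <= A + 2.
  rewrite /V !mxE !ReD/= (le_trans (ler_normD _ _))// (_ : A + 2 = A + 1 + 1); last by ring.
  rewrite lerD//; last by rewrite (le_trans (ler_Re_nm _))// (le_trans (sUij i j)).
  rewrite (le_trans (ler_normD _ _))// lerD//; first by have := hA i j; rewrite mxE.
  by apply: le_trans (hx i j) _; lra.
have htr : \tr (ImM_ (symW V)) <= sigma.
  rewrite /sigma mulr_natl -[p in _ *+ p]card_ord -sumr_const ler_sum// => i _.
  rewrite ImM_symW mxE [X in _ + X]mxE.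
  by have := bIm i i; rewrite ler_norml => /andP[_]; lra.
have hfro : fro (ReM_ (symW V)) <= beta.
  rewrite /beta -sum_mn ler_sum// => i _; rewrite ler_sum// => j _.
  rewrite -[_ ^+ 2]real_normK ?num_real// lerXn2r ?nnegrE//.
    by rewrite mulr_ge0//; lra.
  rewrite ReM_D mxE (le_trans (ler_normD _ _))//.
  have := bRe i j; have := bRe j i; rewrite !mxE; lra.
have b0 : 0 <= beta by rewrite mulr_ge0 ?sqr_ge0.
apply: le_trans (bterm_le n0 pL NK bb hZ erefl e0 b0 htr he hfro) _.
have s0 : 0 < sigma by rewrite !mulr_gt0 ?ltr0n//; lra.
rewrite ler_wpM2r//.
  by rewrite prodr_ge0// => i _; rewrite prodr_ge0// => j _; exact: wt_ge0.
rewrite ler_wpM2r//.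
  rewrite invr_ge0 exprn_ge0// divr_ge0//.
    by rewrite le_min ?invr_ge0 (ltW s0) (ltW e0).
  by rewrite mulr_ge0//; lra.
rewrite ler_wpM2r ?Gbound_ge0//.
rewrite -exprVn lerXn2r ?nnegrE ?invr_ge0 ?(ltW (posdef_det dV))//.
  by rewrite mulr_ge0 ?exprn_ge0 ?divr_ge0 ?(ltW e0).
exact: det_inv_le.
Qed.

Lemma sum_le_Bots (M : R) : 0 <= M -> sum_le (@Bots n g)
  (fun b => M * \prod_i \prod_j wt R (b i j)) (M * 8 ^+ (p * (p + p))).
Proof.
move=> M0; apply: sum_leZ => //; apply: (@sum_le_sub _ _ _ setT) => //.
exact: sum_le_mx.
Qed.

Lemma lift_sum W : domW W -> has_sum (@Bots n g) ((bterm S l r K)^~ (symW W)) (poincare_lift W).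
Proof.
move=> dW; rewrite /poincare_lift asboolT//.
have [rho r0 [M M0 hM]] := bterm_bound dW.
have [|s hs] := @has_sum_ex _ _ (@Bots n g) ((bterm S l r K)^~ (symW W)) _ _ _ (sum_le_Bots M0).
  move=> b bb; have := hM 0 0 0 b _ _ _ bb.
  rewrite mxR0 scale0r !addr0 nm0 => /(_ _ (@small0 _ _ _) (ltW r0))[]//.
  by move=> i j; rewrite mxE normr0 invr_ge0.
by case: xgetP => // /(_ s).
Qed.

Lemma domW_periodic W (z : 'M[int]_p) : domW (W + mxZ R z) <-> domW W.
Proof. by rewrite mxZ_R /domW/= !ImM_symW ImM_D ImM_mxR addr0. Qed.

Lemma lift_periodic : cperiodic poincare_lift.
Proof.
move=> W z; have [dW|dW] := pselect (domW W); last first.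
  by rewrite /poincare_lift !asboolF// domW_periodic.
have dWz := (domW_periodic W z).2 dW.
have sz : (z + z^T)^T = z + z^T by rewrite mxtrD trmxK addrC.
have := has_sum_bterm_shift hL (symW_siegel dW) sz (lift_sum dW).
have -> : symW W + mxZ R (z + z^T) = symW (W + mxZ R z).
  by rewrite /symW /mxZ map_mxD -map_trmx !trmxD; mx_ring.
exact: has_sum_uniq (lift_sum dWz).
Qed.

Lemma lift_tame : tame_on domW poincare_lift.
Proof.
move=> W dW; have [rho r0 [M M0 hM]] := bterm_bound dW.
exists rho => //; exists (M * 8 ^+ (p * (p + p))) => x U sU.
(* [tame_at] allows every real x, so x is first replaced by x0, in the cube of [bterm_bound]. *)
have [z hz] := round_ex x; set x0 := x + _ in hz.
have Ex s : poincare_lift (W + mxR x + s *: U) = poincare_lift (W + mxR x0 + s *: U).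
  rewrite -(lift_periodic (W + mxR x + s *: U) z) -mxR_int /x0 mxRD.
  by congr poincare_lift; mx_ring.
have hb s b : nm s <= rho -> Bots b -> domW (W + mxR x0 + s *: U) /\
    nm (bterm S l r K b (symW (W + mxR x0 + s *: U))) <= M * \prod_i \prod_j wt R (b i j).
  by move=> sr; exact: hM.
have [B0 hB0] : (@Bots n g) !=set0.
  exists (bot (1%:M, (0, 0, 0))); exists (1%:M, (0, 0, 0)) => //.
  by case: (@Gamma_J_inf1 n g).
have hd s : nm s <= rho -> domW (W + mxR x0 + s *: U).
  by move=> sr; case: (hb s B0 sr hB0).
split; last first.
  move=> s sr; rewrite Ex.
  by apply: (has_sum_le _ (sum_le_Bots M0) (lift_sum (hd s sr))) => b /(hb s b sr)[].
rewrite (_ : (fun s => poincare_lift (W + mxR x + s *: U)) =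
    (fun s => poincare_lift (W + mxR x0 + s *: U))); last first.
  by apply/funext => s; exact: Ex.
(* Finite partial sums, each term being covered by [Ap_pterm], approximate the series uniformly on
   the disc. *)
apply: Ap_lim => eps e0.
have w0 b : Bots b -> 0 <= M * \prod_i \prod_j wt R (b i j).
  move=> _; rewrite mulr_ge0// prodr_ge0// => i _; rewrite prodr_ge0// => j _.
  exact: wt_ge0.
have [F FD hF] := sum_le_tail w0 (sum_le_Bots M0) e0.
exists (fun s => \sum_(b <- F) bterm S l r K b (symW (W + mxR x0 + s *: U))); last first.
  move=> s sr; apply: (has_sum_tail _ FD hF (lift_sum (hd s sr))) => b /(hb s b sr)[].
  by [].
apply: Ap_sum => b /FD bb; have [gx bx] := repP bb.
have Esym s : symW (W + mxR x0 + s *: U) = symW (W + mxR x0) + s *: symW U.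
  by rewrite /symW scalerDr [(_ + s *: U)^T]trmxD trmx_iZ; mx_ring.
apply: (@Ap_ext _ _ (fun s => bterm S l r K b (symW (W + mxR x0) + s *: symW U))).
  by move=> s _; rewrite Esym.
apply: Ap_pterm => // s sr; apply: (autj_unit (jsymp gx)).
by rewrite -Esym; apply: symW_siegel; exact: hd.
Qed.

End PoincareTame.

(** * Schur complements and positivity of block matrices *)

Section Schur.
Variables (R : realType).

Lemma qfZ p (a : R) (A : 'M[R]_p) x : qf (a *: A) x = a * qf A x.
Proof. by rewrite /qf -scalemxAr -scalemxAl mxE. Qed.

Lemma posdefZ p (a : R) (A : 'M[R]_p) : 0 < a -> posdef (a *: A) <-> posdef A.
Proof.
move=> a0; suff h (b : R) (B : 'M[R]_p) : 0 < b -> posdef B -> posdef (b *: B).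
  split=> [hA|]; last exact: h.
  rewrite -[A]scale1r -(mulVf (lt0r_neq0 a0)) -scalerA.
  by apply: h => //; rewrite invr_gt0.
move=> b0 [sB pB]; split; first by rewrite linearZ/= sB.
by move=> x x0; have := qfZ b B x; rewrite /qf => ->; rewrite mulr_gt0// pB.
Qed.

Lemma qf_block n g (A : 'M[R]_n) (B : 'M[R]_(n, g)) (D : 'M[R]_g) x1 x2 :
  posdef D -> qf (block_mx A B B^T D) (row_mx x1 x2) =
    qf (A - B *m invmx D *m B^T) x1 + qf D (x1 *m B *m invmx D + x2).
Proof.
move=> pD; have uD := posdef_unit pD; have [sD _] := pD.
have [sE _] := posdef_inv pD.
rewrite /qf -mxD_E; congr (fun_of_matrix _ 0 0).
rewrite mul_row_block tr_row_mx mul_row_col; mnorm.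
by rewrite sE !(mulKVmx uD) !(mulKmx uD); mx_ring.
Qed.

Lemma posdef_schur n g (A : 'M[R]_n) (B : 'M[R]_(n, g)) (D : 'M[R]_g) : posdef D ->
  posdef (block_mx A B B^T D) <-> posdef (A - B *m invmx D *m B^T).
Proof.
move=> pD; have [sD qD] := pD; have [sE _] := posdef_inv pD; split=> [[sM qM]|[sA qA]].
  move: sM; rewrite tr_block_mx => /eq_block_mx[sA _ _ _].
  split; first by rewrite mxtrB !trmx_mul trmxK sE sA mulmxA.
  move=> x1 x0; have := qM (row_mx x1 (- (x1 *m B *m invmx D))).
  rewrite -/(qf _ _) (qf_block _ _ _ _ pD) subrr [X in _ + X](_ : _ = 0) ?addr0.
    apply; apply: contra_neq x0 => E; rewrite -[x1](row_mxKl _ (- (x1 *m B *m invmx D))) E.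
    by rewrite linear0.
  by rewrite /qf !mul0mx mxE.
have sA' : A^T = A.
  apply/(addIr (- (B *m invmx D *m B^T))); rewrite -[RHS]sA.
  by rewrite mxtrB !trmx_mul trmxK sE mulmxA.
split; first by rewrite tr_block_mx trmxK sA' sD.
move=> x; rewrite -[x]hsubmxK -/(qf _ _) (qf_block _ _ _ _ pD).
set x1 := lsubmx x; set x2 := rsubmx x => x0.
have qD0 v : 0 <= qf D v.
  have [->|/qD/ltW//] := eqVneq v 0.
  by rewrite /qf !mul0mx mxE.
have [E|x10] := eqVneq x1 0; last by rewrite ltr_wpDr// qA.
rewrite E !mul0mx add0r ltr_wpDl//; first by rewrite /qf !mul0mx mxE.
by apply: qD; apply: contra_neq x0 => E2; rewrite E E2 row_mx0.
Qed.

Lemma posdef_ul n g (A : 'M[R]_n) (B : 'M[R]_(n, g)) C (D : 'M[R]_g) :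
  posdef (block_mx A B C D) -> posdef A.
Proof.
move=> [sM qM]; split; first by move: sM; rewrite tr_block_mx => /eq_block_mx[].
move=> x x0; have := qM (row_mx x 0).
rewrite mul_row_block tr_row_mx mul_row_col trmx0 mulmx0 !mul0mx !addr0; apply.
by apply: contra_neq x0 => E; rewrite -[x](row_mxKl _ (0 : 'rV_g)) E linear0.
Qed.

(** [disc] is four times the Schur complement of S in the index matrix. *)
Lemma posdef_index n g (S : 'M[R]_g) (T : 'M[R]_n) r : posdef S ->
  posdef (index_mx S T r) <-> posdef (disc S T r).
Proof.
move=> pS; rewrite /index_mx posdef_schur// -(@posdefZ _ 4)//.
suff -> : 4 *: (T - 2^-1 *: map_mx intr r *m invmx S *m (2^-1 *: map_mx intr r)^T) =
  disc S T r by [].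
rewrite /disc linearZ/= -!scalemxAl -!scalemxAr scalerBr scaler_nat !scalerA.
by have -> : 4 / 2 / 2 = 1 :> R; [field|rewrite scale1r].
Qed.

(** Completes a given (tau, z) by tau2 = i t to a point of the half-space of degree n + g. *)
Lemma posdef_extend n g (Y : 'M[R]_n) (y : 'M[R]_(n, g)) : posdef Y ->
  exists t : R, posdef (block_mx Y y y^T t%:M).
Proof.
move=> pY; have [sY qY] := pY; pose b := 1 + \tr (invmx Y).
have tr0 : 0 <= \tr (invmx Y).
  by have [V _ ->] := posdef_chol (posdef_inv pY); rewrite mxtrace_mulC -fro_tr fro_ge0.
have b0 : 0 < b by rewrite ltr_pwDl.
have f0 := fro_ge0 y.
(* Since fro x < b qf Y x and fro (x y) <= fro x fro y, this t exceeds the ratio of the form of y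
   y^T to that of Y. *)
pose t := b * (1 + fro y); have t0 : 0 < t by rewrite mulr_gt0// ltr_pwDl.
have pt : posdef (t%:M : 'M[R]_g).
  split; first by rewrite tr_scalar_mx.
  move=> x x0; rewrite mul_mx_scalar -scalemxAl mxE mulr_gt0//.
  by have := fro_gt0 x0; rewrite fro_tr /mxtrace big_ord1.
exists t; rewrite posdef_schur// invmx_scalar mul_mx_scalar -scalemxAl.
have sy : (y *m y^T)^T = y *m y^T by rewrite trmx_mul trmxK.
split; first by rewrite mxtrB sY linearZ/= sy.
move=> x x0; rewrite -/(qf _ _) -scaleN1r scalerA qfD qfZ mulN1r mulNr subr_gt0.
have -> : qf (y *m y^T) x = fro (x *m y).
  by rewrite fro_tr /mxtrace big_ord1 trmx_mul /qf !mulmxA.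
have fx := fro_gt0 x0.
have h1 := posdef_qf_ge x pY.
have q0 := qY x x0; rewrite -/(qf _ _) in q0.
have h2 : fro x < b * qf Y x by rewrite mulrDl mul1r ltr_pwDl.
have h3 := fro_mul x y.
rewrite mulrC ltr_pdivrMr//; apply: le_lt_trans h3 _.
rewrite /t mulrA [_ * b]mulrC; apply: (@lt_le_trans _ _ (b * qf Y x * (1 + fro y))) => //.
apply: (@le_lt_trans _ _ (fro x * (1 + fro y))).
  by rewrite ler_wpM2l ?(ltW fx)// lerDr.
by rewrite ltr_pM2r// ltr_pwDl.
Qed.

(** Sylvester's identity, from two triangular factorisations of one bordered matrix M. *)
Lemma det_1D_outer p (x : 'rV[R]_p) (s : R) :
  \det (1%:M + s *: (x^T *m x)) = 1 + s * fro x.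
Proof.
pose M : 'M[R]_(1 + p) := block_mx 1%:M x (- (s *: x^T)) 1%:M.
have E1 : M = block_mx 1%:M 0 (- (s *: x^T)) 1%:M *m block_mx 1%:M x 0 (1%:M + s *: (x^T *m x)).
  rewrite mulmx_block !mul1mx !mul0mx !mulmx1 !addr0 mulNmx -scalemxAl.
  by rewrite [- _ + _]addrC addrK.
have E2 : M = block_mx (1%:M + s *: (x *m x^T)) x 0 1%:M *m block_mx 1%:M 0 (- (s *: x^T)) 1%:M.
  rewrite mulmx_block !mul1mx !mul0mx !mulmx0 !mulmx1 ?add0r mulmxN -scalemxAr.
  by rewrite addrK.
have : \det M = \det M by [].
rewrite {1}E1 E2 !det_mulmx det_lblock !det_ublock !det1 !mul1r !mulr1 => ->.
by rewrite det_mx11 mxE [X in X + _]mxE eqxx [X in _ + X]mxE fro_tr /mxtrace big_ord1.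
Qed.

End Schur.

(** * Index matrices as frequencies *)

Section IndexMatrix.
Variable R : realType.
Local Notation C := R[i].

(* The matrix 2 L, rounded down to integers when L is not half-integral. *)
Definition dbl p (L : 'M[R]_p) : 'M[int]_p := \matrix_(i, j) Num.floor (L i j *+ 2).

Lemma dblE p (L : 'M[R]_p) i j : half_integral L -> ((dbl L) i j)%:~R = L i j *+ 2.
Proof. by move=> [_ _ h]; rewrite mxE floorK. Qed.

Lemma dbl_inj p (L L' : 'M[R]_p) : half_integral L -> half_integral L' ->
  dbl L = dbl L' -> L = L'.
Proof.
move=> hL hL' E; apply/matrixP => i j; apply/eqP.
by rewrite -(eqr_pMn2r (ltn0Sn 1)) -dblE// E dblE.
Qed.

(** W and W^T contribute equally to the trace, so the frequency belonging to L is 2 L. *)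
Lemma dotC_dbl p (L : 'M[R]_p) (W : 'M[C]_p) : half_integral L ->
  dotC (dbl L) W = \tr (mxR L *m symW W).
Proof.
move=> hL; have [sL _ _] := hL.
rewrite /symW mulmxDr mxtraceD.
have -> : \tr (mxR L *m W) = \tr (mxR L *m W^T).
  by rewrite -mxtrace_tr trmx_mul -mxR_tr sL mxtrace_mulC.
rewrite -mulr2n /dotC /mxtrace -sumrMnl; apply: eq_bigr => i _.
rewrite mxE -sumrMnl; apply: eq_bigr => j _; rewrite !mxE.
rewrite -(rmorph_int (real_complex R)) floorK ?rmorphMn ?mulrnAl//.
by case: hL.
Qed.

Lemma chi_dbl p (L : 'M[R]_p) (W : 'M[C]_p) : half_integral L ->
  chi (dbl L) W = e (\tr (mxR L *m symW W)).
Proof. by move=> hL; rewrite /chi dotC_dbl. Qed.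

Lemma Lambda_half p (L : 'M[R]_p) : Lambda_pos L -> half_integral L.
Proof. by move=> [[sL _] h1 h2]; split. Qed.

Variables (n g : nat) (S : 'M[R]_g).
Implicit Types (T : 'M[R]_n) (r : 'M[int]_(n, g)).

Lemma half_integral_index T r : half_integral S -> half_integral T ->
  half_integral (index_mx S T r).
Proof.
move=> [sS dS oS] [sT dT oT]; split.
- by rewrite tr_block_mx trmxK sS sT.
- move=> i; rewrite -(splitK i); case: (fintype.split i) => k /=.
    by rewrite block_mxEul.
  by rewrite block_mxEdr.
- have hr i j : (2^-1 *: map_mx intr r : 'M[R]_(n, g)) i j *+ 2 \is a Num.int.
    by rewrite !mxE -(mulr_natl (2^-1 * _)) mulrA divff// mul1r intr_int.
  move=> i j; rewrite -(splitK i) -(splitK j).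
  case: (fintype.split i) => k; case: (fintype.split j) => k' /=.
  - by rewrite block_mxEul.
  - by rewrite block_mxEur.
  - by rewrite block_mxEdl mxE.
  - by rewrite block_mxEdr.
Qed.

Lemma index_mx_inj T T' r r' : index_mx S T r = index_mx S T' r' -> (T, r) = (T', r').
Proof.
move=> /eq_block_mx[-> h _ _]; congr pair; apply/matrixP => i j.
move/matrixP/(_ i j): h; rewrite !mxE => /(mulfI _) h.
by apply/eqP; rewrite -(eqr_int R); apply/eqP/h; rewrite invr_neq0.
Qed.

Lemma e_index_block T r (tau : 'M[C]_n) (z : 'M[C]_(g, n)) (tau2 : 'M[C]_g) :
  e (\tr (mxR (index_mx S T r) *m block_mx tau z^T z tau2)) =
  expTR T r tau z * e (\tr (mxR S *m tau2)).
Proof. by rewrite tr_index_block eD. Qed.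

End IndexMatrix.

(** * Tests that determine the entries of a frequency *)

Section CharacterTests.
Variable R : realType.
Local Notation C := R[i].

(** For x <> 0, the choice t = 1 / (2 x) gives e(1/2) = -1. *)
Lemma e_line_eq1 (x : R) : (forall t : R, e (x * t)%:C = 1) -> x = 0.
Proof.
move=> h; apply/eqP/negPn/negP => x0; have := h ((2 * x)^-1).
rewrite invfM mulrCA divff// mulr1 fmorphV rmorph_nat e_half => /eqP.
by rewrite eqNr oner_eq0.
Qed.

Lemma e_half_int (k : int) : e (k%:~R / 2 : C) = 1 -> (k%:~R / 2 : R) \is a Num.int.
Proof.
have [j [->|->]] : exists j : int, k = j * 2 \/ k = j * 2 + 1.
  exists (k %/ 2)%Z; have := divz_eq k 2.
  have : (0 <= k %% 2)%Z by rewrite modz_ge0.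
  have : ((k %% 2)%Z < 2) by rewrite ltz_pmod.
  lia.
- by move=> _; rewrite rmorphM/= mulfK// intr_int.
- rewrite rmorphD rmorphM/= mulrDl mulfK// mul1r eD e_int e_half mul1r => /eqP.
  by rewrite eqNr oner_eq0.
Qed.

Lemma chi_line p q (a : 'M[int]_(p, q)) i j (t : R) :
  chi a (mxR (t *: delta_mx i j)) = e ((a i j)%:~R * t)%:C.
Proof.
rewrite /chi dotC_real (bigD1 i)//= (bigD1 j)//= big1 ?addr0 => [|j' hj]; last first.
  by rewrite !mxE (negbTE hj) andbF !mulr0.
rewrite big1 ?addr0 => [|i' hi]; last first.
  by rewrite big1// => j' _; rewrite !mxE (negbTE hi) !mulr0.
by rewrite !mxE !eqxx mulr1.
Qed.

Lemma Im_tr_mxR p (L : 'M[R]_p) (Z : 'M[C]_p) :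
  complex.Im (\tr (mxR L *m Z)) = \tr (L *m ImM_ Z).
Proof.
rewrite /mxtrace Im_sum; apply: eq_bigr => i _.
rewrite !mxE Im_sum; apply: eq_bigr => j _; rewrite !mxE.
by rewrite ImM/= mul0r addr0.
Qed.

Lemma nm_chi_dbl p (L : 'M[R]_p) (W : 'M[C]_p) : half_integral L ->
  nm (chi (dbl L) W) = expR (- (2 * pi * \tr (L *m ImM_ (symW W)))).
Proof. by move=> hL; rewrite chi_dbl// nm_e Im_tr_mxR. Qed.

End CharacterTests.

(** As M > N, the powers of u leave at least one factor 1 / u, which is moved to the left side. *)
Lemma real_decay (R : realType) (a u G c H x y : R) (N M : nat) : 1 <= u -> (N < M)%N ->
  0 <= G -> 0 <= c -> 0 <= H -> 0 <= x ->
  a <= u ^- M * G * (c ^+ N * u ^+ N) * H * x -> x <= y ->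
  a * u <= G * c ^+ N * H * y.
Proof.
move=> u1 NM G0 c0 H0 x0 ha xy; have u0 : 0 < u := lt_le_trans ltr01 u1.
have hu : u ^- M * u ^+ N.+1 <= 1.
  by rewrite mulrC ler_pdivrMr ?exprn_gt0// mul1r ler_weXn2l.
have D0 : 0 <= G * c ^+ N * H * x by rewrite !mulr_ge0 ?exprn_ge0.
apply: (@le_trans _ _ (G * c ^+ N * H * x)); last first.
  by rewrite ler_wpM2l// !mulr_ge0 ?exprn_ge0.
apply: le_trans (ler_wpM2r (ltW u0) ha) _; apply: le_trans (ler_piMr D0 hu).
rewrite exprS le_eqVlt; apply/orP; left; apply/eqP.
by move: (u ^- M) (u ^+ N) (c ^+ N) => v w d; ring.
Qed.

(** * Existence and uniqueness of the Fourier expansion of the Poincare series *)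

Section PoincareFourier.
Variables (R : realType) (n g : nat) (S : 'M[R]_g) (l : 'M[R]_n)
  (r : 'M[int]_(n, g)) (K : nat).
Local Notation C := R[i].
Local Notation p := (n + g)%N.
Local Notation L := (index_mx S l r).
Local Notation poincare_lift := (poincare_lift S l r K).
Hypotheses (n0 : (0 < n)%N) (pS : posdef S) (hS : half_integral S)
  (hl : half_integral l) (pL : posdef L) (NK : (NL n g < K)%N).
Implicit Types (W : 'M[C]_p) (q : 'M[int]_p).

Let hL : half_integral L. Proof. exact: half_integral_index. Qed.
Let PFs W (dW : domW W) := lift_sum n0 pL (ltnW NK) dW.
Let PFp := lift_periodic n0 pL hL (ltnW NK).
Let PFt := lift_tame n0 pL hL (ltnW NK).
Let domT := @tame_domain_W R n g n0.

Lemma domW_iR (Y : 'M[R]_p) : posdef Y -> domW (iR Y).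
Proof.
move=> pY; have [sY _] := pY; rewrite /domW /mkset ImM_symW ImM_iR sY.
by rewrite -mulr2n -scaler_nat; apply/posdefZ.
Qed.

Lemma lift_poincare W : domW W ->
  poincare_lift W = e (\tr (mxR S *m drsubmx (symW W))) *
    poincare K.*2 S l r (ulsubmx (symW W)) (dlsubmx (symW W)).
Proof.
move=> dW; have hs := PFs dW; have hZ := symW_siegel dW.
have EZ : symW W = block_mx (ulsubmx (symW W)) (dlsubmx (symW W))^T
    (dlsubmx (symW W)) (drsubmx (symW W)).
  by rewrite trmx_dlsub hZ.1 submxK.
rewrite [in X in has_sum _ X _]EZ in hs; rewrite EZ in hZ.
have sS : S^T = S by case: hS.
have hc := has_sum_cosets sS hL hZ hs.
rewrite /poincare; case: xgetP => [s _ hs'|]; last by move/(_ _ hc).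
by rewrite (has_sum_uniq hs' hc) mulVKf// e_neq0.
Qed.

Lemma symW_mxR W (u : 'M[R]_p) : symW (W + mxR u) = symW W + mxR (u + u^T).
Proof. by rewrite /symW mxRD mxR_tr trmxD; mx_ring. Qed.

Lemma domW_real W (u : 'M[R]_p) : domW W -> domW (W + mxR u).
Proof. exact: (dom_real domT). Qed.

Lemma lift_symW W W' : domW W -> symW W' = symW W -> poincare_lift W' = poincare_lift W.
Proof.
move=> dW E; have dW' : domW W' by rewrite /domW /mkset E.
by rewrite (lift_poincare dW) (lift_poincare dW') E.
Qed.

Lemma lift_lr W (U : 'M[R]_g) : domW W ->
  poincare_lift (W + mxR (block_mx 0 0 0 U)) = e (\tr (S *m (U + U^T)))%:C * poincare_lift W.
Proof.
move=> dW; rewrite (lift_poincare dW) (lift_poincare (domW_real _ dW)).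
have -> : symW (W + mxR (block_mx 0 0 0 U)) = block_mx (ulsubmx (symW W))
    (ursubmx (symW W)) (dlsubmx (symW W)) (drsubmx (symW W) + mxR (U + U^T)).
  have E0 a b : mxR (0 : 'M[R]_(a, b)) = 0 by exact: mxR0.
  rewrite symW_mxR tr_block_mx !trmx0 add_block_mx !addr0 mxR_block !E0.
  by rewrite -[X in X + _]submxK add_block_mx !addr0.
rewrite block_mxKul block_mxKdl block_mxKdr.
rewrite mulmxDr mxtraceD eD -mxRM tr_mxR mulrA; congr (_ * _).
by rewrite mulrC.
Qed.

(** An antisymmetric real translation of W does not move [symW W]. *)
Lemma coef_sym q W i j : domW W -> coef poincare_lift q W != 0 -> q i j = q j i.
Proof.
move=> dW a0; apply/eqP; rewrite -(eqr_int R) -subr_eq0; apply/eqP.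
apply: e_line_eq1 => t.
have h V : domW V -> poincare_lift (V + mxR (t *: delta_mx i j - t *: delta_mx j i)) = 1 * poincare_lift V.
  move=> dV; rewrite mul1r; apply: lift_symW => //.
  rewrite symW_mxR.
  suff -> : t *: delta_mx i j - t *: delta_mx j i +
     (t *: delta_mx i j - t *: delta_mx j i)^T = 0 :> 'M[R]_p by rewrite mxR0 addr0.
  rewrite mxtrB; have E a b : (t *: delta_mx a b : 'M[R]_p)^T = t *: delta_mx b a.
    by rewrite linearZ/= trmx_delta.
  by rewrite !E; mx_ring.
have := coef_translate q domT PFt PFp dW h.
move/(mulIf a0); rewrite mxRD chi_add -scaleNr !chi_line -eD -rmorphD/= => <-.
by congr (e _%:C); ring.
Qed.

(** Half a step in a diagonal entry of W is a full integral step of [symW W]. *)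
Lemma coef_diag q W i : domW W -> coef poincare_lift q W != 0 ->
  ((q i i)%:~R / 2 : R) \is a Num.int.
Proof.
move=> dW a0; apply: e_half_int.
have h V : domW V -> poincare_lift (V + mxR (2^-1 *: delta_mx i i)) = 1 * poincare_lift V.
  move=> dV; rewrite mul1r.
  have dV' := domW_real (2^-1 *: delta_mx i i) dV.
  have E : symW (V + mxR (2^-1 *: delta_mx i i)) = symW V + mxZ R (delta_mx i i).
    rewrite symW_mxR linearZ/= trmx_delta -scalerDl (_ : 2^-1 + 2^-1 = 1); last by field.
    rewrite scale1r mxZ_R; congr (_ + mxR _).
    by apply/matrixP => a b; rewrite !mxE; case: (_ && _).
  apply: (has_sum_uniq (PFs dV')); rewrite E.
  apply: has_sum_bterm_shift (PFs dV) => //; first exact: symW_siegel.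
  by rewrite trmx_delta.
have := coef_translate q domT PFt PFp dW h.
move/(mulIf a0); rewrite chi_line rmorphM/= fmorphV rmorph_nat => h1.
by rewrite -[RHS]h1 rmorph_int.
Qed.

(** A real translation of the lower right block only changes the factor e(tr(S tau2)), by
    [lift_lr]. *)
Lemma coef_lr q W i j : domW W -> coef poincare_lift q W != 0 ->
  (q (rshift n i) (rshift n j))%:~R = S i j *+ 2.
Proof.
move=> dW a0; apply/eqP; rewrite -subr_eq0; apply/eqP; apply: e_line_eq1 => t.
pose u : 'M[R]_p := t *: delta_mx (rshift n i) (rshift n j).
have Eu : u = block_mx 0 0 0 (t *: delta_mx i j).
  apply/matrixP => a b; rewrite -(splitK a) -(splitK b).
  case: (fintype.split a) => k; case: (fintype.split b) => k' /=.
  - by rewrite block_mxEul !mxE eq_lrshift mulr0.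
  - by rewrite block_mxEur !mxE eq_lrshift mulr0.
  - by rewrite block_mxEdl !mxE eq_lrshift andbF mulr0.
  - by rewrite block_mxEdr !mxE !eq_rshift.
have h V : domW V -> poincare_lift (V + mxR u) = e ((S i j *+ 2) * t)%:C * poincare_lift V.
  move=> dV; rewrite Eu lift_lr//; congr (e _%:C * _).
  have Etr a b (s : R) : \tr (S *m (s *: delta_mx a b)) = s * S b a.
    rewrite -scalemxAr mxtraceZ; congr (_ * _).
    rewrite /mxtrace (bigD1 b)//= big1 ?addr0 => [|k hk].
      rewrite mxE (bigD1 a)//= big1 ?addr0 ?mxE ?eqxx ?mulr1// => k hk.
      by rewrite !mxE (negbTE hk) mulr0.
    by rewrite mxE big1// => k' _; rewrite !mxE (negbTE hk) andbF mulr0.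
  rewrite linearZ/= trmx_delta mulmxDr mxtraceD !Etr.
  have -> : S j i = S i j by case: hS => sS _ _; rewrite -[in LHS]sS mxE.
  by rewrite mulr2n; ring.
have := coef_translate q domT PFt PFp dW h.
move/(mulIf a0); rewrite chi_line mulrBl rmorphB eB => ->.
by rewrite divff// e_neq0.
Qed.

(** The upper blocks of q define T and s; [coef_sym] and [coef_diag] make T half-integral,
    [coef_sym] and [coef_lr] fix the lower blocks. *)
Lemma coef_index q W : domW W -> coef poincare_lift q W != 0 ->
  exists T s, half_integral T /\ q = dbl (index_mx S T s).
Proof.
move=> dW a0; have sq i j := coef_sym i j dW a0.
pose T : 'M[R]_n := 2^-1 *: map_mx intr (ulsubmx q).
have T2 i j : T i j *+ 2 = (ulsubmx q i j)%:~R.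
  by rewrite [T i j]mxE -(mulr_natl (2^-1 * _)) mulrA divff// mul1r mxE.
have hT : half_integral T.
  split.
  - by apply/matrixP => i j; rewrite !mxE sq.
  - by move=> i; have := coef_diag (lshift g i) dW a0; rewrite !mxE mulrC.
  - by move=> i j; rewrite T2 intr_int.
exists T, (ursubmx q); split=> //; apply/matrixP => i j; apply/eqP; rewrite -(eqr_int R).
rewrite (dblE _ _ (half_integral_index _ hS hT)) -{1}[q]submxK.
have E2 a b : (2^-1 *: map_mx intr (ursubmx q) : 'M[R]_(n, g)) a b *+ 2 = (ursubmx q a b)%:~R.
  by rewrite mxE -(mulr_natl (2^-1 * _)) mulrA divff// mul1r mxE.
rewrite -(splitK i) -(splitK j).
case: (fintype.split i) => k; case: (fintype.split j) => k' /=.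
- by rewrite !block_mxEul T2.
- by rewrite !block_mxEur E2.
- by rewrite !block_mxEdl [in X in _ == X *+ _]mxE E2 !mxE sq.
- by rewrite !block_mxEdr [drsubmx q _ _]mxE [dsubmx q _ _]mxE (coef_lr _ _ dW a0).
Qed.

Lemma lift_le W (sigma eta : R) : domW W -> (forall i j, `|ReM_ W i j| <= 2^-1) ->
  0 < eta -> \tr (ImM_ (symW W)) <= sigma ->
  (forall v : 'rV_p, eta * fro v <= qf (ImM_ (symW W)) v) ->
  nm (poincare_lift W) <= (\det (ImM_ (symW W))) ^- K * Gbound L K (NL n g) *
    (kappa sigma eta (p * p)%:R) ^- (NL n g) * 8 ^+ NL n g.
Proof.
move=> dW hx e0 hs he; have p0 : (0 < p)%N by rewrite addn_gt0 n0.
have s0 : 0 < sigma by apply: lt_le_trans hs; apply: posdef_tr_gt0.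
have hb : 0 <= (p * p)%:R :> R by [].
have hf : fro (ReM_ (symW W)) <= (p * p)%:R.
  rewrite -[leRHS]mulr1 -sum_mn ler_sum// => i _; rewrite ler_sum// => j _.
  rewrite -[_ ^+ 2]real_normK ?num_real// expr_le1// ReM_D mxE.
  rewrite (le_trans (ler_normD _ _))//; have := hx i j; have := hx j i.
  by rewrite !mxE; lra.
apply: has_sum_le (PFs dW).
  move=> b bb; apply: (bterm_le n0 pL (ltnW NK) bb (symW_siegel dW) erefl e0 hb hs he hf).
apply: (@sum_le_Bots R n g (_ ^- _ * _ * _ ^- _)).
apply: mulr_ge0; last first.
  rewrite invr_ge0 exprn_ge0// divr_ge0//.
    by rewrite le_min ?invr_ge0 (ltW s0) (ltW e0).
rewrite mulr_ge0 ?Gbound_ge0//.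
by rewrite invr_ge0 exprn_ge0// ltW// posdef_det.
Qed.

(* The coefficient is estimated at imaginary part Y = 1 + s x^T x: there
   u = det Y = 1 + s |x|^2 is unbounded, while tr (L' Y) is bounded above. *)
Lemma coef_decay (L' : 'M[R]_p) (x : 'rV[R]_p) W : half_integral L' -> domW W ->
  x != 0 -> qf L' x <= 0 -> exists2 D : R, 0 <= D &
  forall u : R, 1 <= u -> nm (coef poincare_lift (dbl L') W) * u <= D.
Proof.
move=> hL' dW x0 hx; have p0 : (0 < p)%N by rewrite addn_gt0 n0.
have f0 := fro_gt0 x0; set f := fro x in f0.
pose c0 : R := 2 * (3 + 2 * (p * p)%:R).
have c00 : 0 < c0 by rewrite mulr_gt0// ltr_pwDl// mulr_ge0.
have pR : 1 <= p%:R :> R by rewrite ler1n.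
pose D := Gbound L K (NL n g) * (p%:R * c0) ^+ NL n g * 8 ^+ NL n g * expR (2 * pi * \tr L').
have D0 : 0 <= D.
  rewrite mulr_ge0 ?expR_ge0// mulr_ge0 ?exprn_ge0// mulr_ge0 ?Gbound_ge0//.
  by rewrite exprn_ge0// mulr_ge0 ?(ltW c00).
exists D => // u u1; have u0 : 0 < u by exact: lt_le_trans u1.
pose s := (u - 1) / f; have s0 : 0 <= s by rewrite divr_ge0 ?(ltW f0)// subr_ge0.
have sf : s * f = u - 1 by rewrite /s divfK// gt_eqF.
pose Y : 'M[R]_p := 1%:M + s *: (x^T *m x).
have sY : Y^T = Y by rewrite /Y mxtrD tr_scalar_mx linearZ/= trmx_mul trmxK.
have qY v : 1 * fro v <= qf Y v.
  rewrite /Y qfD qfZ mul1r; have -> : qf (x^T *m x) v = fro (v *m x^T).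
    by rewrite fro_tr /mxtrace big_ord1 trmx_mul trmxK /qf !mulmxA.
  have -> : qf 1%:M v = fro v by rewrite /qf mulmx1 fro_tr /mxtrace big_ord1.
  by rewrite lerDl mulr_ge0// fro_ge0.
have pY := qf_gt0_posdef sY ltr01 qY.
have trY (A : 'M[R]_p) : \tr (A *m Y) = \tr A + s * qf A x.
  rewrite /Y mulmxDr mulmx1 mxtraceD -scalemxAr mxtraceZ; congr (_ + _ * _).
  by rewrite mulmxA mxtrace_mulC mulmxA /mxtrace big_ord1.
(* Half of Y, as [symW] doubles the imaginary part. *)
pose V : 'M[C]_p := iR (2^-1 *: Y).
have dV : domW V by apply: domW_iR; rewrite posdefZ// invr_gt0.
have EV : ImM_ (symW V) = Y.
  rewrite ImM_symW ImM_iR linearZ/= sY -scalerDl (_ : 2^-1 + 2^-1 = 1) ?scale1r//.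
  by field.
have hs : \tr (ImM_ (symW V)) <= p%:R * u.
  rewrite EV -[Y]mul1mx trY mxtrace1.
  have -> : qf 1%:M x = f by rewrite /qf mulmx1 /f fro_tr /mxtrace big_ord1.
  rewrite sf -lerBrDl -{2}[p%:R]mulr1 -mulrBr ler_peMl// subr_ge0//.
have hPF y : nm (poincare_lift (V + mxR y)) <= u ^- K * Gbound L K (NL n g) *
    (kappa (p%:R * u) 1 (p * p)%:R) ^- (NL n g) * 8 ^+ NL n g.
  have [z hz] := round_ex y.
  have -> : poincare_lift (V + mxR y) = poincare_lift (V + mxR (y + map_mx intr z)).
    by rewrite mxRD mxR_int addrA PFp.
  have dV' := domW_real (y + map_mx intr z) dV.
  have E' : ImM_ (symW (V + mxR (y + map_mx intr z))) = Y.
    by rewrite symW_mxR ImM_D ImM_mxR addr0.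
  have Eu : u = \det (ImM_ (symW (V + mxR (y + map_mx intr z)))).
    by rewrite E' det_1D_outer -/f sf addrC subrK.
  rewrite {1}Eu; apply: lift_le => //; rewrite ?E' -?EV//; last by rewrite EV.
  move=> i j; rewrite ReM_D (_ : ReM_ V = 0) ?add0r.
    by rewrite mxE; have := hz i j; rewrite !mxE.
  by apply/matrixP => a b; rewrite !mxE ReM/= mulr0 mul0r subr0.
have ha : coef poincare_lift (dbl L') W = coef poincare_lift (dbl L') V.
  exact: (coef_indep _ domT PFt PFp).
rewrite ha; have := nm_coef_le (dbl L') hPF.
rewrite nm_chi_dbl// EV -expRN opprK => hc.
have hE : expR (2 * pi * \tr (L' *m Y)) <= expR (2 * pi * \tr L').
  rewrite ler_expR ler_pM2l ?mulr_gt0 ?pi_gt0// trY gerDl mulr_ge0_le0//.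
(* Here [kappa] is of order 1 / u, so the bound grows by u^NL, while the determinant contributes
   u^(-K) with K > NL. *)
have hk : kappa (p%:R * u) 1 (p * p)%:R = (p%:R * c0 * u)^-1.
  rewrite /kappa -/c0 min_l; last first.
    by rewrite invf_le1 ?mulr_gt0 ?(lt_le_trans ltr01 pR)// mulr_ege1.
  by rewrite -invfM mulrAC.
rewrite hk -[_^-1 ^- _]exprVn invrK exprMn in hc.
apply: real_decay u1 NK _ _ _ (expR_ge0 _) hc hE; first exact: Gbound_ge0.
  by rewrite mulr_ge0 ?(ltW c00).
exact: exprn_ge0.
Qed.

Lemma coef_posdef (L' : 'M[R]_p) W : half_integral L' -> domW W ->
  coef poincare_lift (dbl L') W != 0 -> posdef L'.
Proof.
move=> hL' dW a0; apply: contrapT => npd.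
have [x x0 hx] : exists2 x, x != 0 & qf L' x <= 0.
  apply: contrapT => nex; apply: npd; split; first by case: hL'.
  move=> x x0; rewrite ltNge; apply/negP => h; apply: nex; exists x => //.
have [D D0 hD] := coef_decay hL' dW x0 hx.
have n1 : 0 < nm (coef poincare_lift (dbl L') W) by rewrite nm_gt0.
set a := nm _ in hD n1.
(* With u = 1 + D / a the bound reads a + D <= D. *)
have := hD (1 + D / a); rewrite lerDl divr_ge0 ?(ltW n1)// => /(_ isT).
by rewrite mulrDr mulr1 mulrC divfK ?gt_eqF// gerDr leNgt n1.
Qed.

Let idx (u : 'M[R]_n * 'M[int]_(n, g)) : 'M[int]_p := dbl (index_mx S u.1 u.2).

Lemma idx_half (u : 'M[R]_n * 'M[int]_(n, g)) : Lambda_pos u.1 -> half_integral (index_mx S u.1 u.2).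
Proof. by move=> /Lambda_half; exact: half_integral_index. Qed.

Lemma idx_inj u v : Lambda_pos u.1 -> Lambda_pos v.1 -> idx u = idx v -> u = v.
Proof.
case: u v => [u1 u2] [v1 v2] hu hv E; apply: (@index_mx_inj _ _ _ S).
by apply: dbl_inj E; exact: idx_half.
Qed.

(** A positive index matrix has a positive upper left block and, by [posdef_index], a positive
    [disc]. *)
Lemma coef_cusp q W : domW W -> coef poincare_lift q W != 0 ->
  exists2 u, cusp_index S u & q = idx u.
Proof.
move=> dW a0; have [T [s [hT Eq]]] := coef_index dW a0.
have hi := half_integral_index s hS hT.
rewrite Eq in a0; have pi_ := coef_posdef hi dW a0.
exists (T, s) => //; split=> /=; last by rewrite -posdef_index.
by case: hT => sT dT oT; split=> //; apply: posdef_ul pi_.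
Qed.

Lemma chi_idx u W : Lambda_pos u.1 -> chi (idx u) W =
  expTR u.1 u.2 (ulsubmx (symW W)) (dlsubmx (symW W)) * e (\tr (mxR S *m drsubmx (symW W))).
Proof.
move=> hu; rewrite chi_dbl; last exact: idx_half.
rewrite -e_index_block; congr (e (\tr (_ *m _))).
rewrite trmx_dlsub (_ : (symW W)^T = symW W) ?submxK//.
by rewrite /symW trmxD trmxK addrC.
Qed.

(** Expand the lift at half of a point Z over (tau, z), drop the frequencies excluded by
    [coef_cusp], and divide by the factor belonging to tau2. *)
Lemma poincare_expansion W : domW W -> fourier_expansion S (poincare K.*2 S l r)
  (fun u => if `[< cusp_index S u >] then coef poincare_lift (idx u) W else 0).
Proof.
move=> dW; split=> [u hu|tau z [st pt]]; first by rewrite asboolF.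
have [t ht] := posdef_extend (ImM_ z)^T pt.
pose Z := block_mx tau z^T z (iR t%:M).
have sZ : Z^T = Z by rewrite tr_block_mx trmxK st trmx_iZ -mxR_tr tr_scalar_mx.
have EZ : symW (2^-1 *: Z) = Z.
  rewrite /symW trmx_iZ sZ -scalerDl (_ : 2^-1 + 2^-1 = 1) ?scale1r//.
  by field.
have dV : domW (2^-1 *: Z).
  rewrite /domW /mkset EZ /Z /ImM_ map_block_mx -/(ImM_ _) -/(ImM_ z) -/(ImM_ (iR _)).
  by rewrite ImM_iR; move: ht; rewrite trmxK map_trmx.
have hs := fourier_tame domT PFt PFp dW dV.
have hs1 : has_sum (idx @` cusp_index S)
    (fun q => coef poincare_lift q W * chi q (2^-1 *: Z)) (poincare_lift (2^-1 *: Z)).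
  apply/(@has_sum_sub _ _ _ setT) => // q _ hq.
  have [->|a0] := eqVneq (coef poincare_lift q W) 0; first by rewrite mul0r.
  by exfalso; apply: hq; have [u hu ->] := coef_cusp dW a0; exists u.
have bij : set_bij (cusp_index S) (idx @` cusp_index S) idx.
  split=> [u hu|u v /set_mem[hu _] /set_mem[hv _]|q [u hu <-]].
  - by exists u.
  - exact: idx_inj.
  - by exists u.
have := has_sumZ (e (\tr (mxR S *m iR t%:M)))^-1 (proj2 (has_sum_reindex _ _ bij) hs1).
rewrite lift_poincare// EZ block_mxKul block_mxKdl block_mxKdr mulKf ?e_neq0//.
apply: eq_has_sum => u hu; rewrite asboolT//= chi_idx; last by case: hu.
rewrite EZ block_mxKul block_mxKdl block_mxKdr.
by rewrite mulrCA [_^-1 * _]mulrC mulfK ?e_neq0.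
Qed.

(** Any expansion converges absolutely, so its mean against the character of - q is taken term by
    term and isolates c (T, s). *)
Lemma expansion_coef c T s W : fourier_expansion S (poincare K.*2 S l r) c ->
  Lambda_pos T -> domW W -> c (T, s) = coef poincare_lift (idx (T, s)) W.
Proof.
move=> [c0 hc] hT dW; set q := idx (T, s).
have hx x : has_sum (cusp_index S) (fun u => c u * chi (idx u) (W + mxR x)) (poincare_lift (W + mxR x)).
  have dV := domW_real x dW; rewrite lift_poincare//.
  have st : siegel (ulsubmx (symW (W + mxR x))).
    have [sZ pZ] := symW_siegel dV; split; first by rewrite trmx_ulsub sZ.
    by apply: (@posdef_ul _ _ _ _ (ImM_ (ursubmx (symW (W + mxR x)))) (ImM_ (dlsubmx (symW (W + mxR x))))
      (ImM_ (drsubmx (symW (W + mxR x))))); rewrite -map_block_mx submxK.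
  apply: eq_has_sum (has_sumZ (e (\tr (mxR S *m drsubmx (symW (W + mxR x))))) (hc _ _ st)).
  by move=> u [hu _]; rewrite chi_idx// mulrCA [X in _ * X]mulrC.
have [B hB] := has_sum_abs (hx 0).
pose F u x := c u * chi (idx u) (W + mxR x) * chi (- q) (W + mxR x).
have Fb u x : nm (F u x) <= nm (chi (- q) W) * nm (c u * chi (idx u) (W + mxR 0)).
  rewrite /F (nmM (_ * _)) (nmM (c u) (chi (idx u) (W + mxR x))).
  rewrite (nmM (c u) (chi (idx u) (W + mxR 0))) (nm_chi_shift (- q) W x).
  by rewrite (nm_chi_shift (idx u) W x) (nm_chi_shift (idx u) W 0) mulrC.
have hm : has_sum (cusp_index S) (fun u => mean (F u)) (coef poincare_lift q W).
  apply: (mean_has_sum (fun u x _ => Fb u x) (sum_leZ (nm_ge0 _) hB)) => x.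
  rewrite mulrC; apply: eq_has_sum (has_sumZ _ (hx x)) => u _.
  by rewrite /F mulrC.
have mF u : mean (F u) = c u * (idx u == q)%:R.
  have h1 (x : 'M[R]_p) : nm (chi (idx u - q) (mxR x)) <= 1 by rewrite nm_chi_real.
  transitivity (c u * chi (idx u - q) W * mean (fun x => chi (idx u - q) (mxR x))).
    rewrite -(meanZ _ h1); apply: eq_mean => x.
    by rewrite /F -[RHS]mulrA -chi_add chiD mulrA.
  rewrite mean_chi subr_eq0; have [->|_] := eqVneq; last by rewrite !mulr0.
  by congr (_ * _); rewrite (_ : chi (q - q) W = 1) ?mulr1// subrr chi0.
have hm1 : has_sum [set` [fset (T, s)]%fset] (fun u => mean (F u)) (coef poincare_lift q W).
  apply/(@has_sum_sub _ _ _ setT) => //.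
    move=> u _ /= hu; rewrite mF; case: eqP => [E|]; last by rewrite mulr0.
    have [[hu1 hu2]|/c0 ->] := pselect (cusp_index S u); last by rewrite mul0r.
    by exfalso; apply: hu; rewrite inE (idx_inj hu1 _ E)//= eqxx.
  apply/(@has_sum_sub _ _ (cusp_index S)) => // u _ hu.
  by rewrite mF c0// mul0r.
have := has_sum_uniq hm1 (has_sum_fset _ _).
by rewrite big_seq_fset1 mF eqxx mulr1.
Qed.

(** [xget] finds an expansion by [poincare_expansion]; whichever it returns, [expansion_coef] gives
    its value. *)
Lemma fourier_coefE T s W : Lambda_pos T -> domW W ->
  fourier_coef S (poincare K.*2 S l r) T s = coef poincare_lift (dbl (index_mx S T s)) W.
Proof.
move=> hT dW; rewrite /fourier_coef; case: xgetP => [c _ hc|h]; first exact: expansion_coef.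
by have := h _ (poincare_expansion dW).
Qed.

End PoincareFourier.

(** * The terms with C = 0 *)

Section Translations.
Variables (R : realType) (n g : nat) (S : 'M[R]_g) (l : 'M[R]_n)
  (r : 'M[int]_(n, g)) (K : nat).
Local Notation C := R[i].
Local Notation p := (n + g)%N.
Local Notation L := (index_mx S l r).
Implicit Types (x : jacobi n g) (u : 'M[int]_n * 'M[int]_(g, n)) (b : 'M[int]_(p, p + p)).

Definition congr_int (B : 'M[int]_p) : 'M[R]_p := (map_mx intr B)^T *m L *m map_mx intr B.

(** A diagonal entry is tr(L v v^T) for an integral column v of B, so [half_integral_tr] applies. *)
Lemma half_integral_congr (B : 'M[int]_p) : half_integral L -> half_integral (congr_int B).
Proof.
move=> hL; have [sL dL oL] := hL; split.
- by rewrite /congr_int !trmx_mul trmxK sL mulmxA.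
- move=> i; pose v := col i B.
  have -> : congr_int B i i = \tr (L *m map_mx intr (v *m v^T)).
    rewrite map_mxM mulmxA mxtrace_mulC mulmxA /mxtrace big_ord1.
    rewrite /congr_int !mxE; apply: eq_bigr => k _; rewrite !mxE; congr (_ * _).
    by apply: eq_bigr => j _; rewrite !mxE.
  by apply: half_integral_tr => //; rewrite trmx_mul trmxK.
- move=> i j; rewrite mxE -sumrMnl rpred_sum// => k _; rewrite -mulrnAl mxE -sumrMnl.
  rewrite rpredM ?mxE ?intr_int// rpred_sum// => k' _.
  by rewrite -mulrnAr rpredM// !mxE intr_int.
Qed.

(** Here the even weight enters: D is unimodular, so its determinant is 1 or -1. *)
Lemma det_int_sqr (A D : 'M[int]_p) : A^T *m D = 1%:M -> (\det (mxZ R D)) ^+ (2 * K) = 1.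
Proof.
move=> /(congr1 determinant); rewrite det_mulmx det_tr det1 => E.
have hd : \det D = 1 \/ \det D = -1.
  have : (`|\det A| * `|\det D|)%N = 1%N by rewrite -abszM E.
  by move/eqP; rewrite muln_eq1 => /andP[_ /eqP]; lia.
rewrite /mxZ det_map_mx exprM -rmorphXn/=.
have -> : \det D ^+ 2 = 1 by case: hd => ->.
exact: expr1n.
Qed.

(** With C = 0 the image is A Z A^T + B A^T, and B A^T is symmetric and integral, hence invisible to
    the character. *)
Lemma jterm_jC0 x (Z : 'M[C]_p) : half_integral L -> Gamma_J x -> jC x = 0 ->
  jterm S l r K x Z = e (\tr (mxR (congr_int (jA x)) *m Z)).
Proof.
move=> hL gx c0; have sy := jsymp gx; rewrite /jterm /pterm /mobius.
move: sy; rewrite c0 => sy; have [_ _ ] := sy; rewrite trmx0 mul0mx subr0.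
set A := jA x; set B := jB x; set D := jD x => AD.
have EJ : autj 0 D Z = mxZ R D by rewrite /autj mxZ0 mul0mx add0r.
have DA : mxZ R D *m (mxZ R A)^T = 1%:M by rewrite -mxZ_tr -mxZM (mulmx1C AD) mxZ1.
have uD : mxZ R D \in unitmx by case: (mulmx1_unit DA).
rewrite EJ (det_int_sqr AD) invr1 mul1r (_ : invmx (mxZ R D) = (mxZ R A)^T); last first.
  by apply: (can_inj (mulKmx uD)); rewrite (mulmxV uD) DA.
rewrite /autj mulmxDl mulmxDr mxtraceD eD -mxZ_tr -[mxZ R B *m _]mxZM.
rewrite [X in _ * X]e_half_integral_tr//; last first.
  by have [_ sab _ _] := symp_right sy; rewrite trmx_mul trmxK sab.
rewrite mulr1; congr (e _); rewrite /congr_int !mxRM mxR_tr -mxZ_R -mxZ_tr.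
by rewrite !mulmxA mxtrace_mulC !mulmxA.
Qed.

Definition tbot u : 'M[int]_(p, p + p) :=
  row_mx 0 (block_mx (invmx u.1)^T (- ((invmx u.1)^T *m u.2^T)) 0 1%:M).

(** An element over [tbot u] whose [jA] is exactly the matrix B of [delta_set]. *)
Definition tjac u : jacobi n g := (block_mx u.1 0 0 (invmx u.1)^T, (u.2, 0, 0)).

Lemma tjacP u : u.1 \in unitmx -> [/\ Gamma_J (tjac u), bot (tjac u) = tbot u &
  jA (tjac u) = block_mx u.1 0 u.2 1%:M].
Proof.
move=> uu; split.
- split; last by rewrite /heisZ/= mul0mx addr0 trmx0.
  apply/SpP; rewrite /= block_mxKul block_mxKur block_mxKdl block_mxKdr; split.
  + by rewrite mulmx0 trmx0 mul0mx.
  + by rewrite mulmx0 trmx0 mul0mx.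
  + by rewrite mulmx0 subr0 -trmx_mul (mulVmx uu) trmx1.
- rewrite /bot /tbot /jC /jD /= block_mxKdl block_mxKdr trmx0 mul0mx sub0r.
  by rewrite block_mx0.
- by rewrite /jA /= block_mxKul.
Qed.

Lemma tbot_inj u v : u.1 \in unitmx -> v.1 \in unitmx -> tbot u = tbot v -> u = v.
Proof.
case: u v => [A m] [A' m'] /= uA uA' /eq_row_mx[_ /eq_block_mx[E1 E2 _ _]].
have EA : A = A' by rewrite -[A]invmxK -[A']invmxK -[invmx A]trmxK E1 trmxK.
rewrite -EA /= in E2 *; move/oppr_inj: E2.
have uT : (invmx A)^T \in unitmx by rewrite unitmx_tr unitmx_inv.
by move/(can_inj (mulKmx uT))/trmx_inj => ->.
Qed.

(** C = 0 forces d to be the inverse transpose of a, so such a bottom row is the same as a pair (A,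
    lambda). *)
Lemma tbot_bij : set_bij [set u | u.1 \in unitmx]
  [set b | Bots b /\ lsubmx b = 0] tbot.
Proof.
split.
- move=> u uu; have [gx bx _] := tjacP uu; split; last by rewrite row_mxKl.
  by rewrite -bx; exists (tjac u).
- by move=> u v /set_mem uu /set_mem uv; exact: tbot_inj.
- move=> b [[x gx bx] b0]; have sx := jsymp gx.
  have c0 : dlsubmx x.1 = 0.
    move: b0; rewrite -bx row_mxKl /jC -[0 in RHS]block_mx0; first by case/eq_block_mx.
  have [/SpP[_ _]] := gx; rewrite c0 trmx0 mul0mx subr0 => E _.
  have [ua ud] := mulmx1_unit E; rewrite unitmx_tr in ua.
  exists (ulsubmx x.1, x.2.1.1) => //.
  have ED : drsubmx x.1 = (invmx (ulsubmx x.1))^T.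
    have uT : (ulsubmx x.1)^T \in unitmx by rewrite unitmx_tr.
    by apply: (can_inj (mulKmx uT)); rewrite E -trmx_mul (mulVmx ua) trmx1.
  by rewrite -bx /bot /tbot /jC /jD c0 block_mx0 mul0mx sub0r ED.
Qed.

Lemma bterm_tbot u (W : 'M[C]_p) : half_integral L -> u.1 \in unitmx -> domW W ->
  bterm S l r K (tbot u) (symW W) =
  chi (dbl (congr_int (block_mx u.1 0 u.2 1%:M))) W.
Proof.
move=> hL uu dW; have [gx <- <-] := tjacP uu.
rewrite bterm_bot//; last exact: symW_siegel.
rewrite jterm_jC0//; first by rewrite chi_dbl//; exact: half_integral_congr.
by rewrite /jC /= block_mxKdl block_mx0.
Qed.

End Translations.

(** * The difference between the coefficient and [delta] at Im Z = K *)

Section Remainder.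
Variables (R : realType) (n g : nat) (S : 'M[R]_g) (l : 'M[R]_n)
  (r : 'M[int]_(n, g)) (K : nat).
Local Notation C := R[i].
Local Notation p := (n + g)%N.
Local Notation L := (index_mx S l r).
Local Notation N := (NL n g).
Hypotheses (n0 : (0 < n)%N) (pL : posdef L) (hL : half_integral L)
  (NK : (N < K)%N).

(** [bterm_tau_le] with exponent K. Of the K factors 1 / tau, K - NL are at most 1 / K because c is
    integral and non-zero; the other NL make the sum over b converge. *)
Lemma bterm_jC b (Z : 'M[C]_p) : Bots b -> lsubmx b != 0 -> siegelP Z ->
  ImM_ Z = K%:R%:M -> fro (ReM_ Z) <= (p * p)%:R ->
  nm (bterm S l r K b Z) <= (K%:R ^+ p) ^- K * Gbound L K K * K%:R ^- (K - N) *
    (kappa (p%:R * K%:R : R) K%:R (p * p)%:R) ^- N * \prod_i \prod_j wt R (b i j).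
Proof.
move=> bb c0 hZ EZ hx.
have p0 : (0 < p)%N by rewrite addn_gt0 n0.
have K0 : (0 < K)%N by exact: leq_ltn_trans NK.
have k0 : 0 < K%:R :> R by rewrite ltr0n.
have trZ : \tr (ImM_ Z) <= p%:R * K%:R by rewrite EZ mxtrace_scalar -[K%:R *+ _]mulr_natl.
have qZ (v : 'rV_p) : K%:R * fro v <= qf (ImM_ Z) v.
  by rewrite EZ /qf mul_mx_scalar -scalemxAl mxE fro_tr /mxtrace big_ord1.
have hw := tau_pow_le n0 bb hZ k0 (ler0n _ _) trZ qZ hx.
have ht : K%:R <= tauZ (lsubmx b) (rsubmx b) Z.
  have := tau_lower (map_mx intr (lsubmx b))
    (map_mx intr (lsubmx b) *m ReM_ Z + map_mx intr (rsubmx b)) p0 hZ.2 trZ qZ.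
  apply: le_trans; rewrite ler_wpDl//.
    by rewrite divr_ge0 ?fro_ge0// mulr_ge0.
  by rewrite ler_peMr// fro_int_ge1.
apply: le_trans (bterm_tau_le n0 pL (leqnn K) bb hZ) _.
rewrite EZ det_scalar -[leRHS]mulrA -[leRHS]mulrA ler_wpM2l//.
  by rewrite mulr_ge0 ?Gbound_ge0 ?invr_ge0 ?exprn_ge0.
rewrite -{1}(subnK (ltnW NK)) exprD invfM ler_pM ?invr_ge0 ?exprn_ge0 ?(le_trans (ltW k0))//.
by rewrite lef_pV2 ?posrE ?exprn_gt0 ?(lt_le_trans k0)// lerXn2r ?nnegrE ?(ltW k0) ?(le_trans (ltW k0)).
Qed.

Hypotheses (pS : posdef S) (hS : half_integral S) (hl : half_integral l).
Variables (l' : 'M[R]_n) (r' : 'M[int]_(n, g)).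
Local Notation L' := (index_mx S l' r').
Hypothesis hL' : half_integral L'.

Lemma delta_setE (u : 'M[int]_n * 'M[int]_(g, n)) : delta_set S l r l' r' u <->
  u.1 \in unitmx /\ congr_int S l r (block_mx u.1 0 u.2 1%:M) = L'.
Proof.
by rewrite /delta_set /congr_int /mkset map_block_mx map_mx0 map_mx1.
Qed.

Lemma sum_le_card_finite (I : choiceType) (D : set I) (B : R) :
  sum_le D (fun=> 1) B -> finite_set D.
Proof.
move=> hB; apply: contrapT => hD.
have [G GD hG] := infinite_set_fset (Num.truncn (Num.max B 0)).+1 hD.
have := hB G (fun i iG => GD i iG); rewrite big_const_seq count_predT iter_addr_0.
have := truncnS_gt (Num.max B 0); rewrite leNgt => h1 /negP; apply.
apply: (@le_lt_trans _ _ (Num.max B 0)); first by rewrite le_max lexx.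
by apply: lt_le_trans h1 _; rewrite ler_nat.
Qed.

(** The constant of [bterm_jC] times the inverse modulus of the character of L' at Im Z = K. *)
Definition remainder_bound : R :=
  (K%:R ^+ p) ^- K * Gbound L K K * K%:R ^- (K - N) *
  (kappa (p%:R * K%:R : R) K%:R (p * p)%:R) ^- N * expR (2 * pi * \tr L') ^+ K.

(* On the line Im Z = K the terms with vanishing lower left block C are
   characters, which the mean counts; all others are small. *)
Lemma coef_delta_le :
  nm (coef (poincare_lift S l r K) (dbl L') (iR (K%:R / 2)%:M) - (delta S l r l' r')%:R) <=
  remainder_bound * 8 ^+ N.
Proof.
have K0 : (0 < K)%N by exact: leq_ltn_trans NK.
have k0 : 0 < K%:R :> R by rewrite ltr0n.
(* The base point has imaginary part K / 2 because [symW] doubles it. *)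
set W : 'M[C]_p := iR _; set q := dbl L'.
have dW : domW W.
  apply: domW_iR; split; first by rewrite tr_scalar_mx.
  move=> x x0; rewrite mul_mx_scalar -scalemxAl mxE mulr_gt0 ?divr_gt0//.
  by have := fro_gt0 x0; rewrite fro_tr /mxtrace big_ord1.
(* z x moves x into the unit cell: by periodicity the function is unchanged, and real parts become
   bounded as [bterm_jC] requires. *)
have /choice[z hz] := @round_ex R p p.
pose V (x : 'M[R]_p) : 'M[C]_p := W + mxR (x + map_mx intr (z x)).
have EV x : V x = W + mxR x + mxZ R (z x) by rewrite /V mxRD mxR_int addrA.
have dV x : domW (V x) by exact: domW_real.
have EI x : ImM_ (symW (V x)) = K%:R%:M.
  rewrite symW_mxR ImM_D ImM_mxR addr0 ImM_symW ImM_iR tr_scalar_mx.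
  by apply/matrixP => i j; rewrite !mxE -mulrnDl; congr (_ *+ _); field.
have ER x : fro (ReM_ (symW (V x))) <= (p * p)%:R.
  rewrite -[leRHS]mulr1 -sum_mn ler_sum// => i _; rewrite ler_sum// => j _.
  rewrite -[_ ^+ 2]real_normK ?num_real// expr_le1// symW_mxR ReM_D mxE.
  have -> : ReM_ (symW W) i j = 0 by rewrite !mxE !ReD !ReM/= !mulr0 !mul0r subr0 addr0.
  rewrite add0r; move: (hz x i j) (hz x j i); move: (x + _) => y hy1 hy2.
  by rewrite !mxE/= (le_trans (ler_normD _ _))//; lra.
pose F b x := bterm S l r K b (symW (V x)) * chi (- q) (V x).
have [rho r0 [M M0 hM]] := bterm_bound n0 pL (ltnW NK) dW.
have hq x : nm (chi (- q) (V x)) = expR (2 * pi * \tr L') ^+ K.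
  rewrite chiN nmV nm_chi_dbl// -expRN opprK EI mul_mx_scalar mxtraceZ -expR_mulrn.
  by congr expR; rewrite -mulr_natl; ring.
have Fb b x : Bots b -> nm (F b x) <=
    (expR (2 * pi * \tr L') ^+ K * M) * \prod_i \prod_j wt R (b i j).
  move=> bb; rewrite /F nmM hq [leLHS]mulrC -[leRHS]mulrA ler_wpM2l ?exprn_ge0 ?expR_ge0//.
  have := hM (x + map_mx intr (z x)) 0 0 b (hz x) (@small0 _ _ _).
  by rewrite scale0r addr0 nm0 => /(_ (ltW r0) bb)[].
have Fsum x : has_sum (@Bots n g) (F^~ x) (poincare_lift S l r K (W + mxR x) * chi (- q) (W + mxR x)).
  have -> : poincare_lift S l r K (W + mxR x) = poincare_lift S l r K (V x).
    by rewrite EV (lift_periodic n0 pL hL (ltnW NK)).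
  have -> : chi (- q) (W + mxR x) = chi (- q) (V x) by rewrite EV [RHS]chi_add chi_int mulr1.
  rewrite mulrC; apply: eq_has_sum (has_sumZ _ (lift_sum n0 pL (ltnW NK) (dV x))) => b _.
  by rewrite /F mulrC.
have EM0 : 0 <= expR (2 * pi * \tr L') ^+ K * M by rewrite mulr_ge0 ?exprn_ge0 ?expR_ge0.
have hm : has_sum (@Bots n g) (fun b => mean (F b)) (coef (poincare_lift S l r K) q W).
  exact: (mean_has_sum (fun b x bb => Fb b x bb) (sum_le_Bots EM0) Fsum).
(* Orthogonality: the term is itself a character, so its mean against that of - q is 1 or 0. *)
have mF u : u.1 \in unitmx -> mean (F (tbot u)) =
    (dbl (congr_int S l r (block_mx u.1 0 u.2 1%:M)) == q)%:R.
  move=> uu; set c := dbl (congr_int _ _ _ _).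
  have h1 (x : 'M[R]_p) : nm (chi (c - q) (mxR x)) <= 1 by rewrite nm_chi_real.
  transitivity (chi (c - q) W * mean (fun x => chi (c - q) (mxR x))).
    rewrite -(meanZ _ h1); apply: eq_mean => x.
    rewrite /F bterm_tbot// -/c -chiD EV [LHS]chi_add chi_int mulr1.
    exact: chi_add.
  rewrite mean_chi subr_eq0; case: eqP => [->|_]; last by rewrite mulr0.
  by rewrite (_ : chi (q - q) W = 1) ?mulr1// subrr chi0.
have mF1 u : delta_set S l r l' r' u -> mean (F (tbot u)) = 1.
  by move=> /delta_setE[uu E]; rewrite mF// E eqxx.
have [B hB] := has_sum_abs hm.
have tB (u : 'M[int]_n * 'M[int]_(g, n)) : u.1 \in unitmx -> Bots (tbot u).
  by move=> uu; have [h _ _] := tbot_bij n g; have [] := h u uu.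
(* Each element contributes a mean equal to 1 to an absolutely convergent series, so there are
   finitely many. *)
have fD : finite_set (delta_set S l r l' r').
  apply: (@sum_le_card_finite _ _ B).
  apply: (@sum_le_le _ _ _ _ (fun u => nm (mean (F (tbot u))))).
    by move=> u hu; rewrite mF1// nm1.
  have inj u v : delta_set S l r l' r' u -> delta_set S l r l' r' v ->
      tbot u = tbot v -> u = v.
    by move=> /delta_setE[uu _] /delta_setE[uv _]; exact: tbot_inj.
  have sub u : delta_set S l r l' r' u -> Bots (tbot u).
    by move=> /delta_setE[uu _]; exact: tB.
  exact: (sum_le_inj sub inj hB).
have hd : has_sum (delta_set S l r l' r') (fun u => mean (F (tbot u))) (delta S l r l' r')%:R.
  apply: (@eq_has_sum _ _ _ (fun=> 1)) => [u /mF1//|].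
  have := has_sum_fset (fset_set (delta_set S l r l' r')) (fun=> 1 : C).
  by rewrite fset_setK// big_const_seq count_predT iter_addr_0.
have hd2 : has_sum [set u | u.1 \in unitmx] (fun u => mean (F (tbot u)))
    (delta S l r l' r')%:R.
  apply/(@has_sum_sub _ _ (delta_set S l r l' r')) => //.
    by move=> u /delta_setE[].
  move=> u uu hu; rewrite mF//; case: eqP => // E; exfalso; apply: hu.
  by apply/delta_setE; split=> //; apply: dbl_inj E => //; exact: half_integral_congr.
have hd3 := proj1 (has_sum_reindex (fun b => mean (F b)) _ (tbot_bij n g)) hd2.
(* G keeps the terms with C = 0, whose means sum to [delta]; what remains is the sum over C <> 0. *)
pose G b := if lsubmx b == 0 then mean (F b) else 0.
have hG : has_sum (@Bots n g) G (delta S l r l' r')%:R.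
  apply/(@has_sum_sub _ _ [set b | Bots b /\ lsubmx b = 0]).
  - by move=> b [].
  - by move=> b bb hb; rewrite /G; case: eqP => // b0; case: hb.
  - by apply: eq_has_sum hd3 => b [_ b0]; rewrite /G b0 eqxx.
have hdiff := has_sumD hm (has_sumZ (-1) hG).
rewrite mulN1r in hdiff.
have rb0 : 0 <= remainder_bound.
  rewrite mulr_ge0 ?exprn_ge0 ?expR_ge0// mulr_ge0//; last first.
    rewrite invr_ge0 exprn_ge0// divr_ge0// ?le_min ?invr_ge0 ?(ltW k0) ?mulr_ge0//.
  rewrite mulr_ge0 ?invr_ge0 ?exprn_ge0// mulr_ge0 ?Gbound_ge0 ?invr_ge0 ?exprn_ge0//.
  by rewrite addn_gt0 n0.
apply: has_sum_le (sum_le_Bots rb0) hdiff => b bb; rewrite mulN1r /G.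
have w0 : 0 <= \prod_i \prod_j wt R (b i j).
  by rewrite prodr_ge0// => i _; rewrite prodr_ge0// => j _; exact: wt_ge0.
have [b0|b0] := eqVneq (lsubmx b) 0; first by rewrite subrr nm0 mulr_ge0.
rewrite subr0; apply: mean_le => x; rewrite /F nmM hq /remainder_bound [leRHS]mulrAC.
by rewrite ler_wpM2r ?exprn_ge0 ?expR_ge0// bterm_jC//; exact: symW_siegel.
Qed.

End Remainder.

(** * Passage to the limit *)

Section Limit.
Variables (R : realType) (n g : nat) (S : 'M[R]_g) (l : 'M[R]_n)
  (r : 'M[int]_(n, g)) (l' : 'M[R]_n) (r' : 'M[int]_(n, g)).
Local Notation p := (n + g)%N.
Local Notation N := (NL n g).
Hypotheses (n0 : (0 < n)%N) (pL : posdef (index_mx S l r)).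

(** Collecting powers of k = K gives (p c0)^N A^K k^(-K) k^(2N - K), at most (p c0)^N (A / k)^K once
    K >= 2 N. *)
Lemma remainder_bound_lim : exists2 D : R, 0 <= D & exists K0, forall K, (K0 <= K)%N ->
  remainder_bound S l r K l' r' <= D * 2^-1 ^+ K.
Proof.
have p0 : (0 < p)%N by rewrite addn_gt0 n0.
pose c0 : R := 2 * (3 + 2 * (p * p)%:R).
have c00 : 0 < c0 by rewrite mulr_gt0// ltr_pwDl// mulr_ge0.
pose t := \tr (invmx (index_mx S l r)).
have t0 : 0 <= t by apply/ltW/posdef_tr_gt0 => //; exact: posdef_inv.
pose E := expR (2 * pi * \tr (index_mx S l' r')).
pose A : R := p`!%:R * (p.-1%:R * t / (2 * pi)) ^+ p.-1 * E.
have A0 : 0 <= A.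
  rewrite mulr_ge0 ?expR_ge0// mulr_ge0// exprn_ge0// divr_ge0 ?mulr_ge0//.
  exact: pi_ge0.
have pR : 0 < p%:R :> R by rewrite ltr0n.
exists ((p%:R * c0) ^+ N); first by rewrite exprn_ge0// mulr_ge0 ?ltW.
(* The first threshold makes k^(2N - K) <= 1, the second A / k <= 1/2. *)
exists (maxn (N.+1 + N.+1) (Num.truncn (2 * A)).+1) => K; rewrite geq_max => /andP[NK2 KA].
have NK : (N + N <= K)%N by lia.
have K0 : (0 < K)%N by lia.
set k : R := K%:R.
have k0 : 0 < k by rewrite ltr0n.
have k1 : 1 <= k by rewrite ler1n.
have hA : A / k <= 2^-1.
  have h2A : 2 * A <= k by apply/ltW/(lt_le_trans (truncnS_gt _)); rewrite ler_nat.
  by rewrite ler_pdivrMr//; lra.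
have hk : kappa (p%:R * k) k (p * p)%:R = (p%:R * c0 * k)^-1.
  rewrite /kappa -/c0 min_l; last first.
    apply: (@le_trans _ _ 1) => //; rewrite invf_le1 ?mulr_gt0// mulr_ege1//.
    by rewrite ler1n.
  by rewrite -invfM mulrAC.
have pK : (p * K - K = p.-1 * K)%N by rewrite -{2}[K]mul1n -mulnBl subn1.
have EG : Gbound (index_mx S l r) K K * E ^+ K = A ^+ K * k ^+ (p.-1 * K).
  rewrite /Gbound pK -/t natrM -/k /A !exprMn -exprM -mulrA mulrAC -!mulrA.
  by rewrite -!exprM [E ^+ K * _]mulrC.
clearbody A; rewrite /remainder_bound -/k -/E hk -[_^-1 ^- _]exprVn invrK exprMn.
have -> : (k ^+ p) ^- K * Gbound (index_mx S l r) K K * k ^- (K - N) *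
   ((p%:R * c0) ^+ N * k ^+ N) * E ^+ K = (p%:R * c0) ^+ N * (A ^+ K * (k ^+ (p.-1 * K) *
     (k ^+ p) ^- K * k ^- (K - N) * k ^+ N)).
  move: EG; move: (Gbound _ _ _) (E ^+ K) (A ^+ K) ((k ^+ p) ^- K) (k ^- (K - N)) (k ^+ N)
    (k ^+ (p.-1 * K)) ((p%:R * c0) ^+ N) => a1 a2 a3 a4 a5 a6 a7 a8 e1.
  by transitivity (a1 * a2 * (a4 * a5 * a8 * a6)); [ring | rewrite e1; ring].
rewrite ler_wpM2l//; first by rewrite exprn_ge0// mulr_ge0// ltW.
apply: (@le_trans _ _ ((A / k) ^+ K)); last first.
  by rewrite lerXn2r// nnegrE ?divr_ge0 ?invr_ge0// ltW.
rewrite exprMn ler_wpM2l ?exprn_ge0// exprVn.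
have -> : k ^+ (p.-1 * K) * (k ^+ p) ^- K = k ^- K.
  rewrite -exprM -{2}(prednK p0) mulSn exprD invfM mulrCA divff ?mulr1//.
  by rewrite expf_neq0// gt_eqF.
rewrite -mulrA ler_piMr ?invr_ge0 ?exprn_ge0 ?(ltW k0)//.
rewrite mulrC ler_pdivrMr ?exprn_gt0// mul1r ler_weXn2l//.
by lia.
Qed.

End Limit.

Lemma posdef_index_half (R : realType) (n g : nat) (S : 'M[R]_g) (l : 'M[R]_n)
    (r : 'M[int]_(n, g)) : Lambda_pos S -> Lambda_pos l -> posdef (disc S l r) ->
  posdef (index_mx S l r) /\ half_integral (index_mx S l r).
Proof.
move=> hS hl hd; split; first by apply/posdef_index => //; case: hS.
by apply: half_integral_index; exact: Lambda_half.
Qed.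

Unset Implicit Arguments.

Theorem proposition3p1 (R : realType) (n g : nat) (hn : (0 < n)%N)
    (hg : (0 < g)%N) (S : 'M[R]_g) (l l' : 'M[R]_n) (r r' : 'M[int]_(n, g)) :
  Lambda_pos S -> Lambda_pos l -> Lambda_pos l' -> posdef (disc S l r) ->
  (fun m : nat => fourier_coef S (poincare m.*2 S l r) l' r') @ \oo
    --> ((delta S l r l' r')%:R : R[i]^o).
Proof.
move=> hS hl hl' hd; have [pL hL] := posdef_index_half hS hl hd.
have hL' : half_integral (index_mx S l' r') by apply: half_integral_index; exact: Lambda_half.
have pS : posdef S by case: hS.
have [D D0 [K0 hK0]] := remainder_bound_lim l' r' hn pL.
have DN0 : 0 <= D * 8 ^+ NL n g by rewrite mulr_ge0.
apply/(@cvgrPdist_lt _ (R[i]^o)) => eps e0.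
(* A positive element of [R[i]] has imaginary part 0. *)
have eE : eps = (complex.Re eps)%:C.
  by case: eps e0 => a b; rewrite ltcE/= => /andP[/eqP-> _].
have re0 : 0 < complex.Re eps by move: e0; rewrite eE ltcR.
have h2 : 0 <= (2^-1 : R) < 1 by rewrite invr_ge0 ler0n invf_lt1// ltr1n.
have [K1 hK1] := geom_lim0 h2 (divr_gt0 re0 (ltr_wpDl DN0 ltr01)).
near=> K.
have KN : (NL n g < K)%N by near: K; exact: nbhs_infty_ge.
have K01 : (K0 <= K)%N by near: K; exact: nbhs_infty_ge.
have K11 : (K1 <= K)%N by near: K; exact: nbhs_infty_ge.
rewrite eE ltc_nm nmBC.
(* [fourier_coefE] holds at every point of [domW]; this one, depending on K, is the base point of
   [coef_delta_le]. *)
rewrite (fourier_coefE hn pS (Lambda_half hS) (Lambda_half hl) pL KN r' hl'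
  (W := iR (K%:R / 2)%:M)); last first.
  apply: domW_iR; split; first by rewrite tr_scalar_mx.
  move=> x x0; rewrite mul_mx_scalar -scalemxAl mxE mulr_gt0 ?divr_gt0// ?ltr0n.
    by apply: leq_ltn_trans KN.
  by have := fro_gt0 x0; rewrite fro_tr /mxtrace big_ord1.
apply: le_lt_trans (coef_delta_le hn pL hL KN hL') _.
apply: (@le_lt_trans _ _ (D * 8 ^+ NL n g * 2^-1 ^+ K)).
  by rewrite [leRHS]mulrAC ler_wpM2r// hK0.
apply: (@le_lt_trans _ _ ((D * 8 ^+ NL n g + 1) * 2^-1 ^+ K1)).
  rewrite ler_pM ?exprn_ge0 ?invr_ge0// ?lerDl//.
  by rewrite ler_wiXn2l// ?invr_ge0// invf_le1// ler1n.
by rewrite mulrC -ltr_pdivlMr// ltr_wpDl.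
Unshelve. all: end_near.
Qed.
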